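(* Let $k$ be an algebraically closed field, let $Q$ be a finite quiver, let $J\subseteq kQ$ be the two-sided ideal generated by all arrows of $Q$, and let $m$ be a positive integer. Then there is an isomorphism of quasi-hereditary algebras $$N_m(Q)\cong E_{kQ/J^m}^{\mathrm{ADR}}$$ if and only if all indecomposable projective $kQ/J^m$-modules have Loewy length $m$; i.e. $Q$ contains no sinks and $m$ is arbitrary, or $m=1$ and $Q$ is arbitrary.
   Context: Modules are finitely generated left modules; in path algebras the product $pq$ is the path $q$ followed by the path $p$; products in endomorphism algebras are compositions. A sink is a vertex with no outgoing arrow. For an arrow $a$, $t(a)$ is its source (tail) and $h(a)$ its target (head). Nilpotent quiver algebra. For $Q=(Q_0,Q_1)$ finite and $s\ge1$, the staircase quiver $Q^{(s)}$ has vertices $i_l$ for $i\in Q_0$, $1\le l\le s$, and arrows $b(i_l):i_{l+1}\to i_l$ for $i\in Q_0$, $1\le l\le s-1$, and $a_l:h(a)_{l-1}\to t(a)_l$ for $a\in Q_1$, $2\le l\le s$. Then $N_s(Q)$ is the quotient of $kQ^{(s)}$ by the two-sided ideal generated by the relations $b(t(a)_l)\,a_{l+1}=a_l\,b(h(a)_{l-1})$ for $a\in Q_1$, $2\le l\le s-1$, and $b(t(a)_1)\,a_2=0$ for $a\in Q_1$ (when $s\ge 2$). Its quasi-hereditary structure is given by the layer function $L(i_t)=s-t$ on vertices (= simple modules), with $S<S'$ iff $L(S)<L(S')$. ADR algebra. For a finite dimensional algebra $R$ of Loewy length $L_R$, $\mathrm{ADR}(R)$ is the direct sum, up to isomorphism,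 of all indecomposables in the additive category generated by $Re/\operatorname{rad}^iRe$, $e$ a primitive idempotent, $1\le i\le L_R$, and $E_R^{\mathrm{ADR}}:=\operatorname{End}_R(\mathrm{ADR}(R))$. Its simple modules $S(N)$ are indexed by the indecomposable summands $N$ of $\mathrm{ADR}(R)$ ($S(N)$ is the top of $\operatorname{Hom}_R(N,\mathrm{ADR}(R))$), and it is quasi-hereditary for the layer function $S(Re/\operatorname{rad}^lRe)\mapsto L_R-l$ ($1\le l\le$ Loewy length of $Re$), with $S<S'$ iff the layer of $S$ is smaller than that of $S'$. For a partial order on the simples $S_i$ of an algebra, the standard module $\Delta_i$ is the largest quotient of the projective cover $P_i$ all of whose composition factors $S_j$ satisfy $j\le i$. An isomorphism of quasi-hereditary algebras is an algebra isomorphism identifying the standard modules (i.e. the quasi-hereditary structures). *)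

(* Defs.v *)
From HB Require Import structures.
From mathcomp Require Import all_boot all_algebra.
From mathcomp Require Import boolp classical_sets functions.
From mathcomp Require Import finmap monalg.

Set Implicit Arguments.
Unset Strict Implicit.
Unset Printing Implicit Defensive.

Import GRing.Theory.
Import Quotient.

Local Open Scope ring_scope.
Local Open Scope quotient_scope.

Record submod (A : pzRingType) (M : lmodType A) := Submod {
  submod_pred :> {pred M};
  submodP : submod_closed submod_pred
}.

HB.instance Definition _ (A : pzRingType) (M : lmodType A) (U : submod M) :=
  GRing.isSubmodClosed.Build A M (submod_pred U)
    (GRing.submod_closed_semi (submodP U)).

Section Submodules.
Variables (A : pzRingType) (M : lmodType A).

Fact topsub_closed : submod_closed (fun _ : M => true).
Proof. by []. Qed.
Definition topsub : submod M := Submod topsub_closed.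

Definition issub (U V : submod M) := {subset U <= V}.
Definition iszero (U : submod M) := forall x, x \in U -> x = 0.
Definition isfull (U : submod M) := forall x, x \in U.

End Submodules.

Section Submodule.
Variables (A : pzRingType) (M : lmodType A) (U : submod M).

Definition smod : Type := {x : M | x \in U}.
HB.instance Definition _ := SubChoice.on smod.

HB.instance Definition _ := GRing.SubChoice_isSubLmodule.Build A M
  (fun x : M => x \in U) smod (GRing.submod_closed_semi (submodP U)).

End Submodule.

Section QuotientModule.
Variables (A : pzRingType) (M : lmodType A) (U : submod M).

Definition qmod : Type := {quot U}.
HB.instance Definition _ := GRing.Zmodule.on qmod.
HB.instance Definition _ := EqQuotient.on qmod.

Definition qscale (a : A) (x : qmod) : qmod := \pi_qmod (a *: repr x).

Fact qmod_eqE (x y : M) : (\pi_qmod x == \pi_qmod y) = (x - y \in U).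
Proof. by rewrite (idealrBE U). Qed.

Fact qmodD (x y : M) : \pi_qmod (x + y) = \pi_qmod x + \pi_qmod y.
Proof. exact: (pi_add U). Qed.

Fact qmodZ a (x : M) : \pi_qmod (a *: x) = qscale a (\pi_qmod x).
Proof.
apply/eqP; rewrite /qscale qmod_eqE -scalerBr rpredZ //.
by rewrite -qmod_eqE reprK.
Qed.

Fact qscaleA a b x : qscale a (qscale b x) = qscale (a * b) x.
Proof.
by rewrite -[x]reprK; move: (repr x) => y; rewrite -(qmodZ b y) -!qmodZ scalerA.
Qed.
Fact qscale1 : left_id 1 qscale.
Proof. by move=> x; rewrite -[x]reprK -qmodZ scale1r. Qed.
Fact qscaleDr : right_distributive qscale +%R.
Proof.
by move=> a x y; rewrite -[x]reprK -[y]reprK -qmodD -!qmodZ -qmodD scalerDr.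
Qed.
Fact qscaleDl x : {morph qscale^~ x : a b / a + b}.
Proof. by move=> a b; rewrite -[x]reprK -!qmodZ -qmodD scalerDl. Qed.

HB.instance Definition _ := GRing.Zmodule_isLmodule.Build A qmod
  qscaleA qscale1 qscaleDr qscaleDl.

End QuotientModule.

Section SubQuotient.
Variables (A : pzRingType) (M : lmodType A) (V U : submod M).

Fact restr_closed : submod_closed (fun x : smod V => val x \in U).
Proof.
split=> [|a x y xU yU]; first exact: rpred0.
rewrite unfold_in in xU; rewrite unfold_in in yU.
by rewrite unfold_in linearP rpredD ?rpredZ.
Qed.
Definition restr : submod (smod V) := Submod restr_closed.

(* V / U when U is contained in V (in general V / (U \cap V)) *)
Definition subquot : lmodType A := qmod restr.

End SubQuotient.

Section Radical.
Variables (A : pzRingType) (M : lmodType A).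
Implicit Types U V W : submod M.

Definition maximal_in V U :=
  [/\ issub V U, ~ issub U V &
      forall W, issub V W -> issub W U -> issub W V \/ issub U W].

Fact rad_closed U :
  submod_closed
    (fun x => `[< x \in U /\ forall V, maximal_in V U -> x \in V >]).
Proof.
split=> [|a x y /asboolP[xU xV] /asboolP[yU yV]]; apply/asboolP.
  by split=> [|V _]; exact: rpred0.
split=> [|V mV]; first by rewrite rpredD ?rpredZ.
by rewrite rpredD ?rpredZ //; [exact: xV|exact: yV].
Qed.
(* the radical of the module U, as a submodule of M *)
Definition rad U : submod M := Submod (rad_closed U).
Definition radpow n : submod M := iter n rad (topsub M).

(* 0 if no iterated radical of M vanishes *)
Definition loewy_length : nat :=
  xget 0%N [set n | iszero (radpow n) /\
                    forall j, iszero (radpow j) -> (n <= j)%N].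

End Radical.

Definition topmod (A : pzRingType) (M : lmodType A) : lmodType A :=
  qmod (radpow M 1).

Section ModuleNotions.
Variable A : pzRingType.
Implicit Types M N P S : lmodType A.

Definition miso M N := exists f : {linear M -> N}, bijective f.

Definition nonzero_mod M := exists x : M, x <> 0.

Definition simple_mod M :=
  nonzero_mod M /\ forall U : submod M, iszero U \/ isfull U.

Definition indecomposable M :=
  nonzero_mod M /\
  forall U V : submod M,
    (forall x, exists u v, [/\ u \in U, v \in V & x = u + v]) ->
    (forall x, x \in U -> x \in V -> x = 0) ->
    iszero U \/ iszero V.

Definition fingen M :=
  exists n (g : 'I_n -> M),
    forall x, exists c : 'I_n -> A, x = \sum_i c i *: g i.

Definition onto (X Y : Type) (f : X -> Y) := forall y, exists x, f x = y.

Definition projective P :=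
  forall M N (g : {linear M -> N}) (f : {linear P -> N}),
    onto g -> exists h : {linear P -> M}, forall x, g (h x) = f x.

Definition projective_cover P S (p : {linear P -> S}) :=
  [/\ projective P, onto p &
      forall U : submod P,
        (forall x, exists u v, [/\ u \in U, p v = 0 & x = u + v]) -> isfull U].

Definition comp_series M n (U : nat -> submod M) :=
  [/\ iszero (U 0%N), isfull (U n) &
      forall i, (i < n)%N ->
        issub (U i) (U i.+1) /\ simple_mod (subquot (U i.+1) (U i))].

Definition comp_factor M S :=
  exists n (U : nat -> submod M) i,
    [/\ comp_series n U, (i < n)%N & miso S (subquot (U i.+1) (U i))].

End ModuleNotions.

Section DirectSum.
Variables (A : pzRingType) (I : finType) (N : I -> lmodType A).

Definition dsum : Type := forall i, N i.
HB.instance Definition _ := gen_eqMixin dsum.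
HB.instance Definition _ := gen_choiceMixin dsum.

Implicit Types f g h : dsum.

Definition dsum_add f g : dsum := fun i => f i + g i.
Definition dsum_opp f : dsum := fun i => - f i.
Definition dsum_zero : dsum := fun=> 0.
Definition dsum_scale a f : dsum := fun i => a *: f i.

Fact dsum_addA : associative dsum_add.
Proof. by move=> f g h; apply: functional_extensionality_dep => i; apply: addrA. Qed.
Fact dsum_addC : commutative dsum_add.
Proof. by move=> f g; apply: functional_extensionality_dep => i; apply: addrC. Qed.
Fact dsum_add0 : left_id dsum_zero dsum_add.
Proof. by move=> f; apply: functional_extensionality_dep => i; apply: add0r. Qed.
Fact dsum_addN : left_inverse dsum_zero dsum_opp dsum_add.
Proof. by move=> f; apply: functional_extensionality_dep => i; apply: addNr. Qed.
HB.instance Definition _ := GRing.isZmodule.Build dsum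
  dsum_addA dsum_addC dsum_add0 dsum_addN.

Fact dsum_scaleA a b f : dsum_scale a (dsum_scale b f) = dsum_scale (a * b) f.
Proof. by apply: functional_extensionality_dep => i; apply: scalerA. Qed.
Fact dsum_scale1 : left_id 1 dsum_scale.
Proof. by move=> f; apply: functional_extensionality_dep => i; apply: scale1r. Qed.
Fact dsum_scaleDr : right_distributive dsum_scale +%R.
Proof. by move=> a f g; apply: functional_extensionality_dep => i; apply: scalerDr. Qed.
Fact dsum_scaleDl f : {morph dsum_scale^~ f : a b / a + b}.
Proof. by move=> a b; apply: functional_extensionality_dep => i; apply: scalerDl. Qed.
HB.instance Definition _ := GRing.Zmodule_isLmodule.Build A dsum
  dsum_scaleA dsum_scale1 dsum_scaleDr dsum_scaleDl.

End DirectSum.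

Section Hom.
Variables (A : pzRingType) (M N : lmodType A).

Record hom : Type := Hom { hom_fun :> M -> N; hom_linear : linear hom_fun }.
HB.instance Definition _ := gen_eqMixin hom.
HB.instance Definition _ := gen_choiceMixin hom.
HB.instance Definition _ (f : hom) :=
  GRing.isLinear.Build A M N *:%R (hom_fun f) (hom_linear f).

Definition mkhom (f : {linear M -> N}) : hom := Hom (linearP f).

Fact homP (f g : hom) : f =1 g -> f = g.
Proof.
case: f g => [f fl] [g gl] /= /funext fg.
by case: _ / fg in gl *; congr Hom; exact: Prop_irrelevance.
Qed.

Implicit Types f g h : hom.
Definition hom_add f g : hom := mkhom (f \+ g).
Definition hom_opp f : hom := mkhom (\- f).
Definition hom_zero : hom := mkhom \0.

Fact hom_addA : associative hom_add.
Proof. by move=> f g h; apply: homP => x; apply: addrA. Qed.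
Fact hom_addC : commutative hom_add.
Proof. by move=> f g; apply: homP => x; apply: addrC. Qed.
Fact hom_add0 : left_id hom_zero hom_add.
Proof. by move=> f; apply: homP => x; apply: add0r. Qed.
Fact hom_addN : left_inverse hom_zero hom_opp hom_add.
Proof. by move=> f; apply: homP => x; apply: addNr. Qed.
HB.instance Definition _ := GRing.isZmodule.Build hom
  hom_addA hom_addC hom_add0 hom_addN.

End Hom.

Definition hom_comp (A : pzRingType) (L M N : lmodType A)
  (g : hom M N) (f : hom L M) : hom L N := mkhom (g \o f).

Section Endo.
Variables (A : pzRingType) (N : lmodType A).

Definition endo : Type := hom N N.
HB.instance Definition _ := GRing.Zmodule.on endo.

Definition endo_one : endo := mkhom idfun.
Definition endo_mul (g f : endo) : endo := hom_comp g f.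

Fact endo_mulA : associative endo_mul.
Proof. by move=> f g h; apply: homP. Qed.
Fact endo_mul1 : left_id endo_one endo_mul.
Proof. by move=> f; apply: homP. Qed.
Fact endo_1mul : right_id endo_one endo_mul.
Proof. by move=> f; apply: homP. Qed.
Fact endo_mulDl : left_distributive endo_mul +%R.
Proof. by move=> f g h; apply: homP. Qed.
Fact endo_mulDr : right_distributive endo_mul +%R.
Proof. by move=> f g h; apply: homP => x; apply: (raddfD f). Qed.
HB.instance Definition _ := GRing.Zmodule_isPzRing.Build endo
  endo_mulA endo_mul1 endo_1mul endo_mulDl endo_mulDr.

(* Hom(M, N) as a left End(N)-module *)
Variable M : lmodType A.
Definition homl : Type := hom M N.
HB.instance Definition _ := GRing.Zmodule.on homl.

Definition homl_scale (g : endo) (f : homl) : homl := hom_comp g f.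

Fact homl_scaleA a b f : homl_scale a (homl_scale b f) = homl_scale (a * b) f.
Proof. exact: homP. Qed.
Fact homl_scale1 : left_id 1 homl_scale.
Proof. by move=> f; apply: homP. Qed.
Fact homl_scaleDr : right_distributive homl_scale +%R.
Proof. by move=> a f g; apply: homP => x; apply: (raddfD (a)). Qed.
Fact homl_scaleDl f : {morph homl_scale^~ f : a b / a + b}.
Proof. by move=> a b; apply: homP. Qed.
HB.instance Definition _ := GRing.Zmodule_isLmodule.Build endo homl
  homl_scaleA homl_scale1 homl_scaleDr homl_scaleDl.

End Endo.

Definition pullback (A B : pzRingType) (f : {rmorphism A -> B})
  (M : lmodType B) : Type := M.

Section Pullback.
Variables (A B : pzRingType) (f : {rmorphism A -> B}) (M : lmodType B).
Local Notation fM := (pullback f M).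

HB.instance Definition _ := GRing.Zmodule.on fM.

Definition pb_scale (a : A) (x : fM) : fM := f a *: (x : M).

Fact pb_scaleA a b x : pb_scale a (pb_scale b x) = pb_scale (a * b) x.
Proof. by rewrite /pb_scale rmorphM; apply: scalerA. Qed.
Fact pb_scale1 : left_id 1 pb_scale.
Proof. by move=> x; rewrite /pb_scale rmorph1; apply: scale1r. Qed.
Fact pb_scaleDr : right_distributive pb_scale +%R.
Proof. by move=> a x y; apply: scalerDr. Qed.
Fact pb_scaleDl x : {morph pb_scale^~ x : a b / a + b}.
Proof. by move=> a b; rewrite /pb_scale rmorphD; apply: scalerDl. Qed.
HB.instance Definition _ := GRing.Zmodule_isLmodule.Build A fM
  pb_scaleA pb_scale1 pb_scaleDr pb_scaleDl.

End Pullback.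

(* The library's [algType] is restricted to nonzero rings, which would exclude
   the path algebra of the empty quiver. *)

Record kalg (k : fieldType) := KAlg {
  kring :> pzRingType;
  kscal : {rmorphism k -> kring};
  kscalC : forall c x, kscal c * x = x * kscal c
}.

Record ideal (A : pzRingType) := Ideal {
  ideal_pred :> {pred A};
  ideal_zmod : zmod_closed ideal_pred;
  ideal_mul : forall a x, x \in ideal_pred ->
    a * x \in ideal_pred /\ x * a \in ideal_pred
}.

HB.instance Definition _ (A : pzRingType) (I : ideal A) :=
  GRing.isZmodClosed.Build A (ideal_pred I) (ideal_zmod I).

Section Ideals.
Variable A : pzRingType.

Section Generated.
Variable S : A -> Prop.

Definition idealgen_pred : pred A :=
  fun x => `[< forall I : ideal A, (forall s, S s -> s \in I) -> x \in I >].
Fact idealgen_zmod : zmod_closed idealgen_pred.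
Proof.
split=> [|x y /asboolP xI /asboolP yI]; apply/asboolP => I SI.
  exact: rpred0.
by rewrite rpredB ?xI ?yI.
Qed.
Fact idealgen_mul a x : x \in idealgen_pred ->
  a * x \in idealgen_pred /\ x * a \in idealgen_pred.
Proof.
move=> /asboolP xI; split; apply/asboolP => I SI.
  by have [] := ideal_mul a (xI I SI).
by have [] := ideal_mul a (xI I SI).
Qed.
Definition idealgen : ideal A := Ideal idealgen_zmod idealgen_mul.
End Generated.

Definition ideal_prod (I J : ideal A) : ideal A :=
  idealgen (fun x => exists y z, [/\ y \in I, z \in J & x = y * z]).

Fixpoint ideal_exp (I : ideal A) (n : nat) : ideal A :=
  if n is n'.+1 then ideal_prod I (ideal_exp I n') else idealgen (fun=> True).

End Ideals.

Section QuotientRing.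
Variables (A : pzRingType) (I : ideal A).

Definition qring : Type := {quot I}.
HB.instance Definition _ := GRing.Zmodule.on qring.
HB.instance Definition _ := EqQuotient.on qring.

Definition qmul (x y : qring) : qring := \pi_qring (repr x * repr y).
Definition qone : qring := \pi_qring 1.

Fact qring_eqE (x y : A) : (\pi_qring x == \pi_qring y) = (x - y \in I).
Proof. by rewrite (idealrBE I). Qed.

Fact qringD (x y : A) : \pi_qring (x + y) = \pi_qring x + \pi_qring y.
Proof. exact: (pi_add I). Qed.

Fact qringM (x y : A) : \pi_qring (x * y) = qmul (\pi_qring x) (\pi_qring y).
Proof.
apply/eqP; rewrite /qmul qring_eqE.
set x' := repr _; set y' := repr _.
have xI : x - x' \in I by rewrite -qring_eqE reprK.
have yI : y - y' \in I by rewrite -qring_eqE reprK.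
have -> : x * y - x' * y' = (x - x') * y + x' * (y - y').
  by rewrite mulrBl mulrBr addrA subrK.
by rewrite rpredD; [|case: (ideal_mul y xI)|case: (ideal_mul x' yI)].
Qed.

Fact qmulA : associative qmul.
Proof.
move=> x y z; rewrite -[x]reprK -[y]reprK -[z]reprK.
move: (repr x) (repr y) (repr z) => {}x {}y {}z.
by rewrite -(qringM y z) -(qringM x y) -!qringM mulrA.
Qed.
Fact qmul1 : left_id qone qmul.
Proof. by move=> x; rewrite -[x]reprK -qringM mul1r. Qed.
Fact q1mul : right_id qone qmul.
Proof. by move=> x; rewrite -[x]reprK -qringM mulr1. Qed.
Fact qmulDl : left_distributive qmul +%R.
Proof.
move=> x y z; rewrite -[x]reprK -[y]reprK -[z]reprK.
move: (repr x) (repr y) (repr z) => {}x {}y {}z.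
by rewrite -qringD -!qringM -qringD mulrDl.
Qed.
Fact qmulDr : right_distributive qmul +%R.
Proof.
move=> x y z; rewrite -[x]reprK -[y]reprK -[z]reprK.
move: (repr x) (repr y) (repr z) => {}x {}y {}z.
by rewrite -qringD -!qringM -qringD mulrDr.
Qed.
HB.instance Definition _ := GRing.Zmodule_isPzRing.Build qring
  qmulA qmul1 q1mul qmulDl qmulDr.

Definition qproj (x : A) : qring := \pi_qring x.
Fact qproj_zmod : zmod_morphism qproj.
Proof.
move=> x y; apply: (addIr (\pi_qring y)).
by rewrite /qproj -qringD !subrK.
Qed.
Fact qproj_monoid : monoid_morphism qproj.
Proof. by split=> // x y; exact: qringM. Qed.
HB.instance Definition _ := GRing.isZmodMorphism.Build A qring qproj qproj_zmod.
HB.instance Definition _ := GRing.isMonoidMorphism.Build A qring qproj qproj_monoid.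

End QuotientRing.

Section QuotientAlgebra.
Variables (k : fieldType) (A : kalg k) (I : ideal A).

Definition qscal : {rmorphism k -> qring I} := qproj I \o kscal A.
Fact qscalC c x : qscal c * x = x * qscal c.
Proof.
by rewrite -[x]reprK -[\pi _]/(qproj I _) /= -!rmorphM kscalC.
Qed.
Definition qalg : kalg k := KAlg qscalC.

End QuotientAlgebra.

Section EndoAlgebra.
Variables (k : fieldType) (A : kalg k) (N : lmodType A).

Fact endo_scal_linear (c : k) : linear (fun x : N => kscal A c *: x).
Proof. by move=> a x y; rewrite scalerDr !scalerA kscalC. Qed.
Definition endo_scal (c : k) : endo N := Hom (endo_scal_linear c).
Fact endo_scal_zmod : zmod_morphism endo_scal.
Proof. by move=> c d; apply: homP => x; rewrite /= rmorphB scalerBl. Qed.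
Fact endo_scal_monoid : monoid_morphism endo_scal.
Proof.
split=> [|c d]; apply: homP => x /=; first by rewrite rmorph1 scale1r.
by rewrite rmorphM scalerA.
Qed.
HB.instance Definition _ :=
  GRing.isZmodMorphism.Build k (endo N) endo_scal endo_scal_zmod.
HB.instance Definition _ :=
  GRing.isMonoidMorphism.Build k (endo N) endo_scal endo_scal_monoid.
Fact endo_scalC c (f : endo N) : endo_scal c * f = f * endo_scal c.
Proof. by apply: homP => x /=; rewrite linearZ. Qed.
Definition endalg : kalg k :=
  @KAlg k (endo N) endo_scal endo_scalC.

End EndoAlgebra.

(* [tl a] is the source and [hd a] the target of the arrow [a] *)
Record quiver := Quiver {
  vert : finType;
  arr : finType;
  tl : arr -> vert;
  hd : arr -> vert
}.

Section Paths.
Variable Q : quiver.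

(* [w] lists the arrows in the order in which they are traversed from [x] *)
Fixpoint is_walk (x : vert Q) (w : seq (arr Q)) : bool :=
  if w is a :: w' then (tl a == x) && is_walk (hd a) w' else true.

Definition qpath : Type := {p : vert Q * seq (arr Q) | is_walk p.1 p.2}.
HB.instance Definition _ := SubChoice.on qpath.

Definition psrc (p : qpath) : vert Q := (val p).1.
Definition pword (p : qpath) : seq (arr Q) := (val p).2.
Definition ptgt (p : qpath) : vert Q := last (psrc p) [seq hd a | a <- pword p].

Definition ptriv (v : vert Q) : qpath := exist _ (v, [::]) isT.
Fact parr_proof (a : arr Q) : is_walk (tl a) [:: a].
Proof. by rewrite /= eqxx. Qed.
Definition parr (a : arr Q) : qpath := exist _ (tl a, [:: a]) (parr_proof a).

(* the path q followed by the path p *)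
Definition pcomp (p q : qpath) : option qpath :=
  if psrc p == ptgt q then insub (psrc q, pword q ++ pword p) else None.

Fact is_walk_cat x w w' :
  is_walk x (w ++ w') =
  is_walk x w && is_walk (last x [seq hd a | a <- w]) w'.
Proof. by elim: w x => //= a w IH x; rewrite IH andbA. Qed.

Fact pcompP p q r : reflect
  [/\ psrc p = ptgt q, psrc r = psrc q & pword r = pword q ++ pword p]
  (pcomp p q == Some r).
Proof.
apply: (iffP eqP); rewrite /pcomp.
  case: eqP => // pq.
  case: (insubP qpath (psrc q, pword q ++ pword p)) => // u _ uE [<-].
  by rewrite /psrc /pword uE.
case=> pq rs rw; rewrite pq eqxx.
by rewrite -rs -rw -surjective_pairing valK.
Qed.

Fact pcomp_none p q : (pcomp p q == None) = (psrc p != ptgt q).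
Proof.
rewrite /pcomp; case: (psrc p =P ptgt q) => // pq.
case: (insubP qpath (psrc q, pword q ++ pword p)) => //=.
by rewrite is_walk_cat (valP q) /= -/(ptgt q) -pq (valP p).
Qed.

Fact pcomp_tgt p q r : pcomp p q = Some r -> ptgt r = ptgt p.
Proof.
move=> /eqP/pcompP[pq rs rw].
by rewrite /ptgt rs rw map_cat last_cat -/(ptgt q) -pq.
Qed.

Fact pcompA p q r :
  obind (fun s => pcomp s r) (pcomp p q) = obind (pcomp p) (pcomp q r).
Proof.
case pq : (pcomp p q) => [s|] /=; case qr : (pcomp q r) => [t|] //=.
- have /eqP/pcompP[pqE ss sw] := pq; have /eqP/pcompP[qrE ts tw] := qr.
  case sr : (pcomp s r) => [u|].
    have /eqP/pcompP[_ us uw] := sr.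
    apply/esym/eqP/pcompP; split; first by rewrite (pcomp_tgt qr).
      by rewrite us ts.
    by rewrite uw sw tw catA.
  by move/eqP: sr; rewrite pcomp_none ss qrE eqxx.
- have /eqP/pcompP[_ ss _] := pq.
  by apply/eqP; rewrite pcomp_none ss -pcomp_none qr.
- apply/esym/eqP; rewrite pcomp_none (pcomp_tgt qr) -pcomp_none pq //.
Qed.

Fact pcomp_trivl v q : pcomp (ptriv v) q = if v == ptgt q then Some q else None.
Proof.
case: eqP => vq; apply/eqP; last by rewrite pcomp_none; apply/eqP.
by apply/pcompP; rewrite cats0.
Qed.

Fact pcomp_trivr v q : pcomp q (ptriv v) = if v == psrc q then Some q else None.
Proof.
case: eqP => vq; apply/eqP; last first.
  by rewrite pcomp_none; apply/eqP => /esym.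
by apply/pcompP; split.
Qed.

End Paths.

Definition palg (k : fieldType) (Q : quiver) : Type := {malg k[qpath Q]}.
HB.instance Definition _ (k : fieldType) (Q : quiver) :=
  GRing.Lmodule.on (palg k Q).

(* a path as an element of the path algebra; locked because unification may
   otherwise unfold finitely supported functions without end *)
HB.lock Definition pbase (k : fieldType) (Q : quiver) (p : qpath Q) : palg k Q :=
  << p >>.

Section PathAlgebra.
Variables (k : fieldType) (Q : quiver).
Local Notation palg := (palg k Q).
Local Notation pbase := (@pbase k Q).

Definition pbase_opt (o : option (qpath Q)) : palg :=
  if o is Some r then pbase r else 0.

Definition pone : palg := \sum_(v : vert Q) pbase (ptriv v).

Definition pmul (f g : palg) : palg :=
  \sum_(p <- msupp f) f@_p *: \sum_(q <- msupp g) g@_q *: pbase_opt (pcomp p q).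

Definition lext (V : lmodType k) (F : qpath Q -> V) (f : palg) : V :=
  \sum_(p <- msupp f) f@_p *: F p.

Fact lextw (V : lmodType k) (F : qpath Q -> V) (f : palg) (D : {fset qpath Q}) :
  (msupp f `<=` D)%fset -> lext F f = \sum_(p <- D) f@_p *: F p.
Proof.
move=> fD; rewrite /lext (big_fset_incl _ fD) // => p pD pf.
by rewrite mcoeff_outdom // scale0r.
Qed.

Fact lext_linear (V : lmodType k) (F : qpath Q -> V) : linear (lext F).
Proof.
move=> a f g.
pose D := (msupp (a *: f + g) `|` (msupp f `|` msupp g))%fset.
rewrite !(@lextw _ _ _ D) /D.
- rewrite scaler_sumr -big_split /=; apply: eq_bigr => p _.
  by rewrite scalerA -scalerDl mcoeffD mcoeffZ.
- by rewrite fsubsetU // fsubsetU ?fsubset_refl ?orbT.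
- by rewrite fsubsetU // fsubsetU ?fsubset_refl ?orbT.
- by rewrite fsubsetU ?fsubset_refl.
Qed.
HB.instance Definition _ (V : lmodType k) (F : qpath Q -> V) :=
  GRing.isLinear.Build k palg V *:%R (lext F) (lext_linear F).

Fact lext_base (V : lmodType k) (F : qpath Q -> V) p : lext F (pbase p) = F p.
Proof.
by rewrite /lext pbase.unlock msuppU oner_eq0 big_seq_fset1 mcoeffUU scale1r.
Qed.

Fact pbaseZ (c : k) (p : qpath Q) : << c *g p >> = c *: pbase p :> palg.
Proof.
apply/malgP => q; rewrite mcoeffU.
by rewrite [RHS]mcoeffZ pbase.unlock [X in _ * X]mcoeffU mulr_natr.
Qed.

Fact palgE (f : palg) : f = lext pbase f.
Proof. by rewrite [LHS]monalgE /lext; apply: eq_bigr => p _; rewrite pbaseZ. Qed.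

Fact palg_ind (V : lmodType k) (F G : {linear palg -> V}) :
  (forall p, F (pbase p) = G (pbase p)) -> F =1 G.
Proof.
move=> FG f; rewrite [f]palgE /lext !linear_sum.
by apply: eq_bigr => p _; rewrite !linearZ FG.
Qed.

Fact pmulE f g :
  pmul f g = lext (fun p => lext (fun q => pbase_opt (pcomp p q)) g) f.
Proof. by []. Qed.

Definition pmulr (g f : palg) : palg := pmul f g.
Fact pmulr_linear g : linear (pmulr g).
Proof. by move=> a f f'; rewrite /pmulr !pmulE linearP. Qed.
Fact pmul_linear f : linear (pmul f).
Proof.
move=> a g g'; rewrite !pmulE /lext scaler_sumr -big_split /=.
apply: eq_bigr => p _; rewrite -/(lext _ _) -/(lext _ g) -/(lext _ g').
by rewrite linearP scalerDr !scalerA mulrC.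
Qed.
HB.instance Definition _ g :=
  GRing.isLinear.Build k palg palg *:%R (pmulr g) (pmulr_linear g).
HB.instance Definition _ f :=
  GRing.isLinear.Build k palg palg *:%R (pmul f) (pmul_linear f).

Fact pmul_base p q : pmul (pbase p) (pbase q) = pbase_opt (pcomp p q).
Proof. by rewrite pmulE !lext_base. Qed.

Fact pmul_base_optl o q :
  pmul (pbase_opt o) (pbase q) = pbase_opt (obind (fun p => pcomp p q) o).
Proof.
by case: o => [p|] /=; [exact: pmul_base|exact: (linear0 (pmulr (pbase q)))].
Qed.

Fact pmul_base_optr p o :
  pmul (pbase p) (pbase_opt o) = pbase_opt (obind (pcomp p) o).
Proof. by case: o => [q|] /=; [exact: pmul_base|exact: linear0]. Qed.

Fact pmulA : associative pmul.
Proof.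
move=> f g h; move: f; apply: (palg_ind
  (F := pmulr (pmul g h)) (G := pmulr h \o pmulr g)) => p /=.
move: g; apply: (palg_ind
  (F := pmul (pbase p) \o pmulr h) (G := pmulr h \o pmul (pbase p))) => q /=.
move: h; apply: (palg_ind (F := pmul (pbase p) \o pmul (pbase q))
  (G := pmul (pmul (pbase p) (pbase q)))) => r /=.
by rewrite (pmul_base q r) (pmul_base p q) pmul_base_optr pmul_base_optl pcompA.
Qed.

Fact pmul1 : left_id pone pmul.
Proof.
apply: (palg_ind (F := pmul pone) (G := idfun)) => q /=.
rewrite -[LHS]/(pmulr _ _) linear_sum /= (bigD1 (ptgt q)) //=.
rewrite /pmulr pmul_base pcomp_trivl eqxx big1 ?addr0 // => v vq.
by rewrite pmul_base pcomp_trivl (negPf vq).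
Qed.
Fact p1mul : right_id pone pmul.
Proof.
apply: (palg_ind (F := pmulr pone) (G := idfun)) => q /=.
rewrite /pmulr linear_sum /= (bigD1 (psrc q)) //=.
rewrite pmul_base pcomp_trivr eqxx big1 ?addr0 // => v vq.
by rewrite pmul_base pcomp_trivr (negPf vq).
Qed.
Fact pmulDl : left_distributive pmul +%R.
Proof. by move=> f g h; exact: (linearD (pmulr h)). Qed.
Fact pmulDr : right_distributive pmul +%R.
Proof. by move=> f g h; exact: linearD. Qed.
HB.instance Definition _ := GRing.Zmodule_isPzRing.Build palg
  pmulA pmul1 p1mul pmulDl pmulDr.

Definition pscal (c : k) : palg := c *: (1 : palg).
Fact pscalE c (f : palg) : pscal c * f = c *: f.
Proof.
by rewrite -[in RHS](mul1r f); exact: (linearZ_LR (pmulr f)).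
Qed.
Fact pscalC c (f : palg) : pscal c * f = f * pscal c.
Proof.
by rewrite pscalE -[in LHS](mulr1 f); apply/esym; exact: (linearZ_LR (pmul f)).
Qed.
Fact pscal_zmod : zmod_morphism pscal.
Proof. by move=> c d; rewrite /pscal scalerBl. Qed.
Fact pscal_monoid : monoid_morphism pscal.
Proof. by split=> [|c d]; rewrite ?pscalE /pscal ?scale1r ?scalerA. Qed.
HB.instance Definition _ := GRing.isZmodMorphism.Build k palg pscal pscal_zmod.
HB.instance Definition _ :=
  GRing.isMonoidMorphism.Build k palg pscal pscal_monoid.

Definition path_alg : kalg k := @KAlg k palg pscal pscalC.

End PathAlgebra.

Section LayerModules.
Variable A : pzRingType.

Fact lideal_closed (e : A) :
  submod_closed (fun x : A^o => `[< exists a : A, x = a * e >]).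
Proof.
split=> [|a x y /asboolP[b ->] /asboolP[c ->]]; apply/asboolP.
  by exists 0; rewrite mul0r.
by exists (a * b + c); rewrite mulrDl -mulrA.
Qed.
Definition lideal (e : A) : lmodType A := smod (Submod (lideal_closed e)).

Definition primitive (e : A) :=
  [/\ e * e = e, e <> 0 &
      forall f g, f * f = f -> g * g = g -> f * g = 0 -> g * f = 0 ->
        e = f + g -> f = 0 \/ g = 0].

Definition layer_mod (e : A) (i : nat) : lmodType A := qmod (radpow (lideal e) i).

(* membership in the additive category generated by the modules
   A e / rad^i (A e), e primitive, i at least 1 and at most the Loewy length
   of A *)
Definition in_add_layers (M : lmodType A) :=
  exists n (e : 'I_n -> A) (i : 'I_n -> nat),
    (forall t, primitive (e t) /\ (1 <= i t <= loewy_length A^o)%N) /\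
    exists (s : {linear M -> dsum (fun t => layer_mod (e t) (i t))})
           (r : {linear dsum (fun t => layer_mod (e t) (i t)) -> M}),
      forall x, r (s x) = x.

End LayerModules.

(* [st_simple] lists the simple modules up to isomorphism, [st_lt] is the strict
   part of the order on them *)
Record strat (k : fieldType) := Strat {
  st_alg :> kalg k;
  st_idx : finType;
  st_simple : st_idx -> lmodType st_alg;
  st_lt : st_idx -> st_idx -> Prop
}.

Section Standard.
Variables (k : fieldType) (X : strat k).

Definition st_le (j i : st_idx X) := j = i \/ st_lt j i.

Definition factors_le (M : lmodType X) (i : st_idx X) :=
  forall j, comp_factor M (st_simple j) -> st_le j i.

(* D is the largest quotient of the projective cover P of the i-th simple
   module such that all composition factors of D are at most i *)
Definition is_standard (i : st_idx X) (D : lmodType X) :=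
  exists (P : lmodType X) (p : {linear P -> st_simple i}) (q : {linear P -> D}),
    [/\ projective_cover p, onto q, factors_le D i &
        forall (D' : lmodType X) (q' : {linear P -> D'}),
          onto q' -> factors_le D' i -> forall x, q x = 0 -> q' x = 0].

End Standard.

Definition qh_iso (k : fieldType) (X Y : strat k) :=
  exists f : {rmorphism X -> Y},
    [/\ bijective f, forall c, f (kscal X c) = kscal Y c &
        exists sigma : st_idx X -> st_idx Y, bijective sigma /\
          forall i, exists (D : lmodType X) (D' : lmodType Y),
            [/\ is_standard i D, is_standard (sigma i) D' &
                miso D (pullback f D')]].

Section Nilpotent.
Variables (k : fieldType) (Q : quiver) (s : nat).

Fact ord_lo_proof (l : 'I_s.-1) : (l < s)%N.
Proof. by case: s l => [|n] [l //= /ltnW]. Qed.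
Fact ord_hi_proof (l : 'I_s.-1) : (l.+1 < s)%N.
Proof. by case: s l => [|n] []. Qed.
Definition ord_lo (l : 'I_s.-1) : 'I_s := Ordinal (ord_lo_proof l).
Definition ord_hi (l : 'I_s.-1) : 'I_s := Ordinal (ord_hi_proof l).

(* Levels are counted from 0: [(i, l)] is the vertex i_(l+1), [inl (i, l)] is
   the arrow b(i_(l+1)) and [inr (a, l)] is the arrow a_(l+2) *)
Definition staircase : quiver := {|
  vert := (vert Q * 'I_s)%type;
  arr := ((vert Q * 'I_s.-1) + (arr Q * 'I_s.-1))%type;
  tl := fun x => match x with
        | inl (i, l) => (i, ord_hi l)
        | inr (a, l) => (hd a, ord_lo l)
        end;
  hd := fun x => match x with
        | inl (i, l) => (i, ord_lo l)
        | inr (a, l) => (tl a, ord_hi l)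
        end
|}.

Definition arr_b (i : vert Q) (l : 'I_s.-1) : path_alg k staircase :=
  pbase k (@parr staircase (inl (i, l))).
Definition arr_a (a : arr Q) (l : 'I_s.-1) : path_alg k staircase :=
  pbase k (@parr staircase (inr (a, l))).

Definition nilp_rel (x : path_alg k staircase) :=
  (exists a (l l' : 'I_s.-1), l' = l.+1 :> nat /\
     x = arr_b (tl a) l' * arr_a a l' - arr_a a l * arr_b (hd a) l) \/
  (exists a (l : 'I_s.-1), l = 0%N :> nat /\ x = arr_b (tl a) l * arr_a a l).

Definition nilp_alg : kalg k := qalg (idealgen nilp_rel).

Definition nilp_idem (v : vert staircase) : nilp_alg :=
  qproj (idealgen nilp_rel) (pbase k (ptriv v)).

Definition nilp_quiver_alg : strat k := {|
  st_alg := nilp_alg;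
  st_idx := vert staircase;
  st_simple := fun v => topmod (lideal (nilp_idem v));
  st_lt := fun v w => (s - (val v.2).+1 < s - (val w.2).+1)%N
|}.

End Nilpotent.

(* realizations of ADR(A): representatives of the indecomposable modules in the
   additive category generated by the A e / rad^i (A e) *)
Record adr (A : pzRingType) := Adr {
  adr_idx : finType;
  adr_mod : adr_idx -> lmodType A;
  adr_indec : forall j, indecomposable (adr_mod j);
  adr_add : forall j, in_add_layers (adr_mod j);
  adr_irredundant : forall i j, miso (adr_mod i) (adr_mod j) -> i = j;
  adr_complete : forall M : lmodType A,
    indecomposable M -> in_add_layers M -> exists j, miso M (adr_mod j)
}.

Section ADR.
Variables (k : fieldType) (A : kalg k) (N : adr A).

Definition adr_sum : lmodType A := dsum (@adr_mod A N).

Definition adr_layer (j : adr_idx N) (d : nat) :=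
  exists (e : A) (l : nat),
    [/\ primitive e, (1 <= l <= loewy_length (lideal e))%N,
        miso (adr_mod j) (layer_mod e l) & d = (loewy_length A^o - l)%N].

Definition adr_alg : strat k := {|
  st_alg := endalg adr_sum;
  st_idx := adr_idx N;
  st_simple := fun j => topmod (homl adr_sum (adr_mod j));
  st_lt := fun i j => exists c d, [/\ adr_layer i c, adr_layer j d & (c < d)%N]
|}.

End ADR.

Definition arrow_ideal (k : fieldType) (Q : quiver) : ideal (path_alg k Q) :=
  idealgen (fun x => exists a : arr Q, x = pbase k (parr a)).

Definition trunc_alg (k : fieldType) (Q : quiver) (m : nat) : kalg k :=
  qalg (ideal_exp (arrow_ideal k Q) m).

(* Main.v *)
From HB Require Import structures.
From mathcomp Require Import all_boot all_algebra.
From mathcomp Require Import boolp classical_sets.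
From mathcomp Require Import finmap monalg.
From mathcomp Require Import zify.
Require Import Defs.

(** Proof idea. Put [R = kQ/J^m]. The indecomposable summands of ADR(R) are the
    layers [R e_v / rad^l (R e_v)] with [1 <= l <= LL(R e_v)], where [LL] is the
    Loewy length. An isomorphism of quasi-hereditary algebras matches the
    [m * #|Q_0|] vertices of the staircase with these layers; as
    [LL(R e_v) <= m], it forces [LL(R e_v) = m] for every [v].

    Conversely, suppose that [LL(R e_v) = m] for all [v].  Let [b] act by the
    projections [R e_v / rad^(l+1) -> R e_v / rad^l] and [a] by right
    multiplication, from layer [l] at [h(a)] to layer [l+1] at [t(a)]. In the
    nilpotent quiver algebra the relations move every [b] to the right of every
    [a], so a path from [w_l] to [v_l'] is zero or equals the normal form of a
    path [p] of [Q] from [v] to [w] with [|p| <= l'] and [l' <= l + |p|] (levels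
    counted from 0). Its image sends the generator of the source layer to [p].
    These images form a basis of the homomorphisms between the layers: the bound
    [l' <= l + |p|] is necessary because every path can be prolonged up to length
    [m - 1].

    A standard module is the quotient of [A e_i] by the trace of the [A e_j] with
    [j] not below [i]; it is determined by a universal property that an algebra
    isomorphism respecting idempotents and order preserves. *)

Set Implicit Arguments.
Unset Strict Implicit.
Unset Printing Implicit Defensive.

Import GRing.Theory.
Import Quotient.

Local Open Scope ring_scope.
Local Open Scope quotient_scope.

(** * Modules *)

(** The module theory rests on one structure, [basic]: complete orthogonal idempotents e_i and a
    nilpotent ideal J with A = sum k e_i + J. It is constructed for kQ/J^m and for the nilpotent
    quiver algebra, where the ideal is spanned by the classes of paths of positive length, and is
    transported along the isomorphism to the endomorphism algebra, whose radical therefore never has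
    to be computed.

    Radicals and Loewy lengths are defined through all maximal submodules, for modules that need not
    be finitely generated; nilpotency turns them into statements about J^n M. Krull-Schmidt enters
    only for retracts of sums of local modules.

    No dimensions are compared. Injectivity of the isomorphism is read off from coefficients of
    paths, and surjectivity comes from an explicit preimage of a matrix of homomorphisms. *)

Section ModuleLemmas.
Variable A : pzRingType.
Implicit Types M N : lmodType A.

Definition mklin M N (f : M -> N) (fl : linear f) : {linear M -> N} :=
  hom_fun (Hom fl).

Lemma mklinE M N (f : M -> N) (fl : linear f) x : mklin fl x = f x.
Proof. by []. Qed.

Definition mksub M (P : M -> Prop) (P0 : P 0)
    (PD : forall a x y, P x -> P y -> P (a *: x + y)) : submod M.
Proof.
exists (fun x => `[< P x >]); split; first exact/asboolP.
by move=> a x y /asboolP Px /asboolP Py; apply/asboolP; exact: PD.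
Defined.

Lemma mksubE M (P : M -> Prop) P0 PD x : x \in @mksub M P P0 PD <-> P x.
Proof. by split=> /asboolP. Qed.

Lemma lin_bij M N (f : {linear M -> N}) :
  (forall x, f x = 0 -> x = 0) -> onto f -> bijective f.
Proof.
move=> finj fonto; have [g gP] := choice fonto.
exists g => // x; apply/eqP; rewrite -subr_eq0; apply/eqP/finj.
by rewrite linearB /= gP subrr.
Qed.

Lemma can_linear M N (f : {linear M -> N}) g : cancel f g -> cancel g f -> linear g.
Proof. by move=> fK gK a x y; apply: (can_inj fK); rewrite linearP !gK. Qed.

Lemma miso_refl M : miso M M.
Proof. by exists idfun; exists id. Qed.

Lemma miso_sym M N : miso M N -> miso N M.
Proof.
case=> f [g fK gK].
by exists (mklin (can_linear fK gK)); exists f.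
Qed.

Lemma miso_trans M N L : miso M N -> miso N L -> miso M L.
Proof.
move=> [f fb] [g gb]; exists (g \o f); exact: bij_comp.
Qed.

(** A coefficient a with y = a g is chosen for each y; two choices differ by an annihilator of g,
    which also kills h. *)
Lemma cyclic_hom M N (g : M) (h : N) :
  (forall y, exists a, y = a *: g) -> (forall a, a *: g = 0 -> a *: h = 0) ->
  exists f : {linear M -> N}, forall a, f (a *: g) = a *: h.
Proof.
move=> gen ann; have [c cP] := choice gen.
have cE a : c (a *: g) *: h = a *: h.
  apply/eqP; rewrite -subr_eq0 -scalerBl; apply/eqP/ann.
  by rewrite scalerBl -cP subrr.
have fl : linear (fun y => c y *: h).
  move=> a x y; rewrite {1}(cP x) {1}(cP y) scalerA -scalerDl cE.
  by rewrite scalerDl scalerA.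
by exists (mklin fl) => a; exact: cE.
Qed.

Definition piq M (U : submod M) (x : M) : qmod U := \pi_(qmod U) x.
Lemma piq_linear M (U : submod M) : linear (@piq M U).
Proof. by move=> a x y; rewrite /piq qmodD qmodZ. Qed.
HB.instance Definition _ M (U : submod M) :=
  GRing.isLinear.Build A M (qmod U) *:%R (@piq M U) (@piq_linear M U).

Lemma piq_onto M (U : submod M) : onto (@piq M U).
Proof. by move=> y; exists (repr y); rewrite /piq reprK. Qed.

Lemma piq0 M (U : submod M) x : piq U x = 0 <-> x \in U.
Proof.
rewrite -[in X in _ <-> X](subr0 x) -qmod_eqE -/(piq U x) -/(piq U 0) linear0.
by split=> [->|/eqP].
Qed.

Lemma qmod_hom M N (U : submod M) (f : {linear M -> N}) :
  (forall x, x \in U -> f x = 0) ->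
  exists h : {linear qmod U -> N}, forall x, h (piq U x) = f x.
Proof.
move=> fU.
have fE x : f (repr (piq U x)) = f x.
  apply/eqP; rewrite -subr_eq0 -linearB; apply/eqP/fU/piq0.
  by rewrite linearB /= /piq reprK subrr.
have hl : linear (fun y : qmod U => f (repr y)).
  move=> a x y; have [x' <-] := piq_onto x; have [y' <-] := piq_onto y.
  by rewrite -linearP !fE linearP.
by exists (mklin hl).
Qed.

Lemma qmod_miso M N (U : submod M) (f : {linear M -> N}) :
  onto f -> (forall x, f x = 0 <-> x \in U) -> miso (qmod U) N.
Proof.
move=> fonto fU; have [h hE] := @qmod_hom _ _ U f (fun x => proj2 (fU x)).
exists h; apply: lin_bij => [y|y].
  by have [x <-] := piq_onto y; rewrite hE => /fU/piq0.
by have [x <-] := fonto y; exists (piq U x).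
Qed.

Definition lid (e a : A) : lideal e.
Proof. by exists (a * e); apply/asboolP; exists a. Defined.

Lemma lid_linear e : linear (lid e : A^o -> lideal e).
Proof. by move=> a x y; apply: val_inj; rewrite /= mulrDl -mulrA. Qed.

Lemma lidP e (x : lideal e) : exists a, x = lid e a.
Proof.
by case: x => x xP; have /asboolP[a xE] := xP; exists a; apply: val_inj.
Qed.

Lemma lid_scale e a b : a *: lid e b = lid e (a * b).
Proof. by apply: val_inj; exact: mulrA. Qed.

Lemma lid0 e a : lid e a = 0 <-> a * e = 0.
Proof. by split=> [/(congr1 val)|ae]; [|apply: val_inj]. Qed.

Lemma lid_gen e (x : lideal e) : exists a, x = a *: lid e 1.
Proof.
by have [a ->] := lidP x; exists a; rewrite lid_scale mulr1.
Qed.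

(** A lift is determined by the image of e; it is e x for any x over f(e). *)
Lemma lideal_projective (e : A) : e * e = e -> projective (lideal e).
Proof.
move=> ee M N g f gonto; have [x xE] := gonto (f (lid e 1)).
have ann a : a *: lid e 1 = 0 -> a *: (e *: x) = 0.
  by rewrite lid_scale mulr1 => /lid0 ae; rewrite scalerA ae scale0r.
have [h hE] := cyclic_hom (@lid_gen e) ann.
exists h => y; have [a ->] := lid_gen y; rewrite hE !linearZ /= xE -linearZ /=.
by congr (_ *: f _); apply: val_inj; rewrite /= mul1r.
Qed.

End ModuleLemmas.

(** * Basic algebras *)

Section Kill.
Variables (A : pzRingType) (J : A -> Prop).

(** This is J^n y = 0, stated one factor at a time so that no power of J is formed. *)
Fixpoint kill (M : lmodType A) n (y : M) : Prop :=
  if n is n'.+1 then forall a, J a -> kill n' (a *: y) else y = 0.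

End Kill.

(** A split basic algebra: modulo the nilpotent ideal [brad] it is a product of copies of k, one for
    each index, and [bid_nrad] keeps all factors nonzero. Finite dimension, [basic_fin], serves to
    build composition series. *)
Record basic (k : fieldType) (A : kalg k) (I : finType) := Basic {
  bid : I -> A;
  brad : A -> Prop;
  bid_orth : forall i j, bid i * bid j = if i == j then bid i else 0;
  bid_sum : \sum_i bid i = 1;
  brad0 : brad 0;
  bradD : forall x y, brad x -> brad y -> brad (x + y);
  bradMl : forall a x, brad x -> brad (a * x);
  bradMr : forall a x, brad x -> brad (x * a);
  brad_split : forall x, exists c : I -> k,
    brad (x - \sum_i kscal A (c i) * bid i);
  brad_nil : exists n, forall x : A^o, kill brad n x;
  bid_nrad : forall i, ~ brad (bid i);
  basic_fin : exists n (g : 'I_n -> A), forall x, exists c : 'I_n -> k,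
    x = \sum_t kscal A (c t) * g t
}.

Section Basic.
Variables (k : fieldType) (A : kalg k) (I : finType) (B : basic A I).
Implicit Types M N : lmodType A.
Local Notation J := (brad B).
Local Notation e := (bid B).
Local Notation ks := (kscal A).

Lemma bid_idem i : e i * e i = e i.
Proof. by rewrite bid_orth eqxx. Qed.

Lemma bradN x : J x -> J (- x).
Proof. by rewrite -mulN1r; exact: bradMl. Qed.

Lemma kscalZ M c a (y : M) : ks c *: (a *: y) = a *: (ks c *: y).
Proof. by rewrite !scalerA kscalC. Qed.

Lemma ks_inj M c (y : M) : c != 0 -> ks c^-1 *: (ks c *: y) = y.
Proof. by move=> c0; rewrite scalerA -rmorphM mulVf // rmorph1 scale1r. Qed.

Lemma ks_inj' M c (y : M) : c != 0 -> ks c *: (ks c^-1 *: y) = y.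
Proof. by move=> c0; rewrite scalerA -rmorphM mulfV // rmorph1 scale1r. Qed.

Lemma bid_decomp M (y : M) : y = \sum_i e i *: y.
Proof. by rewrite -scaler_suml bid_sum scale1r. Qed.

Lemma bid_mod M i (y : M) : e i *: (e i *: y) = e i *: y.
Proof. by rewrite scalerA bid_idem. Qed.

(** Since A = sum k e_j + J and e_j y = 0 for j other than i, every ring element acts on y as a
    scalar modulo J. *)
Lemma bid_mod_split M i (y : M) : e i *: y = y -> forall a,
  exists c j, J j /\ a *: y = ks c *: y + j *: y.
Proof.
move=> ey a; have [c cP] := brad_split B a; exists (c i); exists (a - \sum_i ks (c i) * e i).
split=> //; rewrite scalerBl scaler_suml (bigD1 i) //= -scalerA ey big1 ?addr0.
  by rewrite addrC subrK.
move=> j ji; rewrite -ey scalerA -mulrA bid_orth (negPf ji) mulr0.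
by rewrite scale0r.
Qed.

Lemma kill_act M n (b : A^o) (y : M) : kill J n b -> kill J n ((b : A) *: y).
Proof.
elim: n b => [|n IH] b /=; first by move=> ->; rewrite scale0r.
by move=> bn a Ja; rewrite scalerA; apply: IH; exact: bn.
Qed.

Lemma kill_all M : exists n, forall y : M, kill J n y.
Proof.
by have [n nP] := brad_nil B; exists n => y; rewrite -(scale1r y); exact: kill_act.
Qed.

Lemma kill_closed M n a (x y : M) :
  kill J n x -> kill J n y -> kill J n (a *: x + y).
Proof.
elim: n a x y => [|n IH] a x y /=; first by move=> -> ->; rewrite scaler0 addr0.
move=> xn yn b Jb; rewrite scalerDr scalerA -(scale1r (_ *: x)).
by apply: IH; [apply: xn; exact: bradMr|exact: yn].
Qed.

Lemma kill0 M n : kill J n (0 : M).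
Proof. by elim: n => [|n IH] //= a _; rewrite scaler0. Qed.

(** Multiply x by elements of J as long as some product stays outside U. Nilpotency stops this, and
    the last vector lies in the socle of M/U. *)
Lemma socle_step M (U : submod M) x : x \notin U ->
  exists y, [/\ exists b, y = b *: x, y \notin U & forall a, J a -> a *: y \in U].
Proof.
have [n nP] := kill_all M; move: (nP x) => {nP}.
elim: n x => [|n IH] x /=; first by move=> ->; rewrite rpred0.
move=> xn xU; have [Jx|/existsNP[a /not_implyP[Ja /negP axU]]] :=
  pselect (forall a, J a -> a *: x \in U).
  by exists x; split=> //; exists 1; rewrite scale1r.
have [y [[b ->] yU Jy]] := IH _ (xn a Ja) axU.
by exists (b *: (a *: x)); split=> //; exists (b * a); rewrite scalerA.
Qed.

(** * The radical of a module as multiplication by J *)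

Section JMul.
Variable M : lmodType A.
Implicit Types U V : submod M.

(** J U is encoded as the intersection of the submodules containing all products, so finite sums
    never appear: an inclusion of J U is proved by exhibiting one such submodule. *)
Definition jmul U : submod M.
Proof.
apply: (@mksub _ _ (fun y => forall V : submod M,
  (forall a u, J a -> u \in U -> a *: u \in V) -> y \in V)) => [V _|].
  exact: rpred0.
by move=> a x y xP yP V VP; rewrite rpredD ?rpredZ ?xP ?yP.
Defined.

Lemma jmulP U y : y \in jmul U <-> forall V : submod M,
  (forall a u, J a -> u \in U -> a *: u \in V) -> y \in V.
Proof. exact: mksubE. Qed.

Lemma jmul_in U a u : J a -> u \in U -> a *: u \in jmul U.
Proof. by move=> Ja uU; apply/jmulP => V; exact. Qed.

Lemma jmul_sub U V : (forall a u, J a -> u \in U -> a *: u \in V) ->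
  issub (jmul U) V.
Proof. by move=> UV x /jmulP; exact. Qed.

Lemma jmul_le U : issub (jmul U) U.
Proof. by apply: jmul_sub => a u _ uU; rewrite rpredZ. Qed.

Lemma jmul_mono U V : issub U V -> issub (jmul U) (jmul V).
Proof. by move=> UV; apply: jmul_sub => a u Ja /UV; exact: jmul_in. Qed.

Fixpoint jpow n : submod M := if n is n'.+1 then jmul (jpow n') else topsub M.

Lemma jpow_kill n i y : (forall z : M, kill J (n + i) z) -> y \in jpow n -> kill J i y.
Proof.
elim: n i y => [|n IH] i y all_kill; first by [].
pose K := mksub (kill0 M i) (@kill_closed M i).
move/(@jmul_sub _ K) => yK; apply/(mksubE (kill0 M i) (@kill_closed M i))/yK.
move=> a u Ja /(IH i.+1) uK; apply/mksubE; apply: uK => // z.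
by rewrite addnS -addSn.
Qed.

Lemma jpow_nil : exists n, iszero (jpow n).
Proof.
have [n nP] := kill_all M; exists n => y /(@jpow_kill n 0 y); apply.
by rewrite addn0.
Qed.

Lemma jpowS n : issub (jpow n.+1) (jpow n).
Proof. exact: jmul_le. Qed.

Lemma jpow_le m n : (m <= n)%N -> issub (jpow n) (jpow m).
Proof.
move=> /subnK<-; elim: (n - m)%N => [|d IH] x //.
by rewrite addSn => /jpowS; exact: IH.
Qed.

(** From M = U + J M one gets that J^n M lies in U + J^(n+1) M for all n, and J^n M vanishes
    eventually. *)
Lemma jpow_nakayama U :
  (forall y : M, exists2 u, u \in U & y - u \in jpow 1) -> isfull U.
Proof.
move=> UJ.
have UD n : forall y, y \in jpow n -> exists2 u, u \in U & y - u \in jpow n.+1.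
  have P0 m : exists2 u, u \in U & (0 : M) - u \in jpow m.
    by exists 0; rewrite ?subrr rpred0.
  have PD m a x y : (exists2 u, u \in U & x - u \in jpow m) ->
      (exists2 u, u \in U & y - u \in jpow m) ->
      exists2 u, u \in U & a *: x + y - u \in jpow m.
    move=> [u uU xu] [v vU yv]; exists (a *: u + v); first by rewrite rpredD ?rpredZ.
    by rewrite opprD addrACA -scalerBr rpredD ?rpredZ.
  elim: n => [|n IH] y; first by move=> _; exact: UJ.
  move/(@jmul_sub _ (mksub (P0 n.+2) (PD n.+2))) => yU.
  apply/(mksubE (P0 n.+2) (PD n.+2))/yU => a u Ja uJ; apply/mksubE.
  have [v vU uv] := IH u uJ; exists (a *: v); first by rewrite rpredZ.
  by rewrite -scalerBr; exact: jmul_in.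
have [n nP] := jpow_nil.
have {}UJ y m : exists2 u, u \in U & y - u \in jpow m.
  elim: m => [|m [u uU yu]]; first by exists 0; rewrite ?rpred0.
  have [v vU yv] := UD _ _ yu.
  by exists (u + v); [exact: rpredD|rewrite opprD addrA].
move=> y; have [u uU] := UJ y n; move/nP/eqP.
by rewrite subr_eq0 => /eqP->.
Qed.

(** U + k z is stable under A because A acts on z by scalars modulo J and J z lies in U. *)
Lemma line_closed U (z : M) i : e i *: z = z -> (forall a, J a -> a *: z \in U) ->
  exists V : submod M, forall y, y \in V <-> exists2 c, True & y - ks c *: z \in U.
Proof.
move=> ez Jz.
have P0 : exists2 c, True & 0 - ks c *: z \in U.
  by exists 0 => //; rewrite rmorph0 scale0r subrr rpred0.
have PD a x y : (exists2 c, True & x - ks c *: z \in U) ->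
   (exists2 c, True & y - ks c *: z \in U) ->
   (exists2 c, True & a *: x + y - ks c *: z \in U).
  move=> [c _ xc] [d _ yd]; have [c' [j [Jj aE]]] := bid_mod_split ez a.
  exists (c * c' + d) => //.
  have -> : a *: x + y - ks (c * c' + d) *: z =
    a *: (x - ks c *: z) + (y - ks d *: z) + ks c *: (j *: z).
    rewrite scalerBr -(kscalZ c) aE rmorphD rmorphM scalerDl scalerDr -scalerA.
    by rewrite [RHS]addrAC (opprD _ (ks c *: (j *: z))) (addrA (a *: x)) subrK opprD addrACA.
  apply: rpredD; last by apply: rpredZ; exact: Jz.
  by apply: rpredD => //; exact: rpredZ.
by exists (mksub P0 PD) => y; exact: mksubE.
Qed.

(** If x is not in J U, take V maximal among the submodules between J U and U that avoid x. It is a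
    maximal submodule of U: for e_i z outside V, the submodule V + k e_i z must contain x, so e_i z
    lies in V + k x, hence in every W that contains V and x. *)
Lemma rad_sub_jmul U : issub (rad U) (jmul U).
Proof.
move=> x /asboolP[xU xrad]; apply: contrapT => xJ.
(* Zorn is applied to sets S for which the union of S and J U is closed, so that the empty chain has
   an admissible union as well. *)
pose V_of (S : set M) y := S y \/ y \in jmul U.
pose P (S : set M) := [/\ forall y, S y -> y \in U,
  forall a y z, V_of S y -> V_of S z -> V_of S (a *: y + z) & ~ S x].
have [S [[SU Slin Sx] Smax]] : exists S, P S /\ forall T, (S `<` T)%classic -> ~ P T.
  apply: Zorn_bigcup => F FP Ftot; split.
  - by move=> y [X FX Xy]; have [XU _ _] := FP X FX; exact: XU.
  - have push X a y z : F X -> V_of X y -> V_of X z ->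
        V_of (\bigcup_(X in F) X)%classic (a *: y + z).
      move=> FX Xy Xz; have [_ Xlin _] := FP X FX.
      by case: (Xlin a y z Xy Xz) => [?|?]; [left; exists X|right].
    move=> a y z [[X FX Xy]|yJ] [[Z FZ Zz]|zJ].
    + case: (Ftot X Z FX FZ) => sub.
        by apply: (push Z) => //; left; [exact: sub|].
      by apply: (push X) => //; left; [|exact: sub].
    + by apply: (push X) => //; [left|right].
    + by apply: (push Z) => //; [right|left].
    + by right; rewrite rpredD ?rpredZ.
  - by move=> [X FX Xx]; have [_ _] := FP X FX; exact.
have V0 : V_of S 0 by right; rewrite rpred0.
pose V := mksub V0 Slin.
have VE y : y \in V <-> V_of S y by exact: mksubE.
have xnV : x \notin V by apply/negP => /VE[].
have VU : issub V U by move=> y /VE[/SU|/jmul_le].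
have JV : issub (jmul U) V by move=> y yJ; apply/VE; right.
have Vmax (W : submod M) : issub V W -> issub W U -> x \notin W -> issub W V.
  move=> VW WU xW; apply: contrapT => /existsNP[w /not_implyP[wW wV]].
  apply: (Smax (fun y => y \in W)); last split=> //.
  - split; first by move=> y Sy; apply: VW; apply/VE; left.
    by move=> /(_ w wW) Sw; apply: wV; apply/VE; left.
  - move=> a y z Wy Wz; left; rewrite rpredD ?rpredZ //.
      by case: Wy => // /JV /VW.
    by case: Wz => // /JV /VW.
  - exact/negP.
move/negP: (xnV); apply; apply: xrad; split=> //; first by move=> /(_ x xU); apply/negP.
move=> W VW WU; have [xW|xW] := boolP (x \in W); last by left; exact: Vmax.
right=> z zU; rewrite (bid_decomp z) rpred_sum // => i _.
have [zV|zV] := boolP (e i *: z \in V); first exact: VW.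
have Jz a : J a -> a *: (e i *: z) \in V.
  by move=> Ja; apply/JV/jmul_in; rewrite ?rpredZ.
have [L LE] := line_closed (bid_mod i z) Jz.
have zL : e i *: z \in L.
  by apply/LE; exists 1; rewrite // rmorph1 scale1r subrr rpred0.
have VL : issub V L.
  by move=> y yV; apply/LE; exists 0; rewrite // rmorph0 scale0r subr0.
have LU : issub L U.
  move=> y /LE[c _ /VU yU]; rewrite -(subrK (ks c *: (e i *: z)) y).
  by apply: rpredD; rewrite ?rpredZ.
have xL : x \in L by apply: contrapT => /negP /(Vmax L VL LU) /(_ _ zL); apply/negP.
have /LE[c _ xc] := xL.
have c0 : c != 0.
  by apply: contraNneq xnV => c0; rewrite c0 rmorph0 scale0r subr0 in xc.
rewrite -(ks_inj (e i *: z) c0); apply: rpredZ.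
by rewrite -(subKr x (ks c *: _)) rpredB // VW.
Qed.

(** For the converse, let V be maximal in U and choose y in U outside V with J y inside V. By
    maximality U = V + A y, so u = v + c y, and a u = a v + (a c) y is in V for a in J. *)
Lemma rad_jmul U x : x \in rad U <-> x \in jmul U.
Proof.
split=> [/rad_sub_jmul //|xJ]; apply/asboolP; split; first exact: jmul_le xJ.
move=> V [VU UV Vmax]; apply: jmul_sub xJ => a u Ja uU.
have [z /not_implyP[zU /negP zV]] : exists z, ~ (z \in U -> z \in V).
  by apply/existsNP.
have [y [[b yE] yV Jy]] := socle_step zV.
have P0 : exists2 c, True & 0 - c *: y \in V.
  by exists 0; rewrite // scale0r subrr rpred0.
have PD d x1 x2 : (exists2 c, True & x1 - c *: y \in V) ->
   (exists2 c, True & x2 - c *: y \in V) ->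
   (exists2 c, True & d *: x1 + x2 - c *: y \in V).
  move=> [c _ xc] [c' _ yc]; exists (d * c + c') => //.
  rewrite scalerDl -scalerA opprD addrACA -scalerBr.
  by apply: rpredD => //; exact: rpredZ.
have VW : issub V (mksub P0 PD).
  by move=> v vV; apply/mksubE; exists 0; rewrite // scale0r subr0.
have [|WV|UW] := Vmax _ VW.
- move=> w /mksubE[c _ /VU wU]; rewrite -(subrK (c *: y) w) rpredD //.
  by rewrite rpredZ // yE rpredZ.
- have /WV : y \in mksub P0 PD by apply/mksubE; exists 1; rewrite // scale1r subrr rpred0.
  by rewrite (negPf yV).
have /UW/mksubE[c _ uc] := uU.
rewrite -(subrK (c *: y) u) scalerDr; apply: rpredD; first exact: rpredZ.
by rewrite scalerA; apply: Jy; exact: bradMr.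
Qed.

End JMul.

Lemma radpow_jpow M n x : x \in radpow M n <-> x \in jpow M n.
Proof.
elim: n x => [//|n IH] x; rewrite -[radpow M n.+1]/(rad (radpow M n)).
split=> [/rad_jmul|xJ]; first by apply: jmul_mono => y /IH.
by apply/rad_jmul; apply: jmul_mono xJ => y /IH.
Qed.

(** Some J^n M vanishes, so the default value in [loewy_length] is never taken. *)
Lemma loewyP M : iszero (jpow M (loewy_length M)) /\
  forall n, iszero (jpow M n) -> (loewy_length M <= n)%N.
Proof.
have zE n : iszero (radpow M n) <-> iszero (jpow M n).
  by split=> z x xJ; apply: z; apply/radpow_jpow.
have ex : exists n, `[< iszero (jpow M n) >].
  by have [n nP] := jpow_nil M; exists n; apply/asboolP.
have [n /asboolP nz nmin] := ex_minnP ex.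
rewrite /loewy_length; case: xgetP => [l _ [/zE z min]|no].
  by split=> // j /zE; exact: min.
case: (no n); split=> [|j /zE jz]; first exact/zE.
by apply: nmin; exact/asboolP.
Qed.

Lemma loewy_leP M n : (loewy_length M <= n)%N <-> iszero (jpow M n).
Proof.
have [z min] := loewyP M; split=> [le x|]; last exact: min.
by move/(jpow_le le)/z.
Qed.

Lemma lin_jpow M N (f : {linear M -> N}) n x : x \in jpow M n -> f x \in jpow N n.
Proof.
elim: n x => [//|n IH] x /=.
have P0 : f 0 \in jpow N n.+1 by rewrite linear0 rpred0.
have PD a y z : f y \in jpow N n.+1 -> f z \in jpow N n.+1 ->
    f (a *: y + z) \in jpow N n.+1.
  by move=> yP zP; rewrite linearP rpredD ?rpredZ.
move/(@jmul_sub _ _ (mksub P0 PD)) => xP; apply/(mksubE P0 PD)/xP => a u Ja uJ.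
by apply/mksubE; rewrite linearZ; apply: jmul_in => //; exact: IH.
Qed.

Lemma onto_jpow M N (f : {linear M -> N}) n y : onto f -> y \in jpow N n ->
  exists2 x, x \in jpow M n & f x = y.
Proof.
move=> fonto; elim: n y => [|n IH] y; first by have [x] := fonto y; exists x.
have P0 : exists2 x, x \in jpow M n.+1 & f x = 0.
  by exists 0; rewrite ?linear0 ?rpred0.
have PD a y1 y2 : (exists2 x, x \in jpow M n.+1 & f x = y1) ->
    (exists2 x, x \in jpow M n.+1 & f x = y2) ->
    exists2 x, x \in jpow M n.+1 & f x = a *: y1 + y2.
  by move=> [x xP <-] [z zP <-]; exists (a *: x + z); rewrite ?linearP ?rpredD ?rpredZ.
move/(@jmul_sub _ _ (mksub P0 PD)) => xP; apply/(mksubE P0 PD)/xP => a u Ja /IH[x xJ <-].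
by apply/mksubE; exists (a *: x); rewrite ?linearZ //; exact: jmul_in.
Qed.

Lemma onto_loewy M N (f : {linear M -> N}) : onto f ->
  (loewy_length N <= loewy_length M)%N.
Proof.
move=> fo; apply/loewy_leP => y /(onto_jpow fo)[x xJ <-].
by rewrite (proj1 (loewyP M) x xJ) linear0.
Qed.

Lemma bij_onto (X Y : Type) (f : X -> Y) : bijective f -> onto f.
Proof. by case=> g _ gK y; exists (g y). Qed.

Lemma miso_loewy M N : miso M N -> loewy_length M = loewy_length N.
Proof.
move=> MN; have [f /bij_onto fo] := MN; have [g /bij_onto go] := miso_sym MN.
by apply/eqP; rewrite eqn_leq !(onto_loewy fo, onto_loewy go).
Qed.

Lemma miso_layer M N n : miso M N -> miso (qmod (radpow M n)) (qmod (radpow N n)).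
Proof.
case=> f fb; apply: (qmod_miso (f := @piq _ _ (radpow N n) \o f)) => [|x].
  by move=> y; have [z <-] := piq_onto y; have [x <-] := bij_onto fb z; exists x.
rewrite /= piq0 !radpow_jpow; split=> [xJ|]; last exact: lin_jpow.
have [g [h gh]] : miso N M by apply: miso_sym; exists f.
have [z zJ fz] := onto_jpow (bij_onto fb) xJ.
by rewrite -(bij_inj fb fz).
Qed.

End Basic.

Arguments jmul : simpl never.
Arguments jpow : simpl never.

(** * Local modules and primitive idempotents *)

Section Local.
Variables (k : fieldType) (A : kalg k) (I : finType) (B : basic A I).
Implicit Types M N : lmodType A.
Local Notation J := (brad B).
Local Notation e := (bid B).
Local Notation ks := (kscal A).

(** A nonzero quotient of A e_i with a chosen generator; the layers are of this kind. *)
Definition local_gen M i (g : M) :=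
  [/\ e i *: g = g, g <> 0 & forall y, exists a, y = a *: g].

Lemma rad_scale M a (y : M) : J a -> a *: y \in jpow B M 1.
Proof. by move=> Ja; exact: jmul_in. Qed.

(** Here f = c + n, where n maps J^t M into J^(t+1) M. A vector of the kernel equals -c^(-1) n(y),
    hence lies in every J^t M; the image is everything by Nakayama. *)
Lemma perturb_bij M (f : {linear M -> M}) c : c != 0 ->
  (forall y, f y - ks c *: y \in jpow B M 1) -> bijective f.
Proof.
move=> c0 fJ.
have nl : linear (fun y => f y - ks c *: y).
  move=> a x y; rewrite linearP scalerDr kscalZ scalerBr opprD addrACA.
  by rewrite -scalerBr.
pose n := mklin nl.
have nJ t y : y \in jpow B M t -> n y \in jpow B M t.+1.
  elim: t y => [|t IH] y; first by move=> _; exact: fJ.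
  have P0 : n 0 \in jpow B M t.+2 by rewrite linear0 rpred0.
  have PD a y1 y2 : n y1 \in jpow B M t.+2 -> n y2 \in jpow B M t.+2 ->
      n (a *: y1 + y2) \in jpow B M t.+2.
    by move=> h1 h2; rewrite linearP rpredD ?rpredZ.
  move/(@jmul_sub _ _ _ _ _ _ (mksub P0 PD)) => yP.
  apply/(mksubE P0 PD)/yP => a u Ja uJ; apply/mksubE.
  by rewrite linearZ; apply: jmul_in => //; exact: IH.
have fE y : f y = ks c *: y + n y by rewrite /n mklinE addrC subrK.
apply: lin_bij => [y fy|].
  have [t tP] := jpow_nil B M; apply: tP.
  elim: t => [//|t IH].
  have -> : y = ks (- c^-1) *: n y.
    move/eqP: fy; rewrite fE addr_eq0 => /eqP fy.
    by rewrite -[LHS](ks_inj y c0) fy scalerN rmorphN scaleNr.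
  by rewrite rpredZ // nJ.
have P0 : exists x, f x = 0 by exists 0; rewrite linear0.
have PD a y1 y2 : (exists x, f x = y1) -> (exists x, f x = y2) ->
    (exists x, f x = a *: y1 + y2).
  by move=> [x <-] [z <-]; exists (a *: x + z); rewrite linearP.
have full : isfull (mksub P0 PD).
  apply: (@jpow_nakayama _ _ _ B) => y; exists (f (ks c^-1 *: y)).
    by apply/mksubE; exists (ks c^-1 *: y).
  rewrite fE ks_inj' // opprD addrA subrr sub0r rpredN.
  exact: (nJ 0%N).
by move=> y; apply/(mksubE P0 PD)/full.
Qed.

(** Write f(g) = a g. As a acts on g by a scalar c modulo J, the map f - c has image in J M, and the
    two cases are c nonzero and c = 0. *)
Lemma local_endo M i (g : M) (f : {linear M -> M}) : local_gen i g ->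
  bijective f \/ forall y, f y \in jpow B M 1.
Proof.
move=> [eg g0 gen]; have [a fg] := gen (f g).
have [c [j [Jj aE]]] := bid_mod_split eg a.
have fJ y : f y - ks c *: y \in jpow B M 1.
  have [b ->] := gen y; rewrite linearZ_LR fg aE kscalZ -scalerBr addrC addKr.
  by rewrite rpredZ // rad_scale.
have [c0|c0] := eqVneq c 0; last by left; exact: perturb_bij fJ.
by right=> y; have := fJ y; rewrite c0 rmorph0 scale0r subr0.
Qed.

(** Write g = u + v. Modulo J g, the vectors e_i u and e_i v are c g and (1 - c) g for a scalar c.
    The summand with a nonzero scalar contains g modulo J M, so it is all of M by Nakayama. *)
Lemma local_indec M i (g : M) : local_gen i g -> indecomposable M.
Proof.
move=> [eg g0 gen]; split; first by exists g.
suff key (U V : submod M) u v : u \in U -> v \in V -> g = u + v ->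
    (forall x, x \in U -> x \in V -> x = 0) ->
    (exists c j, [/\ c != 0, J j & e i *: u = ks c *: g + j *: g]) -> iszero V.
  move=> U V UV UV0; have [u [v [uU vV gE]]] := UV g.
  have [a uE] := gen (e i *: u).
  have [c [j [Jj aE]]] := bid_mod_split eg a.
  have [c0|c0] := eqVneq c 0; last first.
    by right; apply: (key U V u v) => //; exists c, j; rewrite uE.
  left; apply: (key V U v u) => //; first by rewrite addrC.
    by move=> x xV xU; exact: UV0.
  exists 1, (- j); split; [exact: oner_neq0|exact: bradN|].
  rewrite rmorph1 scale1r scaleNr; move: aE; rewrite c0 rmorph0 scale0r add0r => <-.
  by rewrite -uE -[in RHS]eg [in RHS]gE scalerDr addrC addKr.
move=> uU vV gE UV0 [c [j [c0 Jj uE]]].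
suff full : isfull U by move=> x; apply: UV0.
apply: (@jpow_nakayama _ _ _ B) => y; have [b ->] := gen y.
exists (b *: (ks c^-1 *: (e i *: u))); first by rewrite !rpredZ.
rewrite uE -scalerBr rpredZ // scalerDr ks_inj // opprD addrA subrr sub0r.
by rewrite rpredN rpredZ // rad_scale.
Qed.

Lemma lideal_gen i : local_gen i (lid (e i) 1).
Proof.
split; first by apply: val_inj; rewrite /= mul1r; exact: bid_idem.
  move/(congr1 val) => /= e0; apply: (@bid_nrad _ _ _ B i).
  by rewrite -(mul1r (e i)) e0; exact: brad0.
exact: lid_gen.
Qed.

Lemma jpow1_lideal f (y : lideal f) : y \in jpow B (lideal f) 1 -> J (val y).
Proof.
pose P (x : lideal f) := J (val x).
have PD b x z : P x -> P z -> P (b *: x + z).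
  by move=> Jx Jy; apply: bradD => //; exact: bradMl.
have P0 : P 0 by exact: brad0.
move/(@jmul_sub _ _ _ _ _ _ (mksub P0 PD)) => aP.
by apply/(mksubE P0 PD)/aP => x u Jx _; apply/mksubE; exact: bradMr.
Qed.

Lemma rad_idem f : f * f = f -> J f -> f = 0.
Proof.
move=> ff Jf; have [n nP] := brad_nil B; have := nP f; elim: n {nP} => [//|n IH].
by move=> /(_ f Jf); rewrite -[_ *: _]/(f * f) ff.
Qed.

Lemma nrad_unit i a : exists c j, J j /\ e i * a * e i = ks c * e i + j.
Proof.
have [c cP] := brad_split B a; exists (c i).
exists (e i * (a - \sum_i ks (c i) * e i) * e i).
split; first by apply: bradMr; exact: bradMl.
rewrite mulrBr mulrBl mulr_sumr mulr_suml (bigD1 i) //= big1 ?addr0.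
  by rewrite mulrA -kscalC -!mulrA !bid_idem addrC subrK.
by move=> j ji; rewrite -!mulrA bid_orth (negPf ji) !mulr0.
Qed.

(** In e_i = f + g write f = c e_i + j. Idempotency forces c = 0 or c = 1, so f or g is an
    idempotent in J, and such an idempotent is 0. *)
Lemma bid_primitive i : primitive (e i).
Proof.
split; first exact: bid_idem.
  by move=> e0; apply: (@bid_nrad _ _ _ B i); rewrite e0; exact: brad0.
move=> f g ff gg fg gf eE.
have ef : e i * f = f by rewrite eE mulrDl ff gf addr0.
have fe : f * e i = f by rewrite eE mulrDr ff fg addr0.
have [c [j [Jj]]] := nrad_unit i f; rewrite ef fe => fE.
have key x c' j' : x * x = x -> J j' -> x = ks c' * e i + j' -> c' = 0 -> x = 0.
  by move=> xx Jj' xE c0; apply: rad_idem => //; rewrite xE c0 rmorph0 mul0r add0r.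
have [c0|c0] := eqVneq c 0; first by left; exact: key fE c0.
right; apply: (@rad_idem) => //.
have -> : g = e i - f by rewrite eE addrC addKr.
have Jcc : J (ks (c * (c - 1)) * e i).
  pose T := ks c * e i * j + (j * (ks c * e i) + j * j).
  have ffE : ks (c * c) * e i + T = ks c * e i + j.
    rewrite -fE -ff [in RHS]fE mulrDl !mulrDr /T !addrA; congr (_ + _ + _ + _).
    by rewrite rmorphM -[in RHS]mulrA (mulrA (e i)) -kscalC -!mulrA bid_idem.
  have -> : ks (c * (c - 1)) * e i = j - T.
    rewrite mulrBr mulr1 rmorphB mulrBl; apply/eqP.
    by rewrite subr_eq eq_sym addrAC subr_eq addrC ffE.
  apply: bradD => //; apply: bradN.
  by apply: bradD; [exact: bradMl|apply: bradD; [exact: bradMr|exact: bradMr]].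
have c1 : c = 1.
  apply/eqP; rewrite -subr_eq0; apply: contraT => c1; exfalso.
  apply: (@bid_nrad _ _ _ B i).
  rewrite -(mul1r (e i)) -(rmorph1 ks) -(mulVf (mulf_neq0 c0 c1)) rmorphM -mulrA.
  exact: bradMl.
rewrite fE c1 rmorph1 mul1r opprD addrA subrr sub0r; exact: bradN.
Qed.

(** Some corner r = e_i f e_i is outside J, hence invertible, with inverse u say. For a = f e_i and
    b = e_i u f this gives b a = e_i, so a b is a nonzero idempotent below f, equal to f by
    primitivity. Right multiplications by a and b are then mutually inverse. *)
Lemma primitive_lideal f : primitive f -> exists i, miso (lideal f) (lideal (e i)).
Proof.
move=> [ff f0 fprim].
have [i Ji] : exists i, ~ J (e i * f * e i).
  have [c cP] := brad_split B f.
  have [i ci] : exists i, c i != 0.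
    apply: contrapT => nc; apply: f0; apply: rad_idem => //.
    move: cP; rewrite big1 ?subr0 // => i _.
    have [->|ci] := eqVneq (c i) 0; first by rewrite rmorph0 mul0r.
    by case: nc; exists i.
  exists i => Jfi; apply: (@bid_nrad _ _ _ B i).
  rewrite -(mul1r (e i)) -(rmorph1 ks) -(mulVf ci) rmorphM -mulrA; apply: bradMl.
  have -> : ks (c i) * e i = e i * f * e i - e i * (f - \sum_i ks (c i) * e i) * e i.
    rewrite mulrBr mulrBl subKr mulr_sumr mulr_suml (bigD1 i) //= big1 ?addr0.
      by rewrite mulrA -kscalC -!mulrA !bid_idem.
    by move=> j ji; rewrite -!mulrA bid_orth (negPf ji) !mulr0.
  apply: bradD => //; apply: bradN; apply: bradMr; exact: bradMl.
pose r := e i * f * e i.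
have rl : linear (fun x : lideal (e i) => lid (e i) (val x * r)).
  move=> a x y; apply: val_inj; rewrite /= mulrDl mulrDl.
  by rewrite /GRing.scale /= -!mulrA.
(* Right multiplication by r on the local module A e_i does not have image in the radical, so it is
   bijective; u is the preimage of e_i. *)
have [h hK kh] : bijective (mklin rl).
  have [c [j [Jj rE]]] := nrad_unit i f.
  have c0 : c != 0 by apply: contra_notN Ji => /eqP c0; rewrite rE c0 rmorph0 mul0r add0r.
  have [//|rJ] := local_endo (mklin rl) (lideal_gen i).
  exfalso; apply: Ji; have := jpow1_lideal (rJ (lid (e i) 1)).
  by rewrite mklinE /= /r !mul1r !mulrA bid_idem -!mulrA bid_idem.
pose u := val (h (lid (e i) 1)).
have ur : u * r * e i = e i by have /(congr1 val) /= := kh (lid (e i) 1); rewrite mul1r.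
have ue : u * e i = u.
  by rewrite /u; case: (h _) => x xP /=; have /asboolP[a ->] := xP; rewrite -mulrA bid_idem.
have uf : u * f * e i = e i.
  by rewrite -[RHS]ur /r !mulrA ue -!mulrA bid_idem.
pose a := f * e i; pose b := e i * u * f.
have eb : e i * b = b by rewrite /b !mulrA bid_idem.
have ae : a * e i = a by rewrite /a -mulrA bid_idem.
have fa : f * a = a by rewrite /a mulrA ff.
have ba : b * a = e i by rewrite /a /b -!mulrA (mulrA f) ff (mulrA u) uf bid_idem.
have ab : a * b = f.
  have aba : (a * b) * (a * b) = a * b by rewrite -mulrA (mulrA b) ba eb.
  have fab : f * (a * b) = a * b by rewrite /a !mulrA ff.
  have abf : (a * b) * f = a * b by rewrite /b -!mulrA ff.
  have [||||z|z] := fprim (a * b) (f - a * b) aba.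
  - by rewrite mulrBl !mulrBr ff fab abf aba subrr subr0.
  - by rewrite mulrBr abf aba subrr.
  - by rewrite mulrBl fab aba subrr.
  - by rewrite addrC subrK.
  - exfalso; have : b * (a * b) * a = e i by rewrite mulrA ba -mulrA ba bid_idem.
    rewrite z mulr0 mul0r => e0; apply: (@bid_nrad _ _ _ B i); rewrite -e0; exact: brad0.
  - by apply/eqP; rewrite eq_sym -subr_eq0 z.
clearbody a b.
have fl : linear (fun x : lideal f => lid (e i) (val x * a)).
  by move=> c x y; apply: val_inj; rewrite /= mulrDl mulrDl /GRing.scale /= -!mulrA.
exists i, (mklin fl); exists (fun y : lideal (e i) => lid f (val y * b)) => x.
  have [c ->] := lidP x; apply: val_inj; rewrite !mklinE /=.
  by rewrite -!mulrA (mulrA (e i)) eb (mulrA a) ab !ff.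
have [c ->] := lidP x; apply: val_inj; rewrite !mklinE /=.
by rewrite -!mulrA ae fa (mulrA (e i)) eb ba.
Qed.

End Local.

(** * Indecomposable retracts of direct sums *)

Section DirectSumMaps.
Variables (A : pzRingType) (T : finType) (N : T -> lmodType A).

Definition dinj t (y : N t) : dsum N := dfwith (fun i => 0 : N i) y.

Lemma dinjE t (y : N t) : dinj y t = y.
Proof. exact: dfwith_in. Qed.

Lemma dinjN t (y : N t) i : t != i -> dinj y i = 0.
Proof. exact: dfwith_out. Qed.

Lemma dsumP (f g : dsum N) : (forall i, f i = g i) -> f = g.
Proof. exact: functional_extensionality_dep. Qed.

Lemma dinj_linear t : linear (@dinj t).
Proof.
move=> a x y; apply: dsumP => i; rewrite -[RHS]/(a *: dinj x i + dinj y i).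
have [<-|ti] := eqVneq t i; first by rewrite !dinjE.
by rewrite !dinjN // scaler0 addr0.
Qed.
HB.instance Definition _ t :=
  GRing.isLinear.Build A (N t) (dsum N) *:%R (@dinj t) (@dinj_linear t).

Definition dproj t (f : dsum N) : N t := f t.
Lemma dproj_linear t : linear (@dproj t). Proof. by []. Qed.
HB.instance Definition _ t :=
  GRing.isLinear.Build A (dsum N) (N t) *:%R (@dproj t) (@dproj_linear t).

Lemma dsum_decomp (f : dsum N) : f = \sum_t dinj (f t).
Proof.
apply: dsumP => i; rewrite -[RHS]/(dproj i _) linear_sum /= (bigD1 i) //=.
rewrite /dproj dinjE big1 ?addr0 // => j ji; exact: dinjN.
Qed.

End DirectSumMaps.

Section Retract.
Variables (k : fieldType) (A : kalg k) (I : finType) (B : basic A I).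
Variables (M : lmodType A) (T : finType) (N : T -> lmodType A).
Variables (s : {linear M -> dsum N}) (r : {linear dsum N -> M}).

(** If no N_t is isomorphic to M, each endomorphism of N_t that factors through M has image in J
    N_t. Then every partial difference 1 - sum rt st stays bijective on M, whereas the full sum is r
    s = 1 and leaves the zero map. *)
Lemma retract_local : (forall x, r (s x) = x) -> indecomposable M ->
  (forall t, exists i (g : N t), local_gen B i g) -> exists t, miso M (N t).
Proof.
move=> rs [[x0 x00] Mind] Nloc; apply: contrapT => noiso.
pose rt t : {linear N t -> M} := r \o @dinj _ _ N t.
pose st t : {linear M -> N t} := @dproj _ _ N t \o s.
(* A bijective composite would split off N_t: [rt t] is split by p, so M is the sum of the image of
   [rt t] and the kernel of p. The image is nonzero, so the kernel vanishes and p is an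
   isomorphism. *)
have nbij t (V : {linear M -> M}) : ~ bijective (st t \o V \o rt t).
  move=> wb; apply: noiso; exists t.
  have [w wK Kw] := wb.
  have wl : linear w by exact: (@can_linear _ _ _ (st t \o V \o rt t) w).
  pose p : {linear M -> N t} := mklin wl \o st t \o V.
  have pr y : p (rt t y) = y by exact: wK.
  exists p; apply: lin_bij => [x px|y]; last by exists (rt t y).
  have P0 : exists y, rt t y = 0 by exists 0; rewrite linear0.
  have PD a y1 y2 : (exists y, rt t y = y1) -> (exists y, rt t y = y2) ->
      exists y, rt t y = a *: y1 + y2.
    by move=> [y <-] [z <-]; exists (a *: y + z); rewrite linearP.
  have K0 : p 0 = 0 by rewrite linear0.
  have KD a y1 y2 : p y1 = 0 -> p y2 = 0 -> p (a *: y1 + y2) = 0.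
    by move=> y1K y2K; rewrite linearP y1K y2K scaler0 addr0.
  have [||im0|ker0] := Mind (mksub P0 PD) (mksub K0 KD).
  - move=> y; exists (rt t (p y)), (y - rt t (p y)); split; last by rewrite addrC subrK.
      by apply/mksubE; exists (p y).
    by apply/mksubE; rewrite linearB [X in _ - X]pr subrr.
  - by move=> y /mksubE[z <-] /mksubE; rewrite pr => ->; rewrite linear0.
  - have [i [g [_ g0 _]]] := Nloc t; case: g0.
    by rewrite -(pr g) (im0 (rt t g)) ?linear0 //; apply/mksubE; exists g.
  - by apply: ker0; apply/mksubE.
have wJ t (V : {linear M -> M}) y : st t (V (rt t y)) \in jpow B (N t) 1.
  have [i [g gP]] := Nloc t.
  by have [/nbij//|] := local_endo (st t \o V \o rt t) gP; exact.
(* With V inverse to U, the map U - rt st is invertible because 1 - st V rt is, a perturbation of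
   the identity by a map into J N_t. The preimage of y is V y + V rt h st V y, where h inverts 1 -
   st V rt. *)
have ub (ts : seq T) : exists2 U : {linear M -> M}, bijective U &
    forall x, U x = x - \sum_(t <- ts) rt t (st t x).
  elim: ts => [|t ts [U Ub UE]].
    by exists idfun => [|x]; [exists id|rewrite big_nil subr0].
  have [V UK VK] := Ub.
  have Vl : linear V by exact: can_linear UK VK.
  have hl : linear (fun y => y - st t (V (rt t y))).
    move=> a x y; rewrite (linearP (rt t)) (Vl a) linearP /=.
    by rewrite scalerBr opprD addrACA.
  have [h hK Kh] : bijective (mklin hl).
    apply: (@perturb_bij _ _ _ B _ _ 1); first exact: oner_neq0.
    move=> y; rewrite rmorph1 scale1r mklinE addrC addKr rpredN.
    exact: (wJ t (mklin Vl)).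
  exists (mklin (linearP (U \- (rt t \o st t)))); last first.
    by move=> x; rewrite mklinE /= UE big_cons opprD addrAC addrA.
  apply: lin_bij => [x|y].
    rewrite mklinE /= => /eqP; rewrite subr_eq0 => /eqP UxE.
    have sx0 : st t x = 0.
      apply: (can_inj hK); rewrite linear0 mklinE.
      by rewrite (_ : rt t (st t x) = U x) // UK subrr.
    by apply: (can_inj UK); rewrite UxE -[dproj _ _]/(st t x) sx0 !linear0.
  exists (V y + V (rt t (h (st t (V y))))).
  rewrite mklinE -[LHS]/(U (_ + _) - rt t (st t (_ + _))) (linearD U) (linearD (st t)) !VK.
  set z := h _; have zE : st t (V (rt t z)) = z - st t (V y).
    by rewrite -(Kh (st t (V y))) mklinE -/z opprB addrCA subrr addr0.
  by rewrite zE [st t (V y) + _]addrC subrK addrK.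
have [U [V UK VK] UE] := ub (index_enum T).
apply: x00; apply: (can_inj UK); rewrite linear0 UE.
by rewrite -linear_sum /= -dsum_decomp rs subrr.
Qed.

End Retract.

(** * Composition series and standard modules *)

Section CompositionSeries.
Variables (k : fieldType) (A : kalg k) (I : finType) (B : basic A I).
Implicit Types M : lmodType A.
Local Notation J := (brad B).
Local Notation e := (bid B).
Local Notation ks := (kscal A).

Lemma restrE M (V U : submod M) x : (x \in restr V U) = (val x \in U).
Proof. by []. Qed.

Lemma simple_line M (U L : submod M) z :
  (forall y, y \in L <-> exists2 c, True & y - ks c *: z \in U) ->
  z \notin U -> simple_mod (subquot L U).
Proof.
move=> LE zU.
have zL : z \in L by apply/LE; exists 1; rewrite // rmorph1 scale1r subrr rpred0.
split.
  exists (piq (restr L U) (Sub z zL)) => /piq0; rewrite restrE SubK.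
  exact/negP.
move=> W; have [|/existsNP[w /not_implyP[wW w0]]] := pselect (iszero W); first by left.
right=> v; have [x xE] := piq_onto w; have [y yE] := piq_onto v.
have /LE[c _ xc] := valP x; have /LE[d _ yd] := valP y.
have c0 : c != 0.
  apply/eqP => c0; apply: w0; rewrite -xE; apply/piq0; rewrite restrE.
  by move: xc; rewrite c0 rmorph0 scale0r subr0.
suff -> : v = ks (d / c) *: w by rewrite rpredZ.
apply/eqP; rewrite -subr_eq0 -xE -yE -linearZ -linearB; apply/eqP/piq0.
rewrite restrE.
have -> : val (y - ks (d / c) *: x) =
  (val y - ks d *: z) - ks (d / c) *: (val x - ks c *: z).
  rewrite -[LHS]/(val y - ks (d / c) *: val x).
  by rewrite scalerBr scalerA -rmorphM divfK // opprB addrA subrK.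
by rewrite rpredB ?rpredZ.
Qed.

(** Induction on the number d of vectors spanning M over k modulo U. A socle vector z = e_i y of M/U
    is added to U; as z has a nonzero coefficient at some g_t, this g_t can be eliminated modulo L =
    U + k z. *)
Lemma comp_chain M d (U : submod M) :
  (exists g : 'I_d -> M, forall y, exists c : 'I_d -> k,
     y - \sum_t ks (c t) *: g t \in U) ->
  exists n (W : nat -> submod M), [/\ W 0%N = U, isfull (W n) & forall i, (i < n)%N ->
    issub (W i) (W i.+1) /\ simple_mod (subquot (W i.+1) (W i))].
Proof.
elim: d U => [|d IH] U [g gP].
  exists 0%N, (fun=> U); split=> // y; have [c] := gP y.
  by rewrite big_ord0 subr0.
have [Ufull|/existsNP[x /negP xU]] := pselect (isfull U).
  by exists 0%N, (fun=> U).
have [y [_ yU Jy]] := socle_step B xU.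
have [i iU] : exists i, e i *: y \notin U.
  apply: contrapT => nU; move/negP: yU; apply.
  rewrite (bid_decomp B y) rpred_sum // => i _.
  by apply: contrapT => /negP iU; apply: nU; exists i.
set z := e i *: y in iU.
have Jz a : J a -> a *: z \in U.
  by move=> Ja; rewrite scalerA; apply: Jy; exact: bradMr.
have [L LE] := line_closed (bid_mod B i y) Jz.
have UL : issub U L.
  by move=> v vU; apply/LE; exists 0; rewrite // rmorph0 scale0r subr0.
have zL : z \in L by apply/LE; exists 1; rewrite // rmorph1 scale1r subrr rpred0.
have [c cP] := gP z.
have [t ct] : exists t, c t != 0.
  apply: contrapT => nc; move/negP: iU; apply.
  move: cP; rewrite big1 ?subr0 // => t _.
  have [->|ct] := eqVneq (c t) 0; first by rewrite rmorph0 scale0r.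
  by case: nc; exists t.
have [|n [W [W0 Wn Wi]]] := IH L.
  exists (fun s => g (lift t s)) => v; have [f fP] := gP v.
  exists (fun s => f (lift t s) - f t / c t * c (lift t s)).
  have -> : v - \sum_s ks (f (lift t s) - f t / c t * c (lift t s)) *: g (lift t s) =
    (v - \sum_s ks (f s) *: g s) - ks (f t / c t) *: (z - \sum_s ks (c s) *: g s)
    + ks (f t / c t) *: z.
    rewrite scalerBr opprB addrA subrK !(bigD1_ord t) //= scalerDr (scalerA (ks _) (ks (c t))).
    rewrite -rmorphM divfK // opprD -!addrA; congr (v + _).
    rewrite [X in _ = _ + X]addrCA addKr scaler_sumr -sumrN -sumrN -big_split /=.
    apply: eq_bigr => s _.
    by rewrite rmorphB scalerBl opprB (rmorphM _ _ (c _)) scalerA addrC.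
  apply: rpredD; last exact: rpredZ.
  by apply: UL; apply: rpredB => //; exact: rpredZ.
exists n.+1, (fun m => if m is m'.+1 then W m' else U); split=> // -[_|m]; last exact: Wi.
by rewrite W0; split=> //; exact: simple_line LE iU.
Qed.

Definition kfin M := exists d (g : 'I_d -> M), forall y, exists c : 'I_d -> k,
  y = \sum_t ks (c t) *: g t.

Lemma kfin_cyclic M (g : M) : (forall y, exists a, y = a *: g) -> kfin M.
Proof.
move=> gen; have [d [f fP]] := basic_fin B; exists d, (fun t => f t *: g) => y.
have [a ->] := gen y; have [c ->] := fP a; exists c.
by rewrite scaler_suml; apply: eq_bigr => t _; rewrite scalerA.
Qed.

Lemma simple_jpow M : simple_mod M -> iszero (jpow B M 1).
Proof.
move=> [[x x0] Msim]; have [//|full] := Msim (jpow B M 1).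
have [n nP] := jpow_nil B M; case: x0; apply: nP.
apply: (@jpow_nakayama _ _ _ B) => y; exists 0; first exact: rpred0.
exact: full.
Qed.

(** The map from A e_j sending e_j to y is onto by simplicity. Its kernel is J e_j: modulo J an
    element of A e_j is a multiple c e_j, and J kills M. *)
Lemma simple_top M j (y : M) : simple_mod M -> y <> 0 -> e j *: y = y ->
  miso (topmod (lideal (e j))) M.
Proof.
move=> Msim y0 ey.
have ann a : a *: lid (e j) 1 = 0 -> a *: y = 0.
  by rewrite lid_scale mulr1 => /lid0 ae; rewrite -ey scalerA ae scale0r.
have [f fE] := cyclic_hom (@lid_gen _ (e j)) ann.
apply: (qmod_miso (f := f)) => [v|x].
  have P0 : exists x, f x = 0 by exists 0; rewrite linear0.
  have PD a y1 y2 : (exists x, f x = y1) -> (exists x, f x = y2) ->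
      exists x, f x = a *: y1 + y2.
    by move=> [x <-] [z <-]; exists (a *: x + z); rewrite linearP.
  have [im0|full] := (proj2 Msim) (mksub P0 PD); last exact/(mksubE P0 PD)/full.
  case: y0; apply: im0; apply/mksubE; exists (1 *: lid (e j) 1).
  by rewrite fE scale1r.
rewrite (radpow_jpow B).
split=> [|xJ]; last by apply: (simple_jpow Msim); exact: lin_jpow.
have [a ->] := lid_gen x.
have [eg _ _] := lideal_gen B j.
have [c [i [Ji aE]]] := bid_mod_split eg a; rewrite aE.
have cE : f (ks c *: lid (e j) 1 + i *: lid (e j) 1) = ks c *: y + i *: y.
  by rewrite linearD !fE.
have iy0 : i *: y = 0 by apply: (simple_jpow Msim); exact: rad_scale.
rewrite cE iy0 addr0 => cy0.
have [c0|c0] := eqVneq c 0; last first.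
  by case: y0; rewrite -(ks_inj y c0) cy0 scaler0.
by rewrite c0 rmorph0 scale0r add0r; exact: rad_scale.
Qed.

(** With [comp_factor_bid], the top of A e_j occurs in M exactly when e_j M is nonzero. The first
    member of a composition series containing e_j y provides a nonzero vector fixed by e_j in a
    simple subquotient. *)
Lemma comp_factor_mem M j (y : M) : kfin M -> e j *: y <> 0 ->
  comp_factor M (topmod (lideal (e j))).
Proof.
move=> [d [g gP]] ey0.
have [n0 nz] := jpow_nil B M.
(* The vanishing power J^n0 M serves as the zero submodule at the bottom of the chain. *)
have [|n [W [W0 Wn Wi]]] := @comp_chain M d (jpow B M n0).
  by exists g => v; have [c ->] := gP v; exists c; rewrite subrr rpred0.
set z := e j *: y in ey0; have ez : e j *: z = z by exact: bid_mod.
have ex : exists i, z \in W i by exists n; exact: Wn.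
have [[|i] zi imin] := ex_minnP ex; first by case: ey0; apply: nz; rewrite -W0.
have ltin : (i < n)%N by apply: imin; exact: Wn.
have [_ Lsim] := Wi i ltin.
exists n, W, i; split=> //; first by split=> //; rewrite W0.
have zW : z \notin W i by apply/negP => /imin; rewrite ltnn.
apply: (simple_top Lsim (y := piq (restr (W i.+1) (W i)) (Sub z zi))).
  by move/piq0; rewrite restrE SubK; exact/negP.
by rewrite -linearZ; congr piq; apply: val_inj.
Qed.

Lemma topmod_bid j : exists2 y : topmod (lideal (e j)), y <> 0 & e j *: y = y.
Proof.
exists (piq _ (lid (e j) 1)).
  move/piq0/(radpow_jpow B)/jpow1_lideal; rewrite /= mul1r; exact: bid_nrad.
by rewrite -linearZ; have [-> _ _] := lideal_gen B j.
Qed.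

Lemma comp_factor_bid M j S : miso S (topmod (lideal (e j))) ->
  comp_factor M S -> exists y : M, e j *: y <> 0.
Proof.
move=> Siso [n [U [i [_ _ /miso_sym SL]]]].
have [f [g fK gK]] := miso_sym (miso_trans SL Siso).
have [y y0 ey] := topmod_bid j; have [x xE] := piq_onto (f y).
exists (val x) => ex0; apply: y0; apply: (can_inj fK); rewrite linear0 -ey linearZ_LR -xE.
by rewrite -linearZ; apply/piq0; rewrite restrE -[val _]/(e j *: val x) ex0 rpred0.
Qed.

End CompositionSeries.

Section Standard.
Variables (k : fieldType) (X : strat k) (B : basic X (st_idx X)).
Local Notation e := (bid B).

(* [D] is the quotient of [X e_i] by the trace of the [X e_j] with [j] not
   below [i], and [d] is the class of [e_i]; this determines [D] by a universal
   property that is invariant under pullback along isomorphisms. *)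
Definition std_pres i (D : lmodType X) (d : D) :=
  [/\ e i *: d = d, forall y, exists a, y = a *: d,
      forall j, ~ st_le j i -> forall y : D, e j *: y = 0 &
      forall (D' : lmodType X) (d' : D'), e i *: d' = d' ->
        (forall j, ~ st_le j i -> forall y : D', e j *: y = 0) ->
        forall a, a *: d = 0 -> a *: d' = 0].

(** The trace is the smallest submodule of X e_i containing all e_j x with j not below i; any map to
    a module on which these e_j vanish kills it. *)
Lemma std_pres_exists i : exists (D : lmodType X) (d : D), std_pres i d.
Proof.
pose P (y : lideal (e i)) := forall V : submod (lideal (e i)),
  (forall j x, ~ st_le j i -> e j *: x \in V) -> y \in V.
have P0 : P 0 by move=> V _; exact: rpred0.
have PD a x y : P x -> P y -> P (a *: x + y).
  by move=> xP yP V VP; apply: rpredD; [apply: rpredZ; exact: xP|exact: yP].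
have [eg _ gen] := lideal_gen B i.
exists (qmod (mksub P0 PD)), (piq _ (lid (e i) 1)); split.
- by rewrite -linearZ eg.
- move=> y; have [x <-] := piq_onto y; have [a ->] := gen x.
  by exists a; rewrite -linearZ.
- move=> j ji y; have [x <-] := piq_onto y; rewrite -linearZ.
  by apply/piq0/mksubE => V; exact.
move=> D' d' ed' D'le a; rewrite -linearZ => /piq0/mksubE aP.
have ann b : b *: lid (e i) 1 = 0 -> b *: d' = 0.
  by rewrite lid_scale mulr1 => /lid0 be; rewrite -ed' scalerA be scale0r.
have [f fE] := cyclic_hom gen ann.
have K0 : f 0 = 0 by rewrite linear0.
have KD b y1 y2 : f y1 = 0 -> f y2 = 0 -> f (b *: y1 + y2) = 0.
  by move=> y1K y2K; rewrite linearP y1K y2K scaler0 addr0.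
rewrite -fE; apply/(mksubE K0 KD)/aP => j x ji; apply/mksubE.
by rewrite linearZ; exact: D'le.
Qed.

Hypothesis simE : forall i, miso (st_simple i) (topmod (lideal (e i))).

(** The condition on composition factors of a cyclic module amounts to the vanishing of e_j for all
    j not below i. The kernel of p is the radical of X e_i, so p is essential by Nakayama. *)
Lemma std_pres_standard i (D : lmodType X) (d : D) : std_pres i d -> is_standard i D.
Proof.
move=> [ed gen Dle Duniv].
have [eg _ ggen] := lideal_gen B i.
have [f fb] := miso_sym (simE i).
have ann (N : lmodType X) (y : N) : e i *: y = y -> forall a,
    a *: lid (e i) 1 = 0 -> a *: y = 0.
  by move=> ey b; rewrite lid_scale mulr1 => /lid0 be; rewrite -ey scalerA be scale0r.
have [q qE] := cyclic_hom ggen (ann _ _ ed).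
pose p : {linear lideal (e i) -> st_simple i} := f \o @piq _ _ _.
exists (lideal (e i)), p, q; split.
- split; first by apply: lideal_projective; exact: bid_idem.
    move=> y; have [z <-] := bij_onto fb y; have [x <-] := piq_onto z.
    by exists x.
  move=> U UP; apply: (@jpow_nakayama _ _ _ B) => y.
  have [u [v [uU pv ->]]] := UP y; exists u => //; rewrite addrC addKr.
  by apply/(radpow_jpow B)/piq0; apply: (bij_inj fb); rewrite linear0.
- by move=> y; have [a ->] := gen y; exists (a *: lid (e i) 1); rewrite qE.
- move=> j /(comp_factor_bid (simE j))[y ey]; apply: contrapT => /Dle /(_ y).
  exact: ey.
move=> D' q' q'onto D'le x; have [a ->] := ggen x; rewrite qE linearZ_LR.
apply: Duniv; first by rewrite -linearZ eg.
move=> j ji y; apply: contrapT => ey; apply: ji; apply: D'le.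
have D'fin : kfin D'.
  apply: (@kfin_cyclic _ _ _ B D' (q' (lid (e i) 1))) => z; have [w <-] := q'onto z.
  by have [b ->] := ggen w; exists b; rewrite linearZ.
have [n [U [l [Us ln SU]]]] := comp_factor_mem D'fin ey.
by exists n, U, l; split=> //; exact: miso_trans (simE j) SU.
Qed.

End Standard.

(** The universal property over X is tested over Y, by pulling the test module back along the
    inverse of f. *)
Lemma std_pres_pullback (k : fieldType) (X Y : strat k)
    (BX : basic X (st_idx X)) (BY : basic Y (st_idx Y)) (f : {rmorphism X -> Y})
    (sigma : st_idx X -> st_idx Y) :
  bijective f -> bijective sigma -> (forall i, f (bid BX i) = bid BY (sigma i)) ->
  (forall i j, st_le i j <-> st_le (sigma i) (sigma j)) ->
  forall i (D : lmodType Y) (d : D), std_pres BY (sigma i) d ->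
    @std_pres _ _ BX i (pullback f D) d.
Proof.
move=> [g fK gK] [tau sK tK] fe le i D d [ed gen Dle Duniv].
have gadd : zmod_morphism g by move=> x y; apply: (can_inj fK); rewrite rmorphB !gK.
have gmul : monoid_morphism g.
  by split=> [|x y]; apply: (can_inj fK); rewrite ?rmorph1 ?rmorphM !gK.
pose gm : {rmorphism Y -> X} := HB.pack g
  (GRing.isZmodMorphism.Build Y X g gadd) (GRing.isMonoidMorphism.Build Y X g gmul).
split.
- by rewrite -[LHS]/(f (bid BX i) *: d) fe.
- by move=> y; have [a ->] := gen y; exists (g a); rewrite -[RHS]/(f (g a) *: d) gK.
- move=> j ji y; rewrite -[LHS]/(f (bid BX j) *: (y : D)) fe; apply: Dle.
  by move/le.
move=> D' d' ed' D'le a; rewrite -[LHS]/(f a *: d) => fad.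
rewrite -(fK a); apply: (Duniv (pullback gm D') d') fad.
  by rewrite -[LHS]/(g (bid BY (sigma i)) *: d') -fe fK.
move=> j ji y; rewrite -[LHS]/(g (bid BY j) *: (y : D')) -(tK j) -fe fK.
by apply: D'le => /le; rewrite tK.
Qed.

(** * Path algebras and their quotients *)

Section IdealLemmas.
Variable A : pzRingType.

Definition mkideal (P : A -> Prop) (P0 : P 0) (PB : forall x y, P x -> P y -> P (x - y))
  (PM : forall a x, P x -> P (a * x) /\ P (x * a)) : ideal A.
Proof.
exists (fun x => `[< P x >]); first split; first exact/asboolP.
  by move=> x y /asboolP Px /asboolP Py; apply/asboolP; exact: PB.
by move=> a x /asboolP /(PM a)[? ?]; split; exact/asboolP.
Defined.

Lemma mkidealE P P0 PB PM x : x \in @mkideal P P0 PB PM <-> P x.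
Proof. by split=> /asboolP. Qed.

Lemma idealgen_in (S : A -> Prop) x : S x -> x \in idealgen S.
Proof. by move=> Sx; apply/asboolP => I; exact. Qed.

Lemma idealgen_sub (S : A -> Prop) (I : ideal A) x :
  (forall s, S s -> s \in I) -> x \in idealgen S -> x \in I.
Proof. by move=> SI /asboolP; exact. Qed.

Lemma qproj0 (I : ideal A) x : qproj I x = 0 <-> x \in I.
Proof.
rewrite -[in X in _ <-> X](subr0 x) -qring_eqE -/(qproj I x) -/(qproj I 0) raddf0.
by split=> [->|/eqP].
Qed.

Lemma qproj_onto (I : ideal A) : onto (qproj I).
Proof. by move=> y; exists (repr y); rewrite /qproj reprK. Qed.

End IdealLemmas.

Section Paths.
Variable Q : quiver.
Implicit Types p q : qpath Q.
Local Notation plen p := (size (pword p)).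

Lemma qpathP p q : psrc p = psrc q -> pword p = pword q -> p = q.
Proof.
move: p q => [[v w] p] [[v' w'] q]; rewrite /psrc /pword /= => vv ww.
by apply: val_inj; rewrite /= vv ww.
Qed.

Lemma pcomp_tgtE p q r : pcomp p q = Some r ->
  [/\ psrc p = ptgt q, psrc r = psrc q, ptgt r = ptgt p & pword r = pword q ++ pword p].
Proof.
by move=> pq; have /eqP/pcompP[? ? ?] := pq; rewrite (pcomp_tgt pq).
Qed.

Lemma pcomp_ex p q : psrc p = ptgt q -> exists r, pcomp p q = Some r.
Proof.
move/eqP; rewrite -[_ == _]negbK -pcomp_none.
by case: (pcomp p q) => // r _; exists r.
Qed.

Lemma path_rcons p w a : pword p = rcons w a ->
  exists q, [/\ psrc q = psrc p, pword q = w, ptgt q = tl a, ptgt p = hd a &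
    pcomp (parr a) q = Some p].
Proof.
move=> pE; have := valP p; rewrite -/(psrc p) -/(pword p) pE -cats1 is_walk_cat /=.
case/and3P => walk /eqP tla _.
exists (exist _ (psrc p, w) walk); split=> //.
  by rewrite /ptgt pE map_rcons last_rcons.
by apply/eqP/pcompP; split=> //; rewrite pE -cats1.
Qed.

Lemma path_cons p w a : pword p = a :: w ->
  exists q, [/\ psrc q = hd a, pword q = w, ptgt q = ptgt p, psrc p = tl a &
    pcomp q (parr a) = Some p].
Proof.
move=> pE; have := valP p; rewrite -/(psrc p) -/(pword p) pE /=.
case/andP => /eqP tla walk.
exists (exist _ (hd a, w) walk); split=> //; first by rewrite /ptgt pE.
by apply/eqP/pcompP; split=> //; rewrite pE.
Qed.

End Paths.

Section PathFiltration.
Variables (k : fieldType) (Q : quiver).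
Local Notation palg := (palg k Q).
Local Notation KQ := (path_alg k Q).
Local Notation pb := (@pbase k Q).
Local Notation plen p := (size (pword p)).
Implicit Types (x y : palg) (p q : qpath Q).

Lemma cf_base p q : (pb p)@_q = (p == q)%:R.
Proof. by rewrite pbase.unlock mcoeffU. Qed.

Lemma palg_sum x : x = \sum_(p <- msupp x) x@_p *: pb p.
Proof. exact: palgE. Qed.

Lemma pbM p q : (pb p : KQ) * pb q = pbase_opt k (pcomp p q).
Proof. exact: pmul_base. Qed.

Lemma pscaleAl c x y : (c *: x : KQ) * y = c *: ((x : KQ) * y : palg).
Proof. exact: (linearZ_LR (pmulr y)). Qed.

Lemma pscaleAr c x y : (x : KQ) * (c *: y) = c *: ((x : KQ) * y : palg).
Proof. exact: (linearZ_LR (pmul x)). Qed.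

Lemma kscalE c x : kscal KQ c * x = c *: x.
Proof. exact: pscalE. Qed.

(** Membership in the n-th power of the arrow ideal, expressed by coefficients; see [arrow_expE]. *)
Definition Fl n x := forall p, (plen p < n)%N -> x@_p = 0.

Lemma Fl_ind n (V : palg -> Prop) : V 0 -> (forall x y, V x -> V y -> V (x + y)) ->
  (forall c p, (n <= plen p)%N -> V (c *: pb p)) -> forall x, Fl n x -> V x.
Proof.
move=> V0 VD VZ x xn; rewrite (palg_sum x); apply: big_ind => //.
move=> p _; have [np|pn] := leqP n (plen p); first exact: VZ.
by rewrite (xn p pn) scale0r.
Qed.

Lemma palg_span (V : palg -> Prop) : V 0 -> (forall x y, V x -> V y -> V (x + y)) ->
  (forall c p, V (c *: pb p)) -> forall x, V x.
Proof. by move=> V0 VD VZ x; apply: (Fl_ind (n := 0)). Qed.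

Lemma Fl0 n : Fl n 0. Proof. by move=> p _; rewrite mcoeff0. Qed.
Lemma FlD n x y : Fl n x -> Fl n y -> Fl n (x + y).
Proof. by move=> xn yn p pn; rewrite mcoeffD xn ?yn ?addr0. Qed.
Lemma FlZ n c x : Fl n x -> Fl n (c *: x).
Proof. by move=> xn p pn; rewrite mcoeffZ xn ?mulr0. Qed.
Lemma FlN n x : Fl n x -> Fl n (- x).
Proof. by rewrite -scaleN1r; exact: FlZ. Qed.
Lemma FlB n x y : Fl n x -> Fl n y -> Fl n (x - y).
Proof. by move=> xn yn; apply: FlD => //; exact: FlN. Qed.
Lemma Fl_base n p : (n <= plen p)%N -> Fl n (pb p).
Proof.
move=> np q qn; rewrite cf_base; case: eqP => // pq.
by move: qn; rewrite -pq ltnNge np.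
Qed.
Lemma Fl_baseP n p : Fl n (pb p) -> (n <= plen p)%N.
Proof.
move=> pn; rewrite leqNgt; apply/negP => /pn/eqP.
by rewrite cf_base eqxx oner_eq0.
Qed.
Lemma Fl_le m n x : (m <= n)%N -> Fl n x -> Fl m x.
Proof. by move=> mn xn p pm; apply: xn; exact: leq_trans mn. Qed.
Lemma FlM m n x y : Fl m x -> Fl n y -> Fl (m + n) ((x : KQ) * y).
Proof.
move=> xm yn; elim/(Fl_ind (n := m)): x / xm => [|x x' xP x'P|c p mp].
- by rewrite mul0r; exact: Fl0.
- by rewrite (mulrDl (x : KQ)); exact: FlD.
rewrite pscaleAl; apply: FlZ.
elim/(Fl_ind (n := n)): y / yn => [|y y' yP y'P|d q nq].
- by rewrite mulr0; exact: Fl0.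
- by rewrite (mulrDr (pb p : KQ)); exact: FlD.
rewrite pscaleAr pbM; apply: FlZ.
case pq : (pcomp p q) => [r|] /=; last exact: Fl0.
have [_ _ _ rE] := pcomp_tgtE pq; apply: Fl_base.
by rewrite rE size_cat addnC leq_add.
Qed.

Lemma FlMl n a x : Fl n x -> Fl n ((a : KQ) * x).
Proof. by move=> xn; rewrite -[n]add0n; exact: FlM. Qed.
Lemma FlMr n a x : Fl n x -> Fl n ((x : KQ) * a).
Proof. by move=> xn; rewrite -[n]addn0; exact: FlM. Qed.

Definition Fl_ideal n : ideal KQ := @mkideal KQ (Fl n) (@Fl0 n) (@FlB n)
  (fun a x xn => conj (@FlMl n a x xn) (@FlMr n a x xn)).

Lemma Fl_idealE n x : x \in Fl_ideal n <-> Fl n x.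
Proof. exact: mkidealE. Qed.

(** Lengths add up under multiplication; conversely a long path splits off its last arrow, which is
    the left factor of the product. *)
Lemma arrow_expE n x : x \in ideal_exp (arrow_ideal k Q) n <-> Fl n x.
Proof.
split.
  elim: n x => [//|n IH] x; move/(@idealgen_sub _ _ (Fl_ideal n.+1)) => xP.
  apply/Fl_idealE/xP => _ [y [z [yJ zJ ->]]]; apply/Fl_idealE.
  rewrite -[n.+1]add1n; apply: FlM; last exact: IH.
  apply/Fl_idealE/(@idealgen_sub _ _ (Fl_ideal 1) _ _ yJ) => _ [a ->].
  by apply/Fl_idealE; exact: Fl_base.
elim/Fl_ind: x / => [|x y xP yP|c p np]; first exact: rpred0.
  exact: rpredD.
rewrite -kscalE; apply: (proj1 (ideal_mul _ _)).
elim: n p np => [|n IH] p np; first exact: idealgen_in.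
case/lastP pE : (pword p) => [|w a]; first by rewrite pE in np.
have [q [_ qw _ _ pq]] := path_rcons pE.
apply: idealgen_in; exists (pb (parr a)), (pb q); split.
- by apply: idealgen_in; exists a.
- by apply: IH; rewrite qw; move: np; rewrite pE size_rcons.
- by rewrite pbM pq.
Qed.

Lemma pb_trivM v w : (pb (ptriv v) : KQ) * pb (ptriv w) = if v == w then pb (ptriv v) else 0.
Proof. by rewrite pbM pcomp_trivl; case: eqP => [->|]. Qed.

Lemma pb_triv_l p : (pb (ptriv (ptgt p)) : KQ) * pb p = pb p.
Proof. by rewrite pbM pcomp_trivl eqxx. Qed.
Lemma pb_triv_r p : (pb p : KQ) * pb (ptriv (psrc p)) = pb p.
Proof. by rewrite pbM pcomp_trivr eqxx. Qed.
Lemma pb_triv_l0 p v : v != ptgt p -> (pb (ptriv v) : KQ) * pb p = 0.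
Proof. by rewrite pbM pcomp_trivl => /negPf->. Qed.
Lemma pb_triv_r0 p v : v != psrc p -> (pb p : KQ) * pb (ptriv v) = 0.
Proof. by rewrite pbM pcomp_trivr => /negPf->. Qed.

Definition cfl p : palg -> k^o := fun x => x@_p.
Lemma cfl_linear p : linear (cfl p).
Proof. by move=> c x y; rewrite /cfl mcoeffD mcoeffZ. Qed.
HB.instance Definition _ p :=
  GRing.isLinear.Build k palg k^o *:%R (cfl p) (cfl_linear p).

(** Paths can be cancelled: p is the only path whose composite with q is r, so nothing else
    contributes to the coefficient at r. *)
Lemma cf_comp p q r x : pcomp q p = Some r -> ((pb q : KQ) * x)@_r = x@_p.
Proof.
move=> qp; have [src_q src_r _ rE] := pcomp_tgtE qp; move: x.
apply: (palg_ind (F := cfl r \o pmul (pb q)) (G := cfl p)) => p' /=.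
rewrite pmul_base /cfl cf_base.
case qp' : (pcomp q p') => [r'|] /=.
  have [_ src_r' _ r'E] := pcomp_tgtE qp'.
  rewrite cf_base; congr (1 *+ nat_of_bool _); apply/eqP/eqP => [rr|pp]; last first.
    by apply: Some_inj; rewrite -qp -qp' pp.
  apply: qpathP; first by rewrite -src_r' rr.
  have sz : plen p' = plen p by apply: (@addIn (plen q)); rewrite -!size_cat -r'E -rE rr.
  have := eqseq_cat (pword q) (pword q) sz.
  by rewrite -r'E -rE rr !eqxx andbT => /esym/eqP.
rewrite mcoeff0; case: eqP => // pp.
by move: qp; rewrite -pp qp'.
Qed.

Lemma cf_comp_r p q r x : pcomp p q = Some r -> ((x : KQ) * pb q)@_r = x@_p.
Proof.
move=> qp; have [src_q src_r _ rE] := pcomp_tgtE qp; move: x.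
apply: (palg_ind (F := cfl r \o pmulr (pb q)) (G := cfl p)) => p' /=.
rewrite /pmulr pmul_base /cfl cf_base.
case qp' : (pcomp p' q) => [r'|] /=.
  have [src_q' src_r' _ r'E] := pcomp_tgtE qp'.
  rewrite cf_base; congr (1 *+ nat_of_bool _); apply/eqP/eqP => [rr|pp]; last first.
    by apply: Some_inj; rewrite -qp -qp' pp.
  apply: qpathP; first by rewrite src_q src_q'.
  have := eqseq_cat (pword p') (pword p) (erefl (plen q)).
  by rewrite -r'E -rE rr !eqxx => /esym/eqP.
rewrite mcoeff0; case: eqP => // pp.
by move: qp; rewrite -pp qp'.
Qed.

End PathFiltration.

(** * Quotients of a path algebra by an ideal between a power of the arrow ideal and the arrow
    ideal *)

Section PathQuotient.
Variables (k : fieldType) (Q : quiver) (I : ideal (path_alg k Q)) (n0 : nat).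
Hypothesis FlI : forall x, Fl n0 x -> x \in I.
Hypothesis IFl : forall x, x \in I -> Fl 1 x.
Local Notation KQ := (path_alg k Q).
Local Notation A := (qalg I).
Local Notation rp := (qproj I).
Local Notation pb := (@pbase k Q).
Local Notation plen p := (size (pword p)).
Local Notation ev v := (pb (ptriv v) : KQ).

Lemma rpZ c (x : palg k Q) : rp (c *: x) = kscal A c * rp x.
Proof. by rewrite -kscalE rmorphM. Qed.

Definition pq_rad (z : A) := exists2 x, Fl 1 x & rp x = z.

Let orth v w : rp (ev v) * rp (ev w) = if v == w then rp (ev v) else 0.
Proof. by rewrite -rmorphM pb_trivM; case: eqP => // _; rewrite rmorph0. Qed.

Let sum1 : \sum_v rp (ev v) = 1.
Proof. by rewrite -rmorph_sum -(rmorph1 rp). Qed.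

Let rad0 : pq_rad 0.
Proof. by exists 0; [exact: Fl0|exact: rmorph0]. Qed.
Let radD z t : pq_rad z -> pq_rad t -> pq_rad (z + t).
Proof. by move=> [x ? <-] [y ? <-]; exists (x + y); [exact: FlD|exact: rmorphD]. Qed.
Let radMl z t : pq_rad t -> pq_rad (z * t).
Proof.
have [x <-] := qproj_onto z.
by move=> [y ? <-]; exists ((x : KQ) * y); [exact: FlMl|exact: rmorphM].
Qed.
Let radMr z t : pq_rad t -> pq_rad (t * z).
Proof.
have [x <-] := qproj_onto z.
by move=> [y ? <-]; exists ((y : KQ) * x); [exact: FlMr|exact: rmorphM].
Qed.

Let splittable (z : A) := exists c : vert Q -> k,
  pq_rad (z - \sum_v kscal A (c v) * rp (ev v)).

Let splitD z t : splittable z -> splittable t -> splittable (z + t).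
Proof.
move=> [c cP] [d dP]; exists (fun v => c v + d v).
have -> : \sum_v kscal A (c v + d v) * rp (ev v) =
    \sum_v kscal A (c v) * rp (ev v) + \sum_v kscal A (d v) * rp (ev v).
  by rewrite -big_split; apply: eq_bigr => v _; rewrite rmorphD mulrDl.
rewrite opprD addrACA; exact: radD cP dP.
Qed.

Let split z : splittable z.
Proof.
have [x <-] := qproj_onto z; elim/palg_span: x => [|x y xP yP|c p].
- exists (fun=> 0); rewrite rmorph0 big1 ?subr0 // => v _.
  by rewrite rmorph0 mul0r.
- by rewrite rmorphD; exact: splitD.
case pE : (pword p) => [|a w].
  exists (fun v => if v == psrc p then c else 0).
  rewrite (bigD1 (psrc p)) // eqxx big1 ?Monoid.mulm1; last first.
    by move=> v /negPf->; rewrite (rmorph0 (kscal A)) mul0r.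
  have pv : p = ptriv (psrc p) by apply: qpathP.
  by rewrite -pv rpZ subrr.
exists (fun=> 0); rewrite big1 => [|v _]; last by rewrite rmorph0 mul0r.
by rewrite subr0; exists (c *: pb p) => //; apply/FlZ/Fl_base; rewrite pE.
Qed.

Let kill_Fl j i x : (i + j)%N = n0 -> Fl j x -> kill pq_rad i (rp x : A^o).
Proof.
elim: i j x => [|i IH] j x; first by rewrite add0n => -> xj; apply/qproj0/FlI.
move=> ij xj _ [y y1 <-]; rewrite -[_ *: _]/(rp y * rp x) -rmorphM.
by apply: (IH (1 + j)%N); [rewrite addnA addn1|exact: FlM].
Qed.

Let kill_n0 (z : A^o) : kill pq_rad n0 z.
Proof.
have [x <-] := qproj_onto z.
by apply: (@kill_Fl 0); [rewrite addn0|].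
Qed.

Let nil : exists n, forall z : A^o, kill pq_rad n z.
Proof. by exists n0. Qed.

Let nrad v : ~ pq_rad (rp (ev v)).
Proof.
move=> [x x1 /eqP]; rewrite -subr_eq0 -rmorphB => /eqP/qproj0/IFl x2.
have /Fl_baseP // : Fl 1 (ev v : palg k Q).
by rewrite -[ev v](subKr x); exact: FlB.
Qed.

Let fin : exists n (g : 'I_n -> A), forall z, exists c : 'I_n -> k,
  z = \sum_t kscal A (c t) * g t.
Proof.
(* The spanning family is indexed by a vertex and a list of at most n0 arrows; pairs that are not
   walks are sent to 0. *)
pose T : finType := (vert Q * n0.-bseq (arr Q))%type.
pose h (u : T) : A := if insub (u.1, val u.2) is Some p then rp (pb p) else 0.
exists #|T|, (h \o enum_val) => z.
suff [c ->] : exists c : T -> k, z = \sum_u kscal A (c u) * h u.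
  exists (c \o enum_val); rewrite (reindex _ (onW_bij _ (@enum_val_bij T))) /=.
  by [].
pose spanned (z : A) := exists c : T -> k, z = \sum_u kscal A (c u) * h u.
have spannedD y t : spanned y -> spanned t -> spanned (y + t).
  move=> [c ->] [d ->]; exists (fun u => c u + d u).
  by rewrite -big_split; apply: eq_bigr => u _; rewrite rmorphD mulrDl.
rewrite -/(spanned z); have [x <-] := qproj_onto z.
elim/palg_span: x => [|x y xP yP|c p].
- exists (fun=> 0); rewrite rmorph0 big1 // => u _; by rewrite rmorph0 mul0r.
- by rewrite rmorphD; exact: spannedD.
have [np|pn] := leqP n0 (plen p).
  exists (fun=> 0); rewrite big1 => [|u _]; last by rewrite rmorph0 mul0r.
  by apply/qproj0/FlI/FlZ/Fl_base.
pose u : T := (psrc p, Bseq (ltnW pn)).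
exists (fun u' => if u' == u then c else 0).
rewrite (bigD1 u) // eqxx big1 ?Monoid.mulm1; last first.
  by move=> v /negPf->; rewrite (rmorph0 (kscal A)) mul0r.
rewrite rpZ /h /= insubT /= => [|w]; first exact: (valP p).
by congr (_ * rp (pb _)); apply: qpathP.
Qed.

Definition pq_basic : basic A (vert Q) :=
  @Basic k A (vert Q) (fun v => rp (ev v)) pq_rad (@orth) sum1 rad0 (@radD) (@radMl)
    (@radMr) (@split) nil (@nrad) fin.

Lemma pq_radE x : Fl 1 x -> brad pq_basic (rp x).
Proof. by exists x. Qed.

Lemma pq_jpow_in (M : lmodType A) n x (y : M) : Fl n x -> rp x *: y \in jpow pq_basic M n.
Proof.
elim: n x => [//|n IH] x; elim/Fl_ind: x / => [|x x' xP x'P|c p np].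
- by rewrite rmorph0 scale0r rpred0.
- by rewrite rmorphD scalerDl rpredD.
case/lastP pE : (pword p) => [|w a]; first by rewrite pE in np.
have [q [_ qw _ _ pq]] := path_rcons pE.
rewrite rpZ -scalerA rpredZ // -[pb p]/(pbase_opt k (Some p)) -pq -pbM rmorphM -scalerA.
apply: jmul_in; first by apply: pq_radE; exact: Fl_base.
by apply/IH/Fl_base; rewrite qw; move: np; rewrite pE size_rcons.
Qed.

Lemma pq_jpow_n0 (M : lmodType A) : iszero (jpow pq_basic M n0).
Proof.
move=> y; apply: (@jpow_kill _ _ _ pq_basic _ n0 0) => z.
by rewrite addn0 -(scale1r z); apply: kill_act; exact: kill_n0.
Qed.

Lemma pq_jpow_gen (M : lmodType A) (g : M) n (y : M) :
  (forall y, exists a, y = a *: g) -> y \in jpow pq_basic M n ->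
  exists2 x, Fl n x & y = rp x *: g.
Proof.
move=> gen; elim: n y => [|n IH] y.
  by have [a ->] := gen y; have [x <-] := qproj_onto a; exists x.
pose P (y : M) := exists2 x, Fl n.+1 x & y = rp x *: g.
have P0 : P 0 by exists 0; [exact: Fl0|rewrite rmorph0 scale0r].
have PD a y1 y2 : P y1 -> P y2 -> P (a *: y1 + y2).
  have [z <-] := qproj_onto a; move=> [x xn ->] [x' x'n ->].
  exists ((z : KQ) * x + x'); first by apply: FlD => //; exact: FlMl.
  by rewrite rmorphD rmorphM scalerDl scalerA.
move/(@jmul_sub _ _ _ _ _ _ (mksub P0 PD)) => yP; apply/(mksubE P0 PD)/yP.
move=> a u [x x1 <-] /IH[z zn ->]; apply/mksubE; exists ((x : KQ) * z).
  by rewrite -add1n; exact: FlM.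
by rewrite rmorphM scalerA.
Qed.

Lemma pq_jpow0 (M : lmodType A) (g : M) n : (forall y, exists a, y = a *: g) ->
  iszero (jpow pq_basic M n) <-> forall x, Fl n x -> rp x *: g = 0.
Proof.
move=> gen; split=> [z x xn|z y /(pq_jpow_gen gen)[x xn ->]]; last exact: z.
by apply: z; exact: pq_jpow_in.
Qed.

End PathQuotient.

(** * The layers of the projectives over the truncated path algebra *)

Section Layers.
Variables (k : fieldType) (Q : quiver) (m : nat).
Hypothesis m0 : (0 < m)%N.
Local Notation KQ := (path_alg k Q).
Local Notation R := (trunc_alg k Q m).
Implicit Types M N : lmodType R.
Local Notation rp := (qproj (ideal_exp (arrow_ideal k Q) m)).
Local Notation pb := (@pbase k Q).
Local Notation plen p := (size (pword p)).
Local Notation ev v := (pb (ptriv v) : KQ).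

Definition trunc_basic : basic R (vert Q) :=
  pq_basic (fun x => proj2 (@arrow_expE k Q m x))
           (fun x xI => Fl_le m0 (proj1 (@arrow_expE k Q m x) xI)).
Local Notation B := trunc_basic.

Lemma rp0 x : rp x = 0 <-> Fl m x.
Proof. by rewrite qproj0; exact: arrow_expE. Qed.

(* [g] exhibits [M] as the layer [R e_v / rad^l (R e_v)] *)
Definition layer v l (M : lmodType R) (g : M) :=
  (forall y, exists x, y = rp x *: g) /\
  (forall x, rp x *: g = 0 <-> Fl l ((x : KQ) * ev v)).

Definition plength v := loewy_length (lideal (rp (ev v) : R)).

(** The paths of length below m that start at v form a basis of R e_v. A path of length at least n
    is cut down to its first n arrows to obtain one of length exactly n. *)
Lemma lt_plength v n : (n < plength v)%N <->
  (n < m)%N /\ exists p, psrc p = v /\ plen p = n.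
Proof.
rewrite ltnNge; split=> [/negP le|[nm [p [pv pn]]]].
  have [] := (@contrapT ((n < m)%N /\ exists p, psrc p = v /\ plen p = n)); last first.
    by move=> nm [p pP]; split=> //; exists p.
  move=> nP; apply: le; apply/(loewy_leP B)/(pq_jpow0 _ _ _ (@lid_gen _ _)).
  move=> x xn; rewrite lid_scale mulr1; apply/lid0; rewrite -rmorphM; apply/rp0.
  elim/Fl_ind: x / xn => [|x y xP yP|c p np]; first by rewrite mul0r; exact: Fl0.
    by rewrite (mulrDl (x : KQ)); exact: FlD.
  rewrite pscaleAl; apply: FlZ.
  have [pv|pv] := eqVneq v (psrc p); last by rewrite pb_triv_r0 //; exact: Fl0.
  rewrite pv pb_triv_r; apply: Fl_base; rewrite leqNgt; apply/negP => pm.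
  apply: nP; split; first exact: leq_ltn_trans pm.
  pose w := take n (pword p).
  have walk : is_walk (psrc p) w.
    by have := valP p; rewrite -/(psrc p) -/(pword p) -{1}(cat_take_drop n (pword p)) is_walk_cat => /andP[].
  exists (exist _ (psrc p, w) walk); split=> //.
  by rewrite /pword /= /w size_takel.
apply/negP => /(loewy_leP B)/(pq_jpow0 _ _ _ (@lid_gen _ _)) /(_ (pb p)).
rewrite lid_scale mulr1 => z; have /z/lid0 : Fl n (pb p) by apply: Fl_base; rewrite pn.
rewrite -rmorphM -pv pb_triv_r => /rp0/Fl_baseP.
by rewrite pn leqNgt nm.
Qed.

Lemma plength_le v : (plength v <= m)%N.
Proof. by rewrite leqNgt; apply/negP => /lt_plength[]; rewrite ltnn. Qed.

Lemma plength_gt0 v : (0 < plength v)%N.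
Proof. by apply/lt_plength; split=> //; exists (ptriv v). Qed.

Lemma layer_gen v l M (g : M) : layer v l g -> forall y, exists a, y = a *: g.
Proof. by move=> [gen _] y; have [x ->] := gen y; exists (rp x). Qed.

Lemma layer_bid v l M (g : M) : layer v l g -> rp (ev v) *: g = g.
Proof.
move=> [_ gE]; apply/eqP; rewrite -subr_eq0 -[X in _ - X]scale1r -scalerBl.
rewrite -(rmorph1 rp) -rmorphB; apply/eqP/gE.
by rewrite mulrBl pb_trivM eqxx mul1r subrr; exact: Fl0.
Qed.

Lemma layer_local v l M (g : M) : (0 < l)%N -> layer v l g -> local_gen B v g.
Proof.
move=> l0 gL; split; [exact: layer_bid gL| |exact: layer_gen gL].
move=> g0; have [_ gE] := gL; have /gE : rp 1 *: g = 0 by rewrite g0 scaler0.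
by rewrite mul1r => /Fl_baseP; rewrite leqNgt l0.
Qed.

Lemma layer_mod_layer v l : (l <= m)%N ->
  layer v l (piq (radpow (lideal (rp (ev v) : R)) l) (lid _ 1)).
Proof.
move=> lm; split=> [y|x].
  have [z <-] := piq_onto y; have [a ->] := lid_gen z; have [x <-] := qproj_onto a.
  by exists x; rewrite -linearZ.
rewrite -linearZ piq0 (radpow_jpow B); split.
  case/(pq_jpow_gen (@lid_gen _ _)) => y yl; rewrite !lid_scale !mulr1.
  move/(congr1 val) => /= /eqP; rewrite -!rmorphM -subr_eq0 -rmorphB => /eqP/rp0 xy.
  rewrite -(subrK ((y : KQ) * ev v) ((x : KQ) * ev v)); apply: FlD; last exact: FlMr.
  exact: Fl_le xy.
move=> xl; have -> : rp x *: lid (rp (ev v)) 1 = rp ((x : KQ) * ev v) *: lid (rp (ev v)) 1.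
  by rewrite !lid_scale !mulr1; apply: val_inj; rewrite /= rmorphM -mulrA (bid_idem B v).
exact: pq_jpow_in.
Qed.

Lemma layer_miso v l M (g : M) N (h : N) : layer v l g -> layer v l h -> miso M N.
Proof.
move=> gL hL; have [_ gE] := gL; have [_ hE] := hL.
have ann a : a *: g = 0 -> a *: h = 0.
  by have [x <-] := qproj_onto a; move/gE/hE.
have [f fE] := cyclic_hom (layer_gen gL) ann; exists f; apply: lin_bij => y.
  have [a ->] := layer_gen gL y; rewrite fE; have [x <-] := qproj_onto a.
  by move/hE/gE.
by have [a ->] := layer_gen hL y; exists (a *: g).
Qed.

Lemma miso_layer_gen v l M (g : M) N : miso M N -> layer v l g -> exists h : N, layer v l h.
Proof.
move=> [f [f' fK Kf]] [gen gE]; exists (f g); split=> [y|x].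
  by have [x xE] := gen (f' y); exists x; rewrite -linearZ -xE.
rewrite -linearZ; split=> [fx0|/gE->]; last exact: linear0.
by apply/gE; apply: (can_inj fK); rewrite linear0.
Qed.

(** [in_add_layers] admits exponents up to the Loewy length of the whole algebra; those beyond
    [plength v] only repeat R e_v. *)
Lemma layer_trunc v l M (g : M) : (l <= m)%N -> layer v l g ->
  layer v (minn l (plength v)) g.
Proof.
move=> lm [gen gE]; split=> // x; rewrite gE; split; first by apply: Fl_le; exact: geq_minl.
have [lp|pl] := leqP l (plength v); first by [].
have /(pq_jpow0 _ _ _ (@lid_gen _ _)) z : iszero (jpow B (lideal (rp (ev v) : R)) (plength v)).
  by apply/(loewy_leP B).
move=> /z; rewrite lid_scale mulr1 => /lid0.
by rewrite -rmorphM -mulrA pb_trivM eqxx => /rp0; exact: Fl_le.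
Qed.

Lemma Fl1_corner v v' x : v != v' -> Fl 1 (ev v' * ((x : KQ) * ev v)).
Proof.
move=> vv; elim/palg_span: x => [|x y xP yP|c p].
- by rewrite mul0r mulr0; exact: Fl0.
- by rewrite (mulrDl (x : KQ)) (mulrDr (ev v')); exact: FlD.
rewrite pscaleAl pscaleAr; apply: FlZ.
have [vp|pv] := eqVneq v (psrc p); last by rewrite pb_triv_r0 // mulr0; exact: Fl0.
rewrite vp pb_triv_r.
have [v'p|pv] := eqVneq v' (ptgt p); last by rewrite pb_triv_l0 //; exact: Fl0.
rewrite v'p pb_triv_l; apply: Fl_base; case pE : (pword p) => [|//].
by move: vv; rewrite v'p vp /ptgt pE /= eqxx.
Qed.

(** If v and v' differ, passing from g to g' and back multiplies g by an element of the arrow ideal,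
    yet returns g. If l < l', a path of length l starting at v kills the whole module when M is seen
    as the layer l, but not the generator g' of the layer l'. *)
Lemma layer_uniq v l v' l' M (g g' : M) : (0 < l <= plength v)%N -> (0 < l' <= plength v')%N ->
  layer v l g -> layer v' l' g' -> v = v' /\ l = l'.
Proof.
move=> ll ll' gL gL'.
have vv : v = v'.
  apply/eqP; apply: contraT => vv.
  have [y gy] := proj1 gL' g; have [x gx] := proj1 gL g'.
  have /(proj2 gL) : rp (1 - (y : KQ) * (ev v' * ((x : KQ) * ev v))) *: g = 0.
    rewrite rmorphB rmorph1 scalerBl scale1r !rmorphM -!scalerA (layer_bid gL) -gx.
    by rewrite (layer_bid gL') -gy subrr.
  case/andP: ll => l0 _ /(Fl_le l0) F1; have /Fl_baseP // : Fl 1 (ev v : palg k Q).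
  rewrite -[ev v](subrK ((y : KQ) * (ev v' * ((x : KQ) * ev v)) * ev v)); apply: FlD.
    by rewrite -[X in X - _]mul1r -mulrBl.
  by apply: FlMr; apply: FlMl; exact: Fl1_corner.
split=> //; move: vv ll' gL' => <- ll' gL'.
wlog lt : l l' g g' ll ll' gL gL' / (l < l')%N.
  move=> H; have [lt|lt|//] := ltngtP l l'; first exact: (H l l' g g').
  by apply/esym; exact: (H l' l g' g).
have [nm [p [pv pn]]] : (l < m)%N /\ exists p, psrc p = v /\ plen p = l.
  by apply: (proj1 (lt_plength v l)); have /andP[_ /(leq_trans lt)] := ll'.
have [x gx] := proj1 gL g'.
have : rp (pb p) *: g' = 0.
  by rewrite gx scalerA -rmorphM; apply/(proj2 gL)/FlMr/FlMr/Fl_base; rewrite pn.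
move/(proj2 gL'); rewrite -pv pb_triv_r => /Fl_baseP.
by rewrite pn leqNgt lt.
Qed.

End Layers.

(** * The algebra kQ/J^m and its layers *)

Section Truncated.
Variables (k : fieldType) (Q : quiver) (m : nat).
Hypothesis m0 : (0 < m)%N.
Local Notation KQ := (path_alg k Q).
Local Notation R := (trunc_alg k Q m).
Implicit Types M N : lmodType R.
Local Notation rp := (qproj (ideal_exp (arrow_ideal k Q) m)).
Local Notation pb := (@pbase k Q).
Local Notation plen p := (size (pword p)).
Local Notation ev v := (pb (ptriv v) : KQ).
Local Notation B := (trunc_basic k Q m0).
Local Notation plength v := (@plength k Q m v).

Lemma loewy_trunc M : (loewy_length M <= m)%N.
Proof. by apply/(loewy_leP B); exact: pq_jpow_n0. Qed.

Lemma plength_trunc v : (plength v <= loewy_length (R^o : lmodType R))%N.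
Proof.
apply: (@onto_loewy _ _ _ B _ _ (mklin (@lid_linear _ (rp (ev v) : R)))) => y.
by have [a ->] := lidP y; exists a.
Qed.

Lemma primitive_layer (e : R) l : primitive e -> (l <= m)%N ->
  exists w (g : layer_mod e l), loewy_length (lideal e) = plength w /\
    layer w (minn l (plength w)) g.
Proof.
move=> /(primitive_lideal B)[w ew] lm.
have [g gL] := miso_layer_gen (miso_layer B l (miso_sym ew)) (layer_mod_layer k m0 w lm).
exists w, g; split; first exact: (miso_loewy B ew).
exact: layer_trunc.
Qed.

Lemma add_layers_classify M : indecomposable M -> in_add_layers M ->
  exists v (l : 'I_m) (g : M), (l < plength v)%N /\ layer v l.+1 g.
Proof.
move=> Mind [n [e [i [ei [s [r rs]]]]]].
have im t : (i t <= m)%N.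
  by have [_ /andP[_ h]] := ei t; apply: leq_trans h _; exact: loewy_trunc.
have eL t := primitive_layer (proj1 (ei t)) (im t).
have lt0 t w : (0 < minn (i t) (plength w))%N.
  by rewrite leq_min plength_gt0 // andbT; have [_ /andP[]] := ei t.
have [|t Mt] := retract_local (B := B) rs Mind.
  move=> t; have [w [g [_ gL]]] := eL t; exists w, g.
  exact: (layer_local m0 _ gL).
have [w [g [_ gL]]] := eL t.
have [h hL] := miso_layer_gen (miso_sym Mt) gL.
have lm : ((minn (i t) (plength w)).-1 < m)%N.
  by rewrite prednK //; apply: leq_trans (geq_minl _ _) _.
exists w, (Ordinal lm), h; rewrite /= prednK //; split=> //; exact: geq_minr.
Qed.

Lemma layer_mod_indec v l : (l < plength v)%N ->
  indecomposable (layer_mod (rp (ev v) : R) l.+1).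
Proof.
move=> lv; have lm : (l < m)%N by apply: (leq_trans lv); exact: plength_le.
exact: (local_indec (layer_local m0 _ (layer_mod_layer k m0 v lm))).
Qed.

Lemma layer_mod_add v l : (l < plength v)%N ->
  in_add_layers (layer_mod (rp (ev v) : R) l.+1).
Proof.
move=> lv; pose L : lmodType R := layer_mod (rp (ev v) : R) l.+1.
exists 1%N, (fun=> rp (ev v) : R), (fun=> l.+1); split.
  move=> _; split; first exact: (bid_primitive B).
  by rewrite /=; apply: leq_trans lv (plength_trunc _).
exists (mklin (@dinj_linear R _ (fun=> L) (@ord0 0))),
  (mklin (@dproj_linear R _ (fun=> L) (@ord0 0))) => y.
exact: (@dinjE R _ (fun=> L) (@ord0 0) y).
Qed.

Lemma adr_inhabited : inhabited (adr R).
Proof.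
(* Level l stands for the exponent l + 1, so l < [plength v] selects each nonzero layer once. *)
pose T : finType := {x : vert Q * 'I_m | (x.2 < plength x.1)%N}.
pose N (x : T) : lmodType R := layer_mod (rp (ev (val x).1) : R) (val x).2.+1.
have NL (x : T) : layer (val x).1 (val x).2.+1
    (piq (radpow (lideal (rp (ev (val x).1) : R)) (val x).2.+1) (lid _ 1)).
  exact: layer_mod_layer.
apply: inhabits; apply: (@Adr R T N) => [x|x|x y xy|M Mind Madd].
- exact: (layer_mod_indec (valP x)).
- exact: (layer_mod_add (valP x)).
- have [h hL] := miso_layer_gen xy (NL x).
  have [||v1 l1] := layer_uniq m0 _ _ hL (NL y); [exact: (valP x)|exact: (valP y)|].
  apply: val_inj; move: v1 l1; case: (val x) (val y) => [v l] [v' l'] /= -> [ll].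
  by congr pair; apply: val_inj.
have [v [l [g [lv gL]]]] := add_layers_classify Mind Madd.
exists (Sub (v, l) lv); apply: layer_miso gL _.
by exact: layer_mod_layer.
Qed.

(** Suppose J^(m-1) P = 0 and embed P in a free module by a section h. A path q of length m - 1
    starts at every vertex; it kills y, hence each coordinate of h(y), whose coefficient at the
    trivial path must then be 0. So h(y) has coordinates in J, thus P = J P, and P = 0 by
    Nakayama. *)
Lemma projective_loewy (P : lmodType R) : (forall v, plength v = m) ->
  fingen P -> indecomposable P -> projective P -> loewy_length P = m.
Proof.
move=> full [n [g gP]] [[x0 x00] _] Pproj.
apply/eqP; rewrite eqn_leq loewy_trunc /= leqNgt; apply/negP => lt.
have m1 : (m.-1 < m)%N by rewrite prednK.
have z : iszero (jpow B P m.-1) by apply/(loewy_leP B); rewrite -ltnS prednK.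
pose F : lmodType R := dsum (fun=> R^o : lmodType R) (I := 'I_n).
have fl : linear (fun f : F => \sum_t (f t : R) *: g t : P).
  move=> a f f'; rewrite scaler_sumr -big_split; apply: eq_bigr => t _.
  by rewrite -[LHS]/((a * f t + f' t : R) *: g t) scalerDl scalerA.
have fo : onto (mklin fl) by move=> y; have [c ->] := gP y; exists c.
have [h hE] := Pproj _ _ (mklin fl) idfun fo.
have hJ y t : brad B (h y t).
  have [x xE] := qproj_onto (h y t : R).
  rewrite -[h y t]xE; apply: pq_radE => p; rewrite ltnS leqn0 size_eq0 => /eqP p0.
  have -> : p = ptriv (psrc p) by exact: qpathP.
  have [_ [q [qv qm]]] : (m.-1 < m)%N /\ exists q, psrc q = psrc p /\ plen q = m.-1.
    by apply/(lt_plength k m0); rewrite full.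
  rewrite -(@cf_comp _ _ _ q q); last by rewrite pcomp_trivr qv eqxx.
  have : rp (pb q) *: y = 0.
    by apply/z/pq_jpow_in/Fl_base; rewrite qm.
  move/(congr1 h); rewrite linear0 linearZ => /(congr1 (fun f : F => f t)).
  rewrite -[LHS]/(rp (pb q) * h y t) -xE -rmorphM => /rp0; apply.
  by rewrite qm.
case: x00; have [c cz] := jpow_nil B P; apply: cz.
apply: (@jpow_nakayama _ _ _ B) => y; exists 0; first exact: rpred0.
rewrite subr0 -[y]/(idfun y) -hE mklinE; apply: rpred_sum => t _.
exact: rad_scale.
Qed.

Lemma lideal_fingen (e : R) : fingen (lideal e).
Proof.
exists 1%N, (fun=> lid e 1) => y; have [a ->] := lid_gen y.
by exists (fun=> a); rewrite big_ord_recl big_ord0 addr0.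
Qed.

Lemma projective_plength v :
  (forall P : lmodType R, fingen P -> indecomposable P -> projective P ->
     loewy_length P = m) -> plength v = m.
Proof.
apply; first exact: lideal_fingen.
  exact: (local_indec (lideal_gen B v)).
by apply: lideal_projective; exact: (bid_idem B v).
Qed.

(** The value m at every vertex means that a path of length m - 1 starts there. Without sinks paths
    prolong indefinitely; for m = 1 the trivial paths suffice. *)
Lemma plength_full :
  (forall v, plength v = m) <-> (forall v : vert Q, exists a : arr Q, tl a = v) \/ m = 1%N.
Proof.
split=> [full|nosink v].
  have [m1|m1] := leqP m 1; first by right; apply/eqP; rewrite eqn_leq m1.
  left=> v; have /(lt_plength k m0)[_ [p [pv]]] : (1 < plength v)%N by rewrite full.
  case pE : (pword p) => [//|a w] _; exists a; rewrite -pv.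
  by have [q []] := path_cons pE.
apply/eqP; rewrite eqn_leq plength_le //= leqNgt; apply/negP => lt.
have : exists p : qpath Q, psrc p = v /\ plen p = plength v.
  case: nosink => [nosink|m1].
    elim: (plength v) => [|n [p [pv pn]]]; first by exists (ptriv v).
    have [a ap] := nosink (ptgt p); have [r rE] : exists r, pcomp (parr a) p = Some r.
      exact: pcomp_ex.
    have [_ rs _ rw] := pcomp_tgtE rE; exists r; rewrite rs; split=> //.
    by rewrite rw size_cat pn addn1.
  by move: (plength_gt0 k m0 v); rewrite lt0n; move: lt; rewrite {2}m1 ltnS leqn0 => ->.
by move=> ex; have := ltnn (plength v); rewrite (proj2 (lt_plength k m0 _ _)).
Qed.

End Truncated.

(** * Normal forms in the nilpotent quiver algebra *)

(** The algebra as a k-module through [kscal], so that [lext] can take values in it. *)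
Definition kmod (k : fieldType) (A : kalg k) : Type := A.

Section KMod.
Variables (k : fieldType) (A : kalg k).
HB.instance Definition _ := GRing.Zmodule.on (kmod A).
Definition kmod_scale (c : k) (x : kmod A) : kmod A := kscal A c * (x : A).
Lemma kmod_scaleA a b x : kmod_scale a (kmod_scale b x) = kmod_scale (a * b) x.
Proof. by rewrite /kmod_scale rmorphM mulrA. Qed.
Lemma kmod_scale1 : left_id 1 kmod_scale.
Proof. by move=> x; rewrite /kmod_scale rmorph1 mul1r. Qed.
Lemma kmod_scaleDr : right_distributive kmod_scale +%R.
Proof. by move=> a x y; exact: mulrDr. Qed.
Lemma kmod_scaleDl x : {morph kmod_scale^~ x : a b / a + b}.
Proof. by move=> a b; rewrite /kmod_scale rmorphD mulrDl. Qed.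
HB.instance Definition _ := GRing.Zmodule_isLmodule.Build k (kmod A)
  kmod_scaleA kmod_scale1 kmod_scaleDr kmod_scaleDl.
End KMod.

(** * Universal properties of path algebras and quotient rings *)

Section Universal.
Variables (k : fieldType) (Q : quiver) (A : kalg k).
Variables (eps : vert Q -> A) (alp : arr Q -> A).
Hypothesis eps_orth : forall v w, eps v * eps w = if v == w then eps v else 0.
Hypothesis eps_sum : \sum_v eps v = 1.
Hypothesis alp_hd : forall a, eps (hd a) * alp a = alp a.
Hypothesis alp_tl : forall a, alp a * eps (tl a) = alp a.
Local Notation KQ := (path_alg k Q).
Local Notation pb := (@pbase k Q).

Definition path_word (w : seq (arr Q)) (x : A) : A := foldl (fun y a => alp a * y) x w.
Definition path_val (p : qpath Q) : kmod A := path_word (pword p) (eps (psrc p)).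

Let word_mul w x : path_word w x = path_word w 1 * x.
Proof.
elim: w x => [|a w IH] x /=; first by rewrite mul1r.
by rewrite IH [in RHS]IH mulr1 mulrA.
Qed.

Let word_tgt v w : is_walk v w ->
  eps (last v [seq hd a | a <- w]) * path_word w (eps v) = path_word w (eps v).
Proof.
elim/last_ind: w => [|w a IH]; first by rewrite /= eps_orth eqxx.
rewrite -cats1 map_cat last_cat /= is_walk_cat => /andP[_ _].
by rewrite /path_word foldl_cat /= mulrA alp_hd.
Qed.

Let val_src p : (path_val p : A) * eps (psrc p) = path_val p.
Proof. by rewrite /path_val word_mul -mulrA eps_orth eqxx. Qed.

Let valM p q : (path_val p : A) * path_val q =
  if pcomp p q is Some r then path_val r else 0.
Proof.
have tq : eps (ptgt q) * path_val q = path_val q by apply: word_tgt; exact: (valP q).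
case pq : (pcomp p q) => [r|]; last first.
  by rewrite -val_src -mulrA -tq (mulrA (eps _)) eps_orth;
     move/eqP: pq; rewrite pcomp_none => /negPf->; rewrite mul0r mulr0.
have [src_p src_r _ rE] := pcomp_tgtE pq.
rewrite {3}/path_val src_r rE /path_word foldl_cat -/(path_word _ _) -/(path_word (pword q) _).
by rewrite word_mul {1}/path_val word_mul -mulrA src_p tq.
Qed.

Let Psi : palg k Q -> A := lext (V := kmod A) path_val.

Let Psi_base p : Psi (pb p) = path_val p.
Proof. exact: (@lext_base k Q (kmod A) path_val p). Qed.

Let PsiD x y : Psi (x + y) = Psi x + Psi y.
Proof. exact: (linearD (lext (V := kmod A) path_val)). Qed.

Let PsiZ c x : Psi (c *: x) = kscal A c * Psi x.
Proof. exact: (linearZ_LR (lext (V := kmod A) path_val)). Qed.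

Let Psi0 : Psi 0 = 0.
Proof. exact: (linear0 (lext (V := kmod A) path_val)). Qed.

Let PsiM (x y : KQ) : Psi (x * y) = Psi x * Psi y.
Proof.
move: x; have mulP (z : A) : linear (fun x : palg k Q => Psi x * z : kmod A).
  by move=> c x x'; rewrite PsiD PsiZ mulrDl -mulrA.
have Pmul (p : qpath Q) : linear (fun x : palg k Q => path_val p * Psi x : kmod A).
  move=> c x x'; rewrite PsiD PsiZ mulrDr mulrA -kscalC -mulrA.
  by [].
apply: (palg_ind (F := lext (V := kmod A) path_val \o pmulr y) (G := Hom (mulP (Psi y)))) => p.
rewrite -[LHS]/(Psi ((pb p : KQ) * y)) -[RHS]/(Psi (pb p) * Psi y) Psi_base; move: y.
apply: (palg_ind (F := lext (V := kmod A) path_val \o pmul (pb p)) (G := Hom (Pmul p))) => q.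
rewrite -[LHS]/(Psi ((pb p : KQ) * pb q)) -[RHS]/(path_val p * Psi (pb q)).
rewrite pbM Psi_base valM; case: (pcomp p q) => [r|]; [exact: Psi_base|exact: Psi0].
Qed.

Let Psi1 : Psi (1 : KQ) = 1.
Proof.
rewrite -eps_sum -[LHS]/(Psi (\sum_v pb (ptriv v))) (big_morph Psi PsiD Psi0).
by apply: eq_bigr => v _; exact: Psi_base.
Qed.

Lemma path_alg_universal : exists f : {rmorphism KQ -> A},
  [/\ forall c, f (kscal KQ c) = kscal A c, forall v, f (pb (ptriv v)) = eps v &
      forall a, f (pb (parr a)) = alp a].
Proof.
have fB : zmod_morphism (Psi : KQ -> A) by exact: (linearB (lext (V := kmod A) path_val)).
have fM : monoid_morphism (Psi : KQ -> A) by split; [exact: Psi1|exact: PsiM].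
pose f : {rmorphism KQ -> A} := HB.pack (Psi : KQ -> A)
  (GRing.isZmodMorphism.Build KQ A Psi fB) (GRing.isMonoidMorphism.Build KQ A Psi fM).
exists f; split=> [c|v|a].
- by rewrite -[LHS]/(Psi (c *: (1 : KQ))) PsiZ Psi1 mulr1.
- exact: Psi_base.
by rewrite -[LHS]/(Psi _) Psi_base /path_val /path_word /= alp_tl.
Qed.

End Universal.

Lemma quot_universal (A B : pzRingType) (I : ideal A) (f : {rmorphism A -> B}) :
  (forall x, x \in I -> f x = 0) ->
  exists h : {rmorphism qring I -> B}, forall x, h (qproj I x) = f x.
Proof.
move=> fI; pose h (y : qring I) : B := f (repr y).
have hE x : h (qproj I x) = f x.
  apply/eqP; rewrite -subr_eq0 -rmorphB; apply/eqP/fI/qproj0.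
  by rewrite rmorphB /= /qproj reprK subrr.
have hB : zmod_morphism h.
  move=> x y; have [x' <-] := qproj_onto x; have [y' <-] := qproj_onto y.
  by rewrite -rmorphB !hE rmorphB.
have hM : monoid_morphism h.
  split=> [|x y]; first by rewrite -(rmorph1 (qproj I)) hE rmorph1.
  have [x' <-] := qproj_onto x; have [y' <-] := qproj_onto y.
  by rewrite -rmorphM !hE rmorphM.
pose hr : {rmorphism qring I -> B} := HB.pack h
  (GRing.isZmodMorphism.Build (qring I) B h hB)
  (GRing.isMonoidMorphism.Build (qring I) B h hM).
by exists hr.
Qed.

Lemma mul_push (A : pzRingType) (b x x' b' y y' : A) :
  b * x = x' * b' -> b' * y = y' -> b * (x * y) = x' * y'.
Proof. by move=> bx <-; rewrite mulrA bx mulrA. Qed.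

Section NormalForms.
Variables (k : fieldType) (Q : quiver) (m : nat).
Local Notation SQ := (staircase Q m).
Local Notation KS := (path_alg k SQ).
Local Notation Nm := (nilp_alg k Q m).
Local Notation np := (qproj (idealgen (@nilp_rel k Q m))).
Local Notation pb := (@pbase k SQ).
Local Notation plen p := (size (pword p)).

(** Levels are natural numbers and the value out of range is 0, which keeps ordinals out of the
    arithmetic of levels. *)
Definition lev_e (v : vert Q) (l : nat) : Nm :=
  if insub l is Some i then np (pb (@ptriv SQ (v, i))) else 0.
Definition lev_b (v : vert Q) (l : nat) : Nm :=
  if insub l is Some i then np (@arr_b k Q m v i) else 0.
Definition lev_a (a : arr Q) (l : nat) : Nm :=
  if insub l is Some i then np (@arr_a k Q m a i) else 0.

Lemma lev_eE v (i : 'I_m) : lev_e v i = np (pb (@ptriv SQ (v, i))).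
Proof. by rewrite /lev_e valK. Qed.
Lemma lev_bE v (i : 'I_m.-1) : lev_b v i = np (@arr_b k Q m v i).
Proof. by rewrite /lev_b valK. Qed.
Lemma lev_aE a (i : 'I_m.-1) : lev_a a i = np (@arr_a k Q m a i).
Proof. by rewrite /lev_a valK. Qed.

Lemma lev_ba a l : (l.+2 < m)%N ->
  lev_b (tl a) l.+1 * lev_a a l.+1 = lev_a a l * lev_b (hd a) l.
Proof.
move=> lm; have l1 : (l.+1 < m.-1)%N by lia.
have l0 : (l < m.-1)%N by lia.
rewrite -[l.+1]/(val (Ordinal l1)) -[l]/(val (Ordinal l0)) !lev_aE !lev_bE -!rmorphM.
apply/eqP; rewrite -subr_eq0 -rmorphB; apply/eqP/qproj0/idealgen_in.
by left; exists a, (Ordinal l0), (Ordinal l1).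
Qed.

Lemma lev_ba0 a : lev_b (tl a) 0 * lev_a a 0 = 0.
Proof.
have [l0|l0] := ltnP 0 m.-1; last by rewrite /lev_a insubF ?mulr0 // ltnNge l0.
rewrite -[0%N]/(val (Ordinal l0)) lev_aE lev_bE -rmorphM.
by apply/qproj0/idealgen_in; right; exists a, (Ordinal l0).
Qed.

Lemma arr_b_triv v (i : 'I_m.-1) :
  (pb (@parr SQ (inl (v, i))) : KS) * pb (@ptriv SQ (v, ord_hi i)) =
  (pb (@ptriv SQ (v, ord_lo i)) : KS) * pb (@parr SQ (inl (v, i))).
Proof.
exact: etrans (@pb_triv_r k SQ (parr _)) (esym (@pb_triv_l k SQ (parr _))).
Qed.

Lemma lev_be v l : (l.+1 < m)%N -> lev_b v l * lev_e v l.+1 = lev_e v l * lev_b v l.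
Proof.
move=> lm; have l1 : (l < m.-1)%N by lia.
pose i := Ordinal l1.
have bE : lev_b v l = np (pb (@parr SQ (inl (v, i)))) by exact: (lev_bE v i).
have e1E : lev_e v l.+1 = np (pb (@ptriv SQ (v, ord_hi i))) by exact: (lev_eE v (ord_hi i)).
have e0E : lev_e v l = np (pb (@ptriv SQ (v, ord_lo i))) by exact: (lev_eE v (ord_lo i)).
rewrite bE e1E e0E -(rmorphM np (pb _) (pb _)) -(rmorphM np (pb (ptriv _)) (pb _)).
exact: (congr1 np (arr_b_triv v i)).
Qed.

(** From the end of w at level t to its start at level t + |w|: the arrows a_l run against those of
    Q, so the last arrow of w acts first. The empty climb is 1 since [descend] already carries the
    idempotent. *)
Fixpoint climb (w : seq (arr Q)) (t : nat) : Nm :=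
  if w is a :: w' then lev_a a (t + size w') * climb w' t else 1.
Fixpoint descend (v : vert Q) (t c : nat) : Nm :=
  if c is c'.+1 then descend v t c' * lev_b v (t + c') else lev_e v t.

Lemma b_climb v w t : is_walk v w -> (t + (size w).+1 < m)%N ->
  lev_b v (t + size w) * climb w t.+1 =
  climb w t * lev_b (last v [seq hd a | a <- w]) t.
Proof.
elim: w v => [|a w IH] v /=; first by rewrite addn0 mulr1 mul1r.
case/andP => /eqP <- walk lm.
rewrite addnS mulrA addSn lev_ba; last lia.
by rewrite -[LHS]mulrA IH ?mulrA //; lia.
Qed.

(** Pushed down through the climb, b meets the lowest a, and there the product is 0. *)
Lemma b_climb0 v a w : is_walk v (a :: w) -> ((size w).+1 < m)%N ->
  lev_b v (size w) * climb (a :: w) 0 = 0.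
Proof.
elim: w v a => [|a' w IH] v a /= /andP[/eqP <- walk] lm.
  by rewrite mulr1; exact: lev_ba0.
by rewrite mulrA !add0n lev_ba // -[LHS]mulrA (IH _ a') ?mulr0 //; lia.
Qed.

Lemma b_descend v t c : (t.+1 < m)%N ->
  lev_b v t * descend v t.+1 c = descend v t c.+1.
Proof.
move=> tm; elim: c => [|c IH].
  rewrite -[RHS]/(lev_e v t * lev_b v (t + 0)) addn0.
  exact: lev_be.
rewrite -[descend v t.+1 c.+1]/(descend v t.+1 c * lev_b v (t.+1 + c)).
rewrite mulrA.
rewrite IH.
rewrite -[RHS]/(descend v t c.+1 * lev_b v (t + c.+1)).
rewrite (addSnnS t c).
reflexivity.
Qed.

(* [p] runs from [v] to [u] in [Q]; its normal form runs from [u_l] to [v_l'] in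
   the staircase: first descend to the level [l' - |p|], then climb along [p]
   backwards. *)
Definition nform (l l' : nat) (p : qpath Q) : Nm :=
  if (plen p <= l' <= l + plen p)%N
  then climb (pword p) (l' - plen p) * descend (ptgt p) (l' - plen p) (l + plen p - l')
  else 0.

(** Here |p| counts the arrows a of P and c the arrows b, which gives the equation between levels.
    The induction is on the last arrow of P: an arrow a is put in front of p, an arrow b is pushed
    through the climb. *)
Lemma path_nform (P : qpath SQ) : exists (p : qpath Q) c,
  [/\ psrc p = (ptgt P).1, ptgt p = (psrc P).1,
      ((ptgt P).2 + c = (psrc P).2 + plen p)%N, plen P = (plen p + c)%N &
      np (pb P) = nform (psrc P).2 (ptgt P).2 p].
Proof.
move Ew : (pword P) => w; elim/last_ind: w P Ew => [|w al IH] P PE.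
  have -> : P = ptriv (psrc P) by exact: qpathP.
  move: (psrc P) => [v l]; exists (ptriv v), 0%N; rewrite /psrc /ptgt /=.
  by split=> //; rewrite /nform /= !addn0 leqnn subnn subn0 /= mul1r lev_eE.
have [P' [P's P'w P't Pt comp]] := path_rcons PE.
have [p [c [ps pt levE lenE npE]]] := IH P' P'w.
have pbE : np (pb P) = np (pb (parr al)) * np (pb P').
  by rewrite -rmorphM pbM comp.
rewrite pbE npE size_rcons lenE -P's Pt => {pbE npE lenE PE P'w IH comp}.
move: levE ps; rewrite P't => {P't Pt}.
move: (psrc P') pt => [u l] /= pt {P' P P's}.
case: al => [[v j]|[a j]] /= levE ps.
  exists p, c.+1; split=> //; try lia.
  rewrite -[np _]/(np (@arr_b k Q m v j)) -lev_bE /nform /=.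
  have jm : (j.+1 < m)%N by have := ltn_ord j; lia.
  have walk : is_walk v (pword p) by rewrite -ps; exact: (valP p).
  (* For |p| > j the new normal form is 0. The old one can be nonzero only for |p| = j + 1, and then
     its climb starts at level 0 and is killed by b. *)
  have [pj|pj] : (plen p <= j)%N \/ (j < plen p)%N by lia.
  2: {
    have -> : (plen p <= j <= l + plen p)%N = false by lia.
    case: ifP => [/andP[pj1 _]|_]; last by rewrite mulr0.
    have pj2 : plen p = j.+1 by lia.
    rewrite pj2 subnn; case pE : (pword p) walk => [|a w'] walk; first by rewrite pE in pj2.
    have wj : size w' = j by move: pj2; rewrite pE /= => -[].
    by rewrite mulrA -wj b_climb0 ?mul0r // wj. }
  have -> : (plen p <= j.+1 <= l + plen p)%N by lia.
  have -> : (plen p <= j <= l + plen p)%N by lia.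
  have -> : (j.+1 - plen p = (j - plen p).+1)%N by lia.
  have -> : (l + plen p - j = (l + plen p - j.+1).+1)%N by lia.
  have jE : (j - plen p + plen p = j)%N by lia.
  have tm : ((j - plen p).+1 < m)%N by lia.
  have tgt_p : last v [seq hd a | a <- pword p] = ptgt p by rewrite -ps.
  have E1 : lev_b v j * climb (pword p) (j - plen p).+1 =
            climb (pword p) (j - plen p) * lev_b (ptgt p) (j - plen p).
    by have := b_climb walk (t := j - plen p); rewrite jE tgt_p; apply; lia.
  have E2 := b_descend (ptgt p) (l + plen p - j.+1) tm.
  exact: mul_push E1 E2.
have [q qE] : exists q, pcomp p (parr a) = Some q by apply: pcomp_ex; rewrite ps.
have [_ qs qt qw] := pcomp_tgtE qE.
have {}qw : pword q = a :: pword p by rewrite qw.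
have lenq : plen q = (plen p).+1 by rewrite qw.
exists q, c; rewrite qs qt lenq; split=> //; try lia.
rewrite -[np _]/(np (@arr_a k Q m a j)) -lev_aE; move: (nat_of_ord j) => {levE} {}j.
have cond : (plen q <= j.+1 <= l + plen q)%N = (plen p <= j <= l + plen p)%N by lia.
rewrite /nform cond lenq qt qw.
case: (boolP (plen p <= j <= l + plen p)%N) => [/andP[pj lj]|_]; last exact: mulr0.
have -> : (j.+1 - (plen p).+1 = j - plen p)%N by lia.
have -> : (l + (plen p).+1 - j.+1 = l + plen p - j)%N by lia.
rewrite -[climb (a :: _) _]/(lev_a a (j - plen p + plen p) * climb (pword p) (j - plen p)).
by rewrite (subnK pj) -mulrA.
Qed.

(** In a normal form |p| <= l' < m and c = l + |p| - l' <= l < m, so a path that is nonzero in the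
    quotient has length |p| + c < 2m. *)
Lemma nilp_Fl x : Fl (m + m) x -> x \in idealgen (@nilp_rel k Q m).
Proof.
elim/Fl_ind: x / => [|x y xP yP|c P lP]; first exact: rpred0.
  exact: rpredD.
rewrite -kscalE; apply: (proj1 (ideal_mul _ _)); apply/qproj0.
have [p [c' [_ _ levE lenE ->]]] := path_nform P; rewrite /nform; case: ifP => // /andP[h1 h2].
by have := ltn_ord (psrc P).2; have := ltn_ord (ptgt P).2; lia.
Qed.

Lemma nilp_rel_Fl x : x \in idealgen (@nilp_rel k Q m) -> Fl 1 x.
Proof.
have two y z : Fl 1 ((pb (@parr SQ y) : KS) * pb (@parr SQ z)).
  by apply: FlMr; exact: Fl_base.
move/(@idealgen_sub _ _ (Fl_ideal k SQ 1)) => xP; apply/Fl_idealE/xP => s sP.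
apply/Fl_idealE; case: sP => [[a [l [l' [_ ->]]]]|[a [l [_ ->]]]].
  by apply: FlB; exact: two.
exact: two.
Qed.

Definition nilp_basic : basic Nm (vert SQ) := pq_basic nilp_Fl nilp_rel_Fl.

Definition nlin l l' (x : palg k Q) : Nm := lext (V := kmod Nm) (nform l l') x.
Lemma nlin0 l l' : nlin l l' 0 = 0.
Proof. exact: (linear0 (lext (V := kmod Nm) (nform l l'))). Qed.
Lemma nlinD l l' x y : nlin l l' (x + y) = nlin l l' x + nlin l l' y.
Proof. exact: (linearD (lext (V := kmod Nm) (nform l l'))). Qed.
Lemma nlin_base l l' p : nlin l l' (pbase k p) = nform l l' p.
Proof. exact: (@lext_base k Q (kmod Nm) (nform l l') p). Qed.
Lemma nlinZ l l' c p : nlin l l' (c *: pbase k p) = kscal Nm c * nform l l' p.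
Proof.
rewrite -nlin_base.
exact: (linearZ_LR (lext (V := kmod Nm) (nform l l'))).
Qed.
Lemma nlinE l l' x : nlin l l' x = \sum_(p <- msupp x) kscal Nm x@_p * nform l l' p.
Proof. by []. Qed.

Lemma nilp_span (z : Nm) : exists x : 'I_m -> 'I_m -> palg k Q,
  z = \sum_(l < m) \sum_(l' < m) nlin l l' (x l l').
Proof.
pose spanned (z : Nm) := exists x : 'I_m -> 'I_m -> palg k Q,
  z = \sum_(l < m) \sum_(l' < m) nlin l l' (x l l').
have spannedD y t : spanned y -> spanned t -> spanned (y + t).
  move=> [f ->] [g ->]; exists (fun l l' => f l l' + g l l'); rewrite -big_split.
  apply: eq_bigr => l _; rewrite -big_split; apply: eq_bigr => l' _.
  exact/esym/nlinD.
rewrite -/(spanned z).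
have [x <-] := qproj_onto z; elim/palg_span: x => [|x y xP yP|c P].
- exists (fun _ _ => 0); rewrite rmorph0 big1 // => l _; rewrite big1 // => l' _.
  exact: nlin0.
- by rewrite rmorphD; exact: spannedD.
have [p [_ [_ _ _ _ npE]]] := path_nform P.
pose f (l l' : 'I_m) : palg k Q :=
  if (l == (psrc P).2) && (l' == (ptgt P).2) then c *: pbase k p else 0.
have fE : f (psrc P).2 (ptgt P).2 = c *: pbase k p by rewrite /f !eqxx.
have f0 l l' : l != (psrc P).2 -> f l l' = 0 by rewrite /f => /negPf->.
have f0' l l' : l' != (ptgt P).2 -> f l l' = 0 by rewrite /f andbC => /negPf->.
pose F (l : 'I_m) := \sum_(l' < m) nlin l l' (f l l').
have F1 : F (psrc P).2 = np (c *: pb P).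
  rewrite /F (bigD1 (ptgt P).2) // fE nlinZ -npE -rpZ big1 ?Monoid.mulm1 // => l' l'P.
  by rewrite f0' //; exact: nlin0.
have F0 l : l != (psrc P).2 -> F l = 0.
  by move=> lP; apply: big1 => l' _; rewrite f0 //; exact: nlin0.
have FE : \sum_l F l = F (psrc P).2.
  by rewrite (bigD1 (psrc P).2) //; rewrite big1 ?Monoid.mulm1.
exists f; exact: etrans (esym F1) (esym FE).
Qed.

End NormalForms.

(** * The endomorphism algebra of the layers *)

Lemma rmorph_idealgen (A B : pzRingType) (S : A -> Prop) (f : {rmorphism A -> B}) :
  (forall s, S s -> f s = 0) -> forall x, x \in idealgen S -> f x = 0.
Proof.
move=> fS x.
have K0 : f 0 = 0 by exact: rmorph0.
have KB y z : f y = 0 -> f z = 0 -> f (y - z) = 0.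
  by move=> yK zK; rewrite rmorphB yK zK subrr.
have KM a y : f y = 0 -> f (a * y) = 0 /\ f (y * a) = 0.
  by move=> yK; rewrite !rmorphM yK mulr0 mul0r.
move/(@idealgen_sub _ _ (mkideal K0 KB KM)) => xP; apply/(mkidealE K0 KB KM)/xP => s sS.
by apply/mkidealE; exact: fS.
Qed.

Section EndoIso.
Variables (k : fieldType) (Q : quiver) (m : nat).
Hypothesis m0 : (0 < m)%N.
Local Notation KQ := (path_alg k Q).
Local Notation R := (trunc_alg k Q m).
Local Notation SQ := (staircase Q m).
Local Notation KS := (path_alg k SQ).
Local Notation Nm := (nilp_alg k Q m).
Local Notation rp := (qproj (ideal_exp (arrow_ideal k Q) m)).
Local Notation np := (qproj (idealgen (@nilp_rel k Q m))).
Local Notation pb := (@pbase k Q).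
Local Notation plen p := (size (pword p)).
Local Notation ev v := (pb (ptriv v) : KQ).
Hypothesis full : forall v : vert Q, plength k m v = m.
Variables (idx : finType) (N : idx -> lmodType R) (tau : idx -> vert SQ).
Hypothesis tau_bij : bijective tau.
Variable g : forall j, N j.
Hypothesis gL : forall j, layer (tau j).1 (tau j).2.+1 (g j).
Local Notation E := (endalg (dsum N : lmodType R)).

Definition key i : vert Q * nat := ((tau i).1, nat_of_ord (tau i).2).

Lemma key_inj i j : key i = key j -> i = j.
Proof.
rewrite /key => -[h1 h2]; apply: (bij_inj tau_bij).
by move: h1 h2; case: (tau i) (tau j) => [v l] [v' l'] /= -> /val_inj->.
Qed.

Lemma key_onto v l : (l < m)%N -> exists i, key i = (v, l).
Proof.
move=> lm; have [i iE] := bij_onto tau_bij ((v, Ordinal lm) : vert SQ).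
by exists i; rewrite /key iE.
Qed.

Lemma key_lt i : ((key i).2 < m)%N.
Proof. exact: ltn_ord. Qed.

Lemma keyL i x : rp x *: g i = 0 <-> Fl (key i).2.+1 ((x : KQ) * ev (key i).1).
Proof. by have [_ h] := gL i; exact: h. Qed.

Lemma key_gen i (y : N i) : exists x, y = rp x *: g i.
Proof. by have [h _] := gL i; exact: h. Qed.

Lemma key_bid i : rp (ev (key i).1) *: g i = g i.
Proof. exact: (layer_bid (gL i)). Qed.

Definition app (phi : E) : {linear (dsum N : lmodType R) -> (dsum N : lmodType R)} :=
  hom_fun (phi : endo (dsum N : lmodType R)).

(* the entry of [phi] from the [i]-th to the [j]-th summand, seen as the image
   of the generator *)
Definition entry (phi : E) i j : N j := app phi (dinj (g i)) j.

Lemma entry0 i j : entry 0 i j = 0. Proof. by []. Qed.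
Lemma entryD phi psi i j : entry (phi + psi) i j = entry phi i j + entry psi i j.
Proof. by []. Qed.
Lemma entryB phi psi i j : entry (phi - psi) i j = entry phi i j - entry psi i j.
Proof. by []. Qed.
Lemma entryZ c phi i j : entry (kscal E c * phi) i j = kscal R c *: entry phi i j.
Proof. by []. Qed.
Lemma entry_sum (T : Type) (s : seq T) (P : pred T) (F : T -> E) i j :
  entry (\sum_(t <- s | P t) F t) i j = \sum_(t <- s | P t) entry (F t) i j.
Proof. exact: (big_morph (fun phi => entry phi i j) (fun x y => entryD x y i j) (entry0 i j)). Qed.

Lemma entry1 i j : entry 1 i j = if key i == key j then g j else 0.
Proof.
rewrite -[LHS]/(dinj (g i) j); case: eqP => [/key_inj->|ij]; first exact: dinjE.
by apply: dinjN; apply/eqP => ji; apply: ij; rewrite ji.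
Qed.

Lemma entry_inj phi : (forall i j, entry phi i j = 0) -> phi = 0.
Proof.
move=> phi0; apply: homP => x; rewrite -[LHS]/(app phi x) -[RHS]/(0 : dsum N).
rewrite (dsum_decomp x) linear_sum big1 // => i _.
have [a ->] := key_gen (x i); rewrite (linearZ_LR (@dinj _ _ _ i)) (linearZ_LR (app phi)).
have -> : app phi (dinj (g i)) = 0 by apply: dsumP => j; exact: phi0.
exact: scaler0.
Qed.

Lemma entry_ext phi psi : (forall i j, entry phi i j = entry psi i j) -> phi = psi.
Proof.
move=> h; apply/eqP; rewrite -subr_eq0; apply/eqP/entry_inj => i j.
by rewrite entryB h subrr.
Qed.

Lemma entry_mul (psi phi : E) i j (c : R) s : (forall t, entry phi i t = if t == s then c *: g t else 0) ->
  entry (psi * phi) i j = c *: entry psi s j.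
Proof.
move=> phiE; rewrite -[LHS]/(dproj j (app psi (app phi (dinj (g i))))).
have -> : app phi (dinj (g i)) = c *: dinj (g s).
  have aE t : app phi (dinj (g i)) t = if t == s then c *: g t else 0 by exact: phiE.
  rewrite (dsum_decomp (app phi _)) (bigD1 s) // big1 => [|t ts].
    by rewrite Monoid.mulm1 aE eqxx linearZ_LR.
  by rewrite aE (negPf ts) linear0.
by rewrite (linearZ_LR (app psi)).
Qed.

(** phi is right multiplication by x from the layer u to the layer u' and has no other entries. It
    is a relation because such a phi exists only if x respects annihilators, which is the condition
    in [spec_ex]. *)
Definition spec (u u' : vert Q * nat) (x : palg k Q) (phi : E) := forall i j,
  entry phi i j = if (key i == u) && (key j == u') then rp x *: g j else 0.

Lemma spec_uniq u u' x phi psi : spec u u' x phi -> spec u u' x psi -> phi = psi.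
Proof. by move=> h1 h2; apply: entry_ext => i j; rewrite h1 h2. Qed.

(** Right multiplications compose in reverse: psi after phi sends the generator of u to x times y.
    This matches the reversed arrows of the staircase. *)
Lemma spec_mul u u1 u2 x y phi psi : (u1.2 < m)%N ->
  spec u u1 x phi -> spec u1 u2 y psi -> spec u u2 ((x : KQ) * y) (psi * phi).
Proof.
move=> lm h1 h2 i j; have [s sE] := key_onto u1.1 lm.
have {}sE : key s = u1 by rewrite sE; case: (u1).
rewrite (@entry_mul psi phi i j (if key i == u then rp x else 0) s).
  rewrite h2 sE eqxx /= rmorphM; case: (key i == u) => /=; last by rewrite scale0r.
  by case: (key j == u2); rewrite ?scalerA ?scaler0.
move=> t; rewrite h1; have [->|ts] := eqVneq t s.
  by rewrite sE eqxx andbT; case: ifP => // _; rewrite scale0r.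
case: eqP => //= _; case: eqP => // tu; case/eqP: ts; apply: key_inj.
by rewrite sE.
Qed.

Lemma spec_mul0 u u1 u1' u2 x y phi psi : (u1.2 < m)%N -> u1 != u1' ->
  spec u u1 x phi -> spec u1' u2 y psi -> psi * phi = 0.
Proof.
move=> lm uu h1 h2; apply: entry_inj => i j; have [s sE] := key_onto u1.1 lm.
have {}sE : key s = u1 by rewrite sE; case: (u1).
rewrite (@entry_mul psi phi i j (if key i == u then rp x else 0) s).
  by rewrite h2 sE (negPf uu) scaler0.
move=> t; rewrite h1; have [->|ts] := eqVneq t s.
  by rewrite sE eqxx andbT; case: ifP => // _; rewrite scale0r.
case: eqP => //= _; case: eqP => // tu; case/eqP: ts; apply: key_inj.
by rewrite sE.
Qed.

Lemma spec_zero u u' x phi : Fl u'.2.+1 ((x : KQ) * ev u'.1) -> spec u u' x phi -> phi = 0.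
Proof.
move=> xl h; apply: entry_inj => i j; rewrite h; case: ifP => // /andP[_ /eqP ju].
by apply/keyL; rewrite ju.
Qed.

Lemma spec_ex u u' x : (u.2 < m)%N -> (u'.2 < m)%N ->
  (forall y, Fl u.2.+1 ((y : KQ) * ev u.1) -> Fl u'.2.+1 ((y : KQ) * x * ev u'.1)) ->
  exists phi, spec u u' x phi.
Proof.
move: u u' => [v l] [v' l'] /= lm l'm valid.
have [i0 iE] := key_onto v lm; have [j0 jE] := key_onto v' l'm.
have ann a : a *: g i0 = 0 -> a *: (rp x *: g j0) = 0.
  have [y <-] := qproj_onto a => /keyL; rewrite iE scalerA => yl.
  by rewrite -rmorphM; apply/keyL; rewrite jE; exact: valid.
have gen (y : N i0) : exists a, y = a *: g i0.
  by have [z ->] := key_gen y; exists (rp z).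
have [h hE] := cyclic_hom gen ann.
pose phi : {linear (dsum N : lmodType R) -> (dsum N : lmodType R)} :=
  @dinj R idx N j0 \o (h \o @dproj R idx N i0).
exists (mkhom phi) => i j.
rewrite -[LHS]/(dinj (h (dinj (g i) i0)) j).
have [ii|ii] := eqVneq i i0; last first.
  have di0 : dinj (g i) i0 = 0 by exact: dinjN.
  rewrite di0 (linear0 h) (linear0 (@dinj R idx N j0)).
  case: eqP => // ki; case/eqP: ii.
  by apply: key_inj; rewrite iE.
rewrite ii dinjE iE eqxx -[g i0]scale1r hE scale1r.
have [jj|jj] := eqVneq j0 j; last first.
  rewrite dinjN //; case: eqP => // kj; case/eqP: jj.
  by apply: key_inj; rewrite jE.
by rewrite -jj dinjE jE eqxx.
Qed.

Definition arr_coef (al : arr SQ) : palg k Q :=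
  match al with inl _ => (1 : KQ) | inr (a, _) => pb (parr a) end.

Definition skey (u : vert SQ) : vert Q * nat := (u.1, nat_of_ord u.2).

Lemma skey_lt u : ((skey u).2 < m)%N.
Proof. exact: ltn_ord. Qed.

Lemma skey_inj u u' : skey u = skey u' -> u = u'.
Proof.
by case: u u' => [v l] [v' l']; rewrite /skey /= => -[-> /val_inj->].
Qed.

(** Right multiplication by an arrow raises the filtration by one, which pays for the step from
    level l to l + 1; a projection needs no gain. *)
Lemma arr_spec_ex al : exists phi, spec (skey (tl al)) (skey (hd al)) (arr_coef al) phi.
Proof.
apply: spec_ex; [exact: skey_lt|exact: skey_lt|move=> y].
case: al => [[v j]|[a j]] /=; first by rewrite mulr1; exact: Fl_le.
rewrite -mulrA (pb_triv_r k (parr a)) -(pb_triv_l k (parr a)) mulrA => yl.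
by rewrite -addn1; apply: FlM => //; exact: Fl_base.
Qed.

Lemma vert_spec_ex u : exists phi, spec (skey u) (skey u) (1 : KQ) phi.
Proof.
by apply: spec_ex; [exact: skey_lt|exact: skey_lt|move=> y; rewrite mulr1].
Qed.

Lemma nilp_to_endo : exists f : {rmorphism Nm -> E},
  [/\ forall c, f (kscal Nm c) = kscal E c,
      forall u, spec (skey u) (skey u) (1 : KQ) (f (np (pbase k (ptriv u)))) &
      forall al, spec (skey (tl al)) (skey (hd al)) (arr_coef al) (f (np (pbase k (parr al))))].
Proof.
have [eps epsS] := choice vert_spec_ex; have [alp alpS] := choice arr_spec_ex.
have orth u u' : eps u * eps u' = if u == u' then eps u else 0.
  case: eqP => [<-|uu].
    apply: (spec_uniq _ (epsS u)); rewrite -[1 : KQ]mulr1.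
    exact: (spec_mul (skey_lt u) (epsS u) (epsS u)).
  apply: (spec_mul0 (skey_lt u') _ (epsS u') (epsS u)).
  by apply/eqP => /skey_inj/esym.
have sum1 : \sum_u eps u = 1.
  apply: entry_ext => i j; rewrite entry1 entry_sum (bigD1 (tau i)) // big1 => [|u ui].
    rewrite Monoid.mulm1 epsS eqxx andTb eq_sym; case: ifP => // _.
    by rewrite rmorph1 scale1r.
  rewrite epsS; case: eqP => // /skey_inj iu.
  by rewrite iu eqxx in ui.
have ahd al : eps (hd al) * alp al = alp al.
  apply: (spec_uniq _ (alpS al)); rewrite -[arr_coef al](mulr1 (arr_coef al : KQ)).
  exact: (spec_mul (skey_lt _) (alpS al) (epsS _)).
have atl al : alp al * eps (tl al) = alp al.
  apply: (spec_uniq _ (alpS al)); rewrite -[arr_coef al](mul1r (arr_coef al : KQ)).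
  exact: (spec_mul (skey_lt _) (epsS _) (alpS al)).
have [F [Fk Fv Fa]] := path_alg_universal orth sum1 ahd atl.
have [|f fE] := @quot_universal _ _ (idealgen (@nilp_rel k Q m)) F.
  apply: rmorph_idealgen => r rR.
  have FM y z : F (y * z) = F y * F z by exact: rmorphM.
  have FB y z : F (y - z) = F y - F z by exact: rmorphB.
  case: rR => [[a [l [l' [ll' ->]]]]|[a [l [l0 ->]]]].
    have hl : ord_lo l' = ord_hi l by apply: val_inj.
    have FbE i j : F (arr_b k i j) = alp (inl (i, j)) by exact: Fa.
    have FaE i j : F (arr_a k i j) = alp (inr (i, j)) by exact: Fa.
    have h1 : F (arr_b k (tl a) l' * arr_a k a l') = alp (inl (tl a, l')) * alp (inr (a, l')).
      exact: etrans (FM _ _) (congr2 _ (FbE _ _) (FaE _ _)).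
    have h2 : F (arr_a k a l * arr_b k (hd a) l) = alp (inr (a, l)) * alp (inl (hd a, l)).
      exact: etrans (FM _ _) (congr2 _ (FaE _ _) (FbE _ _)).
    apply: etrans (FB _ _) (etrans (congr2 (fun x y : E => x - y) h1 h2) _).
    (* Both sides of the commutation relation are right multiplication by a between the same two
       layers. *)
    have S1 := spec_mul (skey_lt _) (alpS (inr (a, l'))) (alpS (inl (tl a, l'))).
    have S2 := spec_mul (skey_lt _) (alpS (inl (hd a, l))) (alpS (inr (a, l))).
    have h3 : alp (inl (tl a, l')) * alp (inr (a, l')) = alp (inr (a, l)) * alp (inl (hd a, l)).
      apply: (spec_uniq _ S2); move: S1.
      by rewrite /= hl mulr1 mul1r.
    by rewrite h3 subrr.
  apply: etrans (FM _ _) _; rewrite (Fa (inl (tl a, l))) (Fa (inr (a, l))).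
  (* At the bottom the target is R e_t(a) modulo its radical, where the arrow a vanishes. *)
  apply: (spec_zero _ (spec_mul (skey_lt _) (alpS (inr (a, l))) (alpS (inl (tl a, l))))).
  rewrite /= l0; apply: FlMr; apply: FlMr; exact: Fl_base.
exists f; split=> [c|u|al].
- by rewrite -[kscal Nm c]/(np (kscal KS c)) fE Fk.
- by rewrite fE Fv; exact: epsS.
by rewrite fE Fa; exact: alpS.
Qed.

(** * Bijectivity of the map to the endomorphism algebra *)

Section Iso.
Variable f : {rmorphism Nm -> E}.
Hypothesis fk : forall c, f (kscal Nm c) = kscal E c.
Hypothesis fv : forall u, spec (skey u) (skey u) (1 : KQ) (f (np (pbase k (ptriv u)))).
Hypothesis fa : forall al,
  spec (skey (tl al)) (skey (hd al)) (arr_coef al) (f (np (pbase k (parr al)))).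

Lemma f_lev_e v l : (l < m)%N -> spec (v, l) (v, l) (1 : KQ) (f (lev_e k m v l)).
Proof.
by move=> lm; rewrite -[l]/(val (Ordinal lm)) lev_eE; exact: (fv (v, Ordinal lm)).
Qed.

Lemma f_lev_b v l : (l.+1 < m)%N -> spec (v, l.+1) (v, l) (1 : KQ) (f (lev_b k m v l)).
Proof.
move=> lm; have l1 : (l < m.-1)%N by lia.
by rewrite -[l]/(val (Ordinal l1)) lev_bE; exact: (fa (inl (v, Ordinal l1))).
Qed.

Lemma f_lev_a a l : (l.+1 < m)%N ->
  spec (hd a, l) (tl a, l.+1) (pb (parr a)) (f (lev_a k m a l)).
Proof.
move=> lm; have l1 : (l < m.-1)%N by lia.
by rewrite -[l]/(val (Ordinal l1)) lev_aE; exact: (fa (inr (a, Ordinal l1))).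
Qed.

Lemma f_descend v t c : (t + c < m)%N ->
  spec (v, t + c)%N (v, t) (1 : KQ) (f (descend k m v t c)).
Proof.
elim: c => [|c IH] lm; first by rewrite addn0; apply: f_lev_e; lia.
rewrite -[descend _ _ _ _ _]/(descend k m v t c * lev_b k m v (t + c)) rmorphM.
rewrite -[1 : KQ]mulr1 addnS; apply: spec_mul; last by apply: IH; lia.
  by rewrite /=; lia.
by apply: f_lev_b; lia.
Qed.

Lemma f_climb u y D p t : (t + plen p < m)%N -> spec u (ptgt p, t) y (f D) ->
  spec u (psrc p, t + plen p)%N ((y : KQ) * pb p) (f (climb k m (pword p) t * D)).
Proof.
move=> tm DS; move Ew : (pword p) => w; elim: w p Ew tm DS => [|a w IH] p pE tm DS.
  have pv : p = ptriv (psrc p) by exact: qpathP.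
  rewrite mul1r addn0 => i j; move: DS; rewrite {1}pv /ptgt /= => ->; case: ifP => // /andP[_ /eqP ju].
  rewrite pv rmorphM -scalerA; congr (_ *: _).
  by have := key_bid j; rewrite ju.
have [q [qs qw qt ps comp]] := path_cons pE.
rewrite -[climb _ _ _ _]/(lev_a k m a (t + size w) * climb k m w t) -mulrA rmorphM.
rewrite ps /= addnS.
have -> : (y : KQ) * pb p = ((y : KQ) * pb q) * pb (parr a).
  by rewrite -mulrA pbM comp.
have tm' : ((t + size w).+1 < m)%N by move: tm; rewrite pE /= addnS.
have tm2 : (t + size w < m)%N by exact: ltnW.
have S1 : spec u (hd a, t + size w)%N ((y : KQ) * pb q) (f (climb k m w t * D)).
  by rewrite -qs; apply: IH => //; rewrite ?qw ?qt.
exact: (spec_mul _ S1 (f_lev_a a tm')).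
Qed.

Lemma f_nform l l' p : (l < m)%N -> (l' < m)%N -> (plen p <= l' <= l + plen p)%N ->
  spec (ptgt p, l) (psrc p, l') (pb p) (f (nform k m l l' p)).
Proof.
move=> lm l'm val; rewrite /nform val; case/andP: val => pl' ll'.
have t1 : (l' - plen p + plen p = l')%N by lia.
have t2 : (l' - plen p + (l + plen p - l') = l)%N by lia.
have := @f_climb (ptgt p, l) (1 : KQ) (descend k m (ptgt p) (l' - plen p) (l + plen p - l')) p (l' - plen p).
rewrite t1 mul1r; apply => //.
by have := @f_descend (ptgt p) (l' - plen p) (l + plen p - l'); rewrite t2; exact.
Qed.

(** The paths whose normal forms contribute to the entry from i to j; [cut] is the projection of kQ
    onto their span. *)
Definition window i j (p : qpath Q) : palg k Q :=
  if [&& psrc p == (key j).1, ptgt p == (key i).1 &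
      (plen p <= (key j).2 <= (key i).2 + plen p)%N] then pb p else 0.
Definition cut i j (x : palg k Q) : palg k Q := lext (window i j) x.

Lemma cut_base i j p : cut i j (pb p) = window i j p.
Proof. exact: lext_base. Qed.

Lemma rp_sum (x : palg k Q) (F : qpath Q -> palg k Q) (M : lmodType R) (y : M) :
  rp (\sum_(p <- msupp x) x@_p *: F p) *: y =
  \sum_(p <- msupp x) kscal R x@_p *: (rp (F p) *: y).
Proof.
rewrite (big_morph rp (rmorphD rp) (rmorph0 rp)) scaler_suml.
by apply: eq_bigr => p _; rewrite rpZ scalerA.
Qed.

Lemma rp_cut i j x (y : N j) :
  rp (cut i j x) *: y = \sum_(p <- msupp x) kscal R x@_p *: (rp (window i j p) *: y).
Proof. exact: rp_sum. Qed.

Lemma entry_nlin_sum l l' x i j : entry (f (nlin m l l' x)) i j =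
  \sum_(p <- msupp x) kscal R x@_p *: entry (f (nform k m l l' p)) i j.
Proof.
rewrite nlinE (big_morph f (rmorphD f) (rmorph0 f)) entry_sum.
by apply: eq_bigr => p _; rewrite rmorphM fk entryZ.
Qed.

Lemma entry_nform l l' p i j : (l < m)%N -> (l' < m)%N ->
  entry (f (nform k m l l' p)) i j =
  if (l == (key i).2) && (l' == (key j).2) then rp (window i j p) *: g j else 0.
Proof.
move=> lm l'm; rewrite /window.
have [val|/negPf nval] := boolP (plen p <= l' <= l + plen p)%N.
  rewrite (f_nform lm l'm val); move: (key i) (key j) => [w n] [v n'].
  rewrite !xpair_eqE /= (eq_sym (psrc p)) (eq_sym (ptgt p)) (eq_sym l) (eq_sym l').
  have [->|_] := eqVneq n l; have [->|_] := eqVneq n' l'; rewrite ?andbF //.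
  rewrite val !andbT andbC; case: ifP => // _.
  by rewrite rmorph0 scale0r.
rewrite /nform nval rmorph0 entry0; case: ifP => // /andP[/eqP<- /eqP<-].
by rewrite nval !andbF rmorph0 scale0r.
Qed.

Lemma entry_nlin l l' x i j : (l < m)%N -> (l' < m)%N ->
  entry (f (nlin m l l' x)) i j =
  if (l == (key i).2) && (l' == (key j).2) then rp (cut i j x) *: g j else 0.
Proof.
move=> lm l'm; rewrite entry_nlin_sum rp_cut.
case cond : ((l == (key i).2) && (l' == (key j).2)); last first.
  by rewrite big1 // => p _; rewrite entry_nform // cond scaler0.
by apply: eq_bigr => p _; rewrite entry_nform // cond.
Qed.

Lemma entry_total (x : 'I_m -> 'I_m -> palg k Q) i j :
  entry (f (\sum_(l < m) \sum_(l' < m) nlin m l l' (x l l'))) i j =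
  rp (cut i j (x (tau i).2 (tau j).2)) *: g j.
Proof.
rewrite (big_morph f (rmorphD f) (rmorph0 f)) entry_sum.
pose h (l l' : 'I_m) : N j := if (l == (tau i).2) && (l' == (tau j).2)
  then rp (cut i j (x (tau i).2 (tau j).2)) *: g j else 0.
pose S (l : 'I_m) := \sum_(l' < m) h l l'.
have S0 l : l != (tau i).2 -> S l = 0.
  by move=> /negPf li; apply: big1 => l' _; rewrite /h li.
have S1 : S (tau i).2 = rp (cut i j (x (tau i).2 (tau j).2)) *: g j.
  rewrite /S (bigD1 (tau j).2) // big1 => [|l' /negPf lj]; last by rewrite /h andbC lj.
  by rewrite Monoid.mulm1 /h !eqxx.
have SE : \sum_l S l = S (tau i).2.
  by rewrite (bigD1 (tau i).2) //; rewrite big1 ?Monoid.mulm1.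
rewrite -S1 -SE; apply: eq_bigr => l _.
rewrite (big_morph f (rmorphD f) (rmorph0 f)) entry_sum; apply: eq_bigr => l' _.
apply: etrans (entry_nlin _ _ _ (ltn_ord l) (ltn_ord l')) _; rewrite /h.
have -> : ((l : nat) == (key i).2) = (l == (tau i).2) by [].
have -> : ((l' : nat) == (key j).2) = (l' == (tau j).2) by [].
case cond : ((l == (tau i).2) && (l' == (tau j).2)); last exact: erefl.
move/andP: cond => [/eqP hl /eqP hl'].
have e : x l l' = x (tau i).2 (tau j).2 by rewrite hl hl'.
by rewrite e.
Qed.

(** For p with a nonzero normal form, consider the entry between the layers of keys (ptgt p, l) and
    (psrc p, l'). It is a combination of paths modulo those of length above l'; as |p| <= l', the
    coefficient of p survives and must be 0. *)
Lemma f_inj z : f z = 0 -> z = 0.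
Proof.
have [x ->] := nilp_span z => fz0.
apply: big1 => l _; apply: big1 => l' _; rewrite nlinE big_seq big1 // => p _.
have [val|/negPf nval] := boolP (plen p <= l' <= l + plen p)%N; last first.
  by rewrite /nform nval mulr0.
have [i iE] := bij_onto tau_bij ((ptgt p, l) : vert SQ).
have [j jE] := bij_onto tau_bij ((psrc p, l') : vert SQ).
have /keyL cutl : rp (cut i j (x l l')) *: g j = 0.
  by have := entry_total x i j; rewrite fz0 iE jE entry0 => <-.
rewrite /key jE in cutl.
suff -> : (x l l')@_p = 0 by rewrite rmorph0 mul0r.
have pl : (plen p < l'.+1)%N by case/andP: val.
rewrite -(cutl p pl) (@cf_comp_r k Q p (ptriv (psrc p)) p); last first.
  by rewrite pcomp_trivr eqxx.
move: (x l l'); apply: (palg_ind (F := @cfl k Q p) (G := @cfl k Q p \o lext (window i j))) => q.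
rewrite -[RHS]/((cut i j (pb q))@_p) cut_base -[LHS]/((pb q)@_p) cf_base /window /key iE jE /=.
have [->|qp] := eqVneq q p; first by rewrite !eqxx val cf_base eqxx.
by case: ifP => _; rewrite ?cf_base ?(negPf qp) ?mcoeff0.
Qed.

Lemma corner_base p v w :
  ev w * ((pb p : KQ) * ev v) = if (psrc p == v) && (ptgt p == w) then pb p else 0.
Proof.
have [<-|pv] := eqVneq (psrc p) v; last by rewrite pb_triv_r0 1?eq_sym // mulr0.
rewrite pb_triv_r; have [<-|pw] := eqVneq (ptgt p) w; first exact: pb_triv_l.
by rewrite pb_triv_l0 1?eq_sym.
Qed.

(** The idempotents fix the endpoints, and paths longer than the level l_j of j vanish in N_j. If
    l_i + |p| < l_j, a path q of length l_i + 1 is attached at the end of p: it kills g_i, hence the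
    entry, while q p has length at most l_j and would survive. So p has coefficient 0. *)
Lemma entry_cut phi i j x : entry phi i j = rp x *: g j -> entry phi i j = rp (cut i j x) *: g j.
Proof.
move=> xE.
have yE : entry phi i j = rp (ev (key i).1 * ((x : KQ) * ev (key j).1)) *: g j.
  rewrite !rmorphM -!scalerA key_bid -xE.
  rewrite -[RHS]/(dproj j (rp (ev (key i).1) *: app phi (dinj (g i)))).
  by rewrite -(linearZ_LR (app phi)) -(linearZ_LR (@dinj _ _ _ i)) key_bid.
have x0 p : psrc p = (key j).1 -> ptgt p = (key i).1 -> ((key i).2 + plen p < (key j).2)%N ->
    x@_p = 0.
  move=> ps pt plt; have im : ((key i).2.+1 < m)%N by have := key_lt j; lia.
  have [_ [q [qs ql]]] : ((key i).2.+1 < m)%N /\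
      exists q, psrc q = (key i).1 /\ plen q = (key i).2.+1.
    by apply/(lt_plength k m0); rewrite full.
  have [r rE] : exists r, pcomp q p = Some r by apply: pcomp_ex; rewrite qs pt.
  have [_ rs _ rw] := pcomp_tgtE rE.
  have : rp (pb q) *: entry phi i j = 0.
    rewrite -[LHS]/(dproj j (rp (pb q) *: app phi (dinj (g i)))).
    rewrite -(linearZ_LR (app phi)) -(linearZ_LR (@dinj _ _ _ i)).
    have -> : rp (pb q) *: g i = 0 by apply/keyL; apply: FlMr; apply: Fl_base; rewrite ql.
    by rewrite !linear0.
  rewrite xE scalerA -rmorphM => /keyL yl.
  rewrite -(cf_comp x rE) -(@cf_comp_r k Q r (ptriv (key j).1) r); last first.
    by rewrite pcomp_trivr rs ps eqxx.
  by apply: yl; rewrite rw size_cat ql; lia.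
pose G p : palg k Q := ev (key i).1 * ((pb p : KQ) * ev (key j).1).
have cornerE : ev (key i).1 * ((x : KQ) * ev (key j).1) = \sum_(p <- msupp x) x@_p *: G p.
  rewrite -[LHS]/((pmul (ev (key i).1) \o pmulr (ev (key j).1)) x) {1}(palg_sum x).
  by rewrite linear_sum; apply: eq_bigr => p _; rewrite linearZ_LR.
apply: etrans yE _; rewrite cornerE.
apply: etrans (rp_sum x G (g j)) (etrans _ (esym (rp_cut i x (g j)))).
apply: eq_bigr => p _; rewrite /G corner_base /window.
have [ps|ps] := boolP (psrc p == (key j).1); last exact: erefl.
have [pt|pt] := boolP (ptgt p == (key i).1); last exact: erefl.
rewrite !andTb.
have [val|nval] := boolP (plen p <= (key j).2 <= (key i).2 + plen p)%N; first exact: erefl.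
rewrite (rmorph0 rp) scale0r scaler0.
have [pl|pl] := leqP (plen p) (key j).2; last first.
  have -> : rp (pb p) *: g j = 0 by apply/keyL; apply: FlMr; exact: Fl_base.
  exact: scaler0.
have lt : ((key i).2 + plen p < (key j).2)%N by move: nval; rewrite pl ltnNge.
by rewrite (x0 p (eqP ps) (eqP pt) lt) (rmorph0 (kscal R)) scale0r.
Qed.

(** Once the levels are fixed, the endpoints of a path determine i and j, so distinct pairs on the
    same levels have disjoint windows. *)
Lemma cut_window i j i' j' p : (key i').2 = (key i).2 -> (key j').2 = (key j).2 ->
  cut i j (window i' j' p) = if (i' == i) && (j' == j) then window i j p else 0.
Proof.
have c0 : cut i j 0 = 0 by exact: (linear0 (lext (window i j))).
move=> il jl; have [ii|ii] := eqVneq i' i; have [jj|jj] := eqVneq j' j.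
- rewrite ii jj andbT [window i j p in LHS]/window; case cond : [&& _, _ & _].
    exact: cut_base.
  by rewrite c0 /window cond.
all: rewrite /window; case cond : [&& psrc p == (key j').1, _ & _]; last exact: c0.
all: rewrite cut_base /window.
all: move/and3P: cond => [/eqP ps /eqP pt _].
all: case cond : [&& _, _ & _]; last exact: erefl.
all: move/and3P: cond => [/eqP ps' /eqP pt' _].
- case/eqP: jj; apply: key_inj; move: jl ps ps'; case: (key j) (key j') => [v l] [v' l'] /=.
  by move=> -> -> ->.
- case/eqP: ii; apply: key_inj; move: il pt pt'; case: (key i) (key i') => [v l] [v' l'] /=.
  by move=> -> -> ->.
case/eqP: ii; apply: key_inj; move: il pt pt'; case: (key i) (key i') => [v l] [v' l'] /=.
by move=> -> -> ->.
Qed.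

Lemma cut_cut i j i' j' x : (key i').2 = (key i).2 -> (key j').2 = (key j).2 ->
  cut i j (cut i' j' x) = if (i' == i) && (j' == j) then cut i j x else 0.
Proof.
move=> il jl; case cond : ((i' == i) && (j' == j)).
  move: x; apply: (palg_ind (F := lext (window i j) \o lext (window i' j'))
    (G := lext (window i j))) => p.
  rewrite -[LHS]/(cut i j (cut i' j' (pb p))) -[RHS]/(cut i j (pb p)) !cut_base.
  by rewrite cut_window // cond.
move: x; apply: (palg_ind (F := lext (window i j) \o lext (window i' j')) (G := \0)) => p.
rewrite -[LHS]/(cut i j (cut i' j' (pb p))) cut_base.
by rewrite cut_window // cond.
Qed.

Lemma f_onto : onto f.
Proof.
move=> phi.
have [X0 X0E] := choice (fun ij : idx * idx => key_gen (entry phi ij.1 ij.2)).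
pose X i j := cut i j (X0 (i, j)).
have XE i j : entry phi i j = rp (X i j) *: g j by exact: entry_cut (X0E (i, j)).
(* [nlin] only sees the two levels, so all entries between these levels are added up; the cuts
   separate them again. *)
pose x (l l' : 'I_m) := \sum_(ij : idx * idx |
  ((tau ij.1).2 == l) && ((tau ij.2).2 == l')) X ij.1 ij.2.
exists (\sum_(l < m) \sum_(l' < m) nlin m l l' (x l l')).
apply: entry_ext => i j; apply: etrans (entry_total x i j) (etrans _ (esym (XE i j))).
suff -> : cut i j (x (tau i).2 (tau j).2) = X i j by [].
rewrite -[LHS]/(lext (window i j) _) /x linear_sum (bigD1 (i, j)); last by rewrite /= !eqxx.
rewrite big1 => [|[i' j'] /andP[/andP[/eqP il /eqP jl] ij]].
  rewrite Monoid.mulm1; apply: etrans (cut_cut _ _ _) _ => //.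
  by rewrite !eqxx.
apply: etrans (cut_cut _ _ _) _; [by rewrite /key il|by rewrite /key jl|].
by move: ij; rewrite xpair_eqE => /negPf->.
Qed.

End Iso.

End EndoIso.

(** * Comparison of the quasi-hereditary structures *)

Section Transport.
Variables (k : fieldType) (A B : kalg k) (I J : finType) (BA : basic A I).
Variables (f : {rmorphism A -> B}) (t : J -> I).
Hypothesis fb : bijective f.
Hypothesis fk : forall c, f (kscal A c) = kscal B c.
Hypothesis tb : bijective t.

Definition transport_rad (y : B) := exists2 x, brad BA x & f x = y.

Let onto_f : onto f := bij_onto fb.

Let orth i j : f (bid BA (t i)) * f (bid BA (t j)) = if i == j then f (bid BA (t i)) else 0.
Proof.
by rewrite -rmorphM bid_orth (bij_eq tb); case: eqP => // _; rewrite rmorph0.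
Qed.

Let sum1 : \sum_j f (bid BA (t j)) = 1.
Proof.
rewrite -(rmorph1 f) -(bid_sum BA) (reindex t) ?rmorph_sum //.
exact: onW_bij.
Qed.

Let rad0 : transport_rad 0.
Proof. by exists 0; [exact: brad0|exact: rmorph0]. Qed.
Let radD x y : transport_rad x -> transport_rad y -> transport_rad (x + y).
Proof. by move=> [a ? <-] [b ? <-]; exists (a + b); [exact: bradD|exact: rmorphD]. Qed.
Let radMl x y : transport_rad y -> transport_rad (x * y).
Proof.
have [a <-] := onto_f x.
by move=> [b ? <-]; exists (a * b); [exact: bradMl|exact: rmorphM].
Qed.
Let radMr x y : transport_rad y -> transport_rad (y * x).
Proof.
have [a <-] := onto_f x.
by move=> [b ? <-]; exists (b * a); [exact: bradMr|exact: rmorphM].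
Qed.

Let split y : exists c : J -> k,
  transport_rad (y - \sum_j kscal B (c j) * f (bid BA (t j))).
Proof.
have [x <-] := onto_f y; have [c cP] := brad_split BA x.
exists (c \o t); exists (x - \sum_i kscal A (c i) * bid BA i) => //.
rewrite rmorphB rmorph_sum (reindex t); last exact: onW_bij.
by congr (_ - _); apply: eq_bigr => j _; rewrite rmorphM fk.
Qed.

Let nil : exists n, forall y : B^o, kill transport_rad n y.
Proof.
have [n nP] := brad_nil BA; exists n => y; have [x <-] := onto_f y.
elim: n x {nP} (nP x) => [|n IH] x /=; first by move=> ->; rewrite rmorph0.
move=> xn _ [a aJ <-]; have := IH (a * x) (xn a aJ).
by rewrite rmorphM.
Qed.

Let nrad j : ~ transport_rad (f (bid BA (t j))).
Proof. by move=> [x xJ /(bij_inj fb) xe]; apply: (@bid_nrad _ _ _ BA (t j)); rewrite -xe. Qed.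

Let fin : exists n (g : 'I_n -> B), forall x, exists c : 'I_n -> k,
  x = \sum_t kscal B (c t) * g t.
Proof.
have [n [g gP]] := basic_fin BA; exists n, (f \o g) => y; have [x <-] := onto_f y.
have [c ->] := gP x; exists c; rewrite rmorph_sum; apply: eq_bigr => s _.
by rewrite rmorphM fk.
Qed.

Definition transport_basic : basic B J :=
  @Basic k B J (fun j => f (bid BA (t j))) transport_rad (@orth) sum1 rad0 (@radD)
    (@radMl) (@radMr) (@split) nil (@nrad) fin.

End Transport.

(** The hypothesis makes e the projector onto the j-th summand, so an element of the left ideal of e
    is determined by its restriction to that summand. *)
Lemma homl_lideal (A : pzRingType) (I : finType) (M : I -> lmodType A) j
    (e : endo (dsum M)) : (forall x : dsum M, e x = dinj (x j)) ->
  miso (homl (dsum M) (M j)) (lideal e).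
Proof.
move=> eE; apply: miso_sym.
pose r (x : lideal e) : homl (dsum M) (M j) :=
  hom_comp (val x : hom (dsum M) (dsum M)) (mkhom (@dinj A I M j)).
have rl : linear r by move=> a x y; apply: homP.
exists (mklin rl); apply: lin_bij => [x x0|h].
  have [a aE] := lidP x; apply: val_inj; apply: homP => y.
  have xe : (val x : hom (dsum M) (dsum M)) (dinj (y j)) = 0.
    exact: (congr1 (fun h : hom (M j) (dsum M) => h (y j)) x0).
  rewrite aE /= -[LHS]/((a : hom (dsum M) (dsum M)) ((e : hom (dsum M) (dsum M)) y)) eE.
  rewrite -[LHS]/((a : hom (dsum M) (dsum M)) (dinj (y j))) -xe aE.
  rewrite -[RHS]/((a : hom (dsum M) (dsum M)) ((e : hom (dsum M) (dsum M)) (dinj (y j)))) eE.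
  by rewrite dinjE.
exists (lid e (hom_comp (h : hom (M j) (dsum M)) (mkhom (@dproj A I M j)) : endo (dsum M))).
apply: homP => y.
rewrite -[LHS]/((h : hom (M j) (dsum M)) ((e : hom (dsum M) (dsum M)) (dinj y) j)) eE.
by rewrite !dinjE.
Qed.

Section Comparison.
Variables (k : fieldType) (Q : quiver) (m : nat).
Hypothesis m0 : (0 < m)%N.
Local Notation KQ := (path_alg k Q).
Local Notation R := (trunc_alg k Q m).
Local Notation SQ := (staircase Q m).
Local Notation Nm := (nilp_alg k Q m).
Local Notation rp := (qproj (ideal_exp (arrow_ideal k Q) m)).
Local Notation np := (qproj (idealgen (@nilp_rel k Q m))).
Local Notation pb := (@pbase k Q).
Local Notation ev v := (pb (ptriv v) : KQ).
Local Notation plength v := (@plength k Q m v).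
Variable N : adr R.

(** Any realization of ADR is indexed by the pairs (v, l) with l < [plength v]: irredundance gives
    injectivity of tau, completeness shows that all these pairs occur. *)
Lemma adr_layers : exists tau : adr_idx N -> vert SQ,
  [/\ injective tau, forall j, ((tau j).2 < plength (tau j).1)%N,
      forall u : vert SQ, (u.2 < plength u.1)%N -> exists j, tau j = u &
      exists g : forall j, adr_mod j, forall j, layer (tau j).1 (tau j).2.+1 (g j)].
Proof.
have H (j : adr_idx N) : exists u : vert SQ, (u.2 < plength u.1)%N /\
    exists g : adr_mod j, layer u.1 u.2.+1 g.
  have [v [l [g [lv gL]]]] := add_layers_classify m0 (adr_indec j) (adr_add j).
  by exists (v, l); split=> //; exists g.
have [tau tauP] := choice H.
have [g gL] : exists g : forall j, adr_mod j, forall j, layer (tau j).1 (tau j).2.+1 (g j).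
  have gP j := cid (proj2 (tauP j)).
  by exists (fun j => sval (gP j)) => j; exact: svalP (gP j).
exists tau; split; last by exists g.
- move=> i j ij; apply: adr_irredundant; have := gL j; rewrite -ij => gLj.
  exact: layer_miso (gL i) gLj.
- by move=> j; have [] := tauP j.
move=> [v l] /= lv.
have [j [h hb]] := adr_complete N (layer_mod_indec m0 lv) (layer_mod_add m0 lv).
have [h' h'L] := miso_layer_gen (ex_intro _ h hb) (layer_mod_layer k m0 v (ltn_ord l)).
exists j; have [||vE lE] := layer_uniq m0 _ _ (gL j) h'L; [by have [] := tauP j|by []|].
by move: vE lE; case: (tau j) => [v' l'] /= -> [] /val_inj ->.
Qed.

Lemma qh_iso_full : qh_iso (nilp_quiver_alg k Q m) (adr_alg N) ->
  forall v : vert Q, plength v = m.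
Proof.
move=> [f [_ _ [sigma [sb _]]]] v; have [tau [tinj tlt _ _]] := adr_layers.
have ts : injective (tau \o sigma) by exact: inj_comp tinj (bij_inj sb).
have lm : (m.-1 < m)%N by rewrite prednK.
(* An injective self-map of the finite vertex set of the staircase is onto, so the top level m - 1
   over v occurs as a layer. *)
have [h _ Kh] := injF_bij ts.
have := tlt (sigma (h (v, Ordinal lm))); have /= -> := Kh (v, Ordinal lm).
by have := plength_le k m0 v; rewrite /=; lia.
Qed.

Hypothesis full : forall v : vert Q, plength v = m.

(** [adr_layer] asks for some presentation as R e / rad^l; by [layer_uniq] the exponent does not
    depend on it, so the relation is a function. *)
Lemma adr_layerE (tau : adr_idx N -> vert SQ) (g : forall j, adr_mod j) j d :
  (forall j, layer (tau j).1 (tau j).2.+1 (g j)) ->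
  adr_layer j d <-> d = (m - (tau j).2.+1)%N.
Proof.
move=> gL.
have RE : loewy_length (R^o : lmodType R) = m.
  apply/eqP; rewrite eqn_leq (loewy_trunc m0).
  by have := plength_trunc k m0 (tau j).1; rewrite full.
split=> [[e [l [eprim /andP[l0 le] jl ->]]]|->].
  have lm : (l <= m)%N by apply: (leq_trans le); exact: loewy_trunc.
  have [w [h [eE hL]]] := primitive_layer m0 eprim lm.
  rewrite full (minn_idPl lm) in hL.
  have [h' h'L] := miso_layer_gen (miso_sym jl) hL.
  have tm : (0 < (tau j).2.+1 <= plength (tau j).1)%N by rewrite full /=; exact: ltn_ord.
  have wm : (0 < l <= plength w)%N by rewrite full l0.
  by have [_ <-] := layer_uniq m0 tm wm (gL j) h'L; rewrite RE.
exists (rp (ev (tau j).1) : R), (tau j).2.+1; split.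
- exact: (bid_primitive (trunc_basic k Q m0)).
- by rewrite /= -/(plength (tau j).1) full; exact: ltn_ord.
- exact: layer_miso (gL j) (layer_mod_layer k m0 (tau j).1 (ltn_ord (tau j).2)).
by rewrite RE.
Qed.

Lemma full_qh_iso : qh_iso (nilp_quiver_alg k Q m) (adr_alg N).
Proof.
have [tau [tinj tlt tonto [g gL]]] := adr_layers.
have tb : bijective tau.
  have [sigma sigmaK] := choice (fun u => tonto u (leq_trans (ltn_ord u.2) (eq_leq (esym (full u.1))))).
  by exists sigma => // j; apply: tinj.
have [f [fk fv fa]] := nilp_to_endo tb gL.
have fbij : bijective f.
  have fo := f_onto m0 full tb gL fk fv fa.
  have fi := f_inj m0 tb gL fk fv fa.
  have [h hK] := choice fo; exists h => // z.
  apply/eqP; rewrite -subr_eq0; apply/eqP/fi.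
  by rewrite rmorphB hK subrr.
pose X := nilp_quiver_alg k Q m; pose Y := adr_alg N.
pose BX : basic X (st_idx X) := nilp_basic k Q m.
(* Transport along f, indexed through tau, makes f match the idempotents by construction. *)
pose BY : basic Y (st_idx Y) := @transport_basic k X Y (st_idx X) (st_idx Y) BX f tau fbij fk tb.
have [sigma tK sK] := tb.
have sb : bijective sigma by exists tau.
exists f; split=> //; exists sigma; split=> // i.
have simX u : miso (st_simple u) (topmod (lideal (bid BX u))) by exact: miso_refl.
(* The image of the idempotent at tau j is the projector onto the j-th summand, so its left ideal is
   Hom(N_j, ADR), whose top is the simple module indexed by j. *)
have simY j : miso (st_simple j) (topmod (lideal (bid BY j))).
  apply: (miso_layer BY 1); apply: (homl_lideal (e := bid BY j)) => x.
  have S1 := fv (tau j).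
  have -> : bid BY j = f (np (pbase k (ptriv (tau j)))) by [].
  have pE : f (np (pbase k (ptriv (tau j)))) =
      (mkhom (@dinj R _ _ j \o @dproj R _ _ j) : endo (adr_sum N)).
    apply: (entry_ext gL) => i1 i2; rewrite S1.
    rewrite -[RHS]/(dinj (dinj (g i1) j) i2).
    have kE i3 : (key tau i3 == skey (tau j)) = (i3 == j).
      by apply/eqP/eqP => [/skey_inj/tinj|->].
    rewrite !kE; have [->|ij] := eqVneq i1 j; last first.
      have -> : dinj (g i1) j = 0 by exact: dinjN.
      by rewrite linear0.
    rewrite dinjE; have [->|ij] := eqVneq i2 j.
      by rewrite dinjE rmorph1 scale1r.
    by rewrite dinjN // eq_sym.
  by rewrite pE.
have le (u u' : vert SQ) : @st_le k X u u' <-> @st_le k Y (sigma u) (sigma u').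
  have dE (u0 : vert SQ) : (m - (tau (sigma u0)).2.+1)%N = (m - u0.2.+1)%N by rewrite sK.
  split=> [[->|lt]|[/(bij_inj sb)->|]]; [by left| |by left|].
    right; exists (m - u.2.+1)%N, (m - u'.2.+1)%N.
    by split=> //; apply/(adr_layerE _ _ gL); rewrite dE.
  move=> [c [d [/(adr_layerE _ _ gL) cE /(adr_layerE _ _ gL) dE' cd]]]; right.
  have h : (m - u.2.+1 < m - u'.2.+1)%N by rewrite -(dE u) -(dE u') -cE -dE'.
  exact: h.
have fe u : f (bid BX u) = bid BY (sigma u) by rewrite -{1}(sK u).
(* One standard module over the endomorphism algebra is enough: its pullback is standard over the
   nilpotent quiver algebra, and the required isomorphism is the identity. *)
have [D' [d' dP]] := std_pres_exists BY (sigma i).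
exists (pullback f D'), D'; split.
- apply: (@std_pres_standard _ _ BX simX i _ (d' : pullback f D')).
  exact: (@std_pres_pullback k X Y BX BY f sigma fbij sb fe le i D' d' dP).
- exact: (std_pres_standard simY dP).
exact: miso_refl.
Qed.

End Comparison.

Theorem proposition6p15 (k : closedFieldType) (Q : quiver) (m : nat)
    (hm : (0 < m)%N) :
  let R := trunc_alg k Q m in
  let projectives_have_length_m :=
    forall P : lmodType R,
      fingen P -> indecomposable P -> projective P -> loewy_length P = m in
  inhabited (adr R) /\
  (forall N : adr R,
      qh_iso (nilp_quiver_alg k Q m) (adr_alg N) <-> projectives_have_length_m) /\
  (projectives_have_length_m <->
     (forall v : vert Q, exists a : arr Q, tl a = v) \/ m = 1%N).
Proof.
move=> R len; split; first exact: adr_inhabited.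
have fullE : (forall v : vert Q, plength k m v = m) <-> len.
  split=> [full P|h v]; first exact: projective_loewy.
  exact: (projective_plength hm).
split=> [N|].
  split=> [/(qh_iso_full hm)/fullE //|/fullE full].
  exact: full_qh_iso.
split=> [/fullE/(plength_full k Q hm) //|nosink].
exact/fullE/(plength_full k Q hm).
Qed.
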